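(* Let $p>1$ and let $\Omega$ be a bounded domain in the Heisenberg group $\mathcal{H}^n$. For $i=1,2$ let $u_i\in D^{1,p}_0(\Omega)$ be such that $-\Delta_p u_i=\mu_i$, where $\mu_i>0$ is a bounded Radon measure, with $u_i|_{\partial\Omega}=0$, $u_i\ge 0$ a.e. in $\Omega$ and $u_i\not\equiv 0$. Then $$\int_{\Omega}\left(-\frac{\Delta_p u_1}{u_1^{p-1}}+\frac{\Delta_p u_2}{u_2^{p-1}}\right)(u_1^p-u_2^p)\ge 0.$$
   Context: The Heisenberg group $\mathcal{H}^n$ is $\mathbb{R}^{2n+1}$ with points $(x,y,t)$, $x,y\in\mathbb{R}^n$, $t\in\mathbb{R}$, and group law $(x,y,t)\cdot(x',y',t')=(x+x',y+y',t+t'+2(\langle y,x'\rangle-\langle x,y'\rangle))$, where $\langle\cdot,\cdot\rangle$ is the standard inner product of $\mathbb{R}^n$. Its left-invariant vector fields include $\mathcal{X}_i=\frac{\partial}{\partial x_i}+2y_i\frac{\partial}{\partial t}$ and $\mathcal{Y}_i=\frac{\partial}{\partial y_i}-2x_i\frac{\partial}{\partial t}$, $i=1,\dots,n$. The symbol $\nabla$ denotes the horizontal gradient $\nabla_H=(\mathcal{X}_1,\dots,\mathcal{X}_n,\mathcal{Y}_1,\dots,\mathcal{Y}_n)$, and $\Delta_p$ denotes the $p$-sub-Laplacian $\Delta_{p}u=\nabla_H\cdot(|\nabla_H u|^{p-2}\nabla_H u)$, understood in the weak (distributional) sense. The space $D^{1,p}_0(\Omega)$ is the closure of $C_0^\infty(\Omega)$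 with respect to the norm $\|u\|_{D^{1,p}_0(\Omega)}=\left(\int_\Omega|\nabla_H u|^p\,dx\,dy\,dt\right)^{1/p}$; the condition $u_i|_{\partial\Omega}=0$ is expressed by $u_i\in D^{1,p}_0(\Omega)$. In the integral, $-\Delta_p u_i$ stands for the measure $\mu_i$, i.e. the left-hand side is $\int_\Omega \frac{u_1^p-u_2^p}{u_1^{p-1}}\,d\mu_1-\int_\Omega\frac{u_1^p-u_2^p}{u_2^{p-1}}\,d\mu_2$. *)

(* Defs.v *)
From HB Require Import structures.
From mathcomp Require Import all_boot all_order all_algebra.
From mathcomp Require Import all_classical all_reals all_analysis.
Set Implicit Arguments.
Unset Strict Implicit.
Unset Printing Implicit Defensive.
Import Order.TTheory GRing.Theory Num.Theory numFieldNormedType.Exports.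
Local Open Scope classical_set_scope.
Local Open Scope ring_scope.

(* The Borel sigma-algebra of R^n, presented as the one generated by the
   coordinate functions (as the library does for n.-tuple T). *)
Section rV_measurable.
Context {R : realType} (n : nat).

Definition rV_coord (i : 'I_n) (v : 'rV[R]_n) : R := v ord0 i.

Let rV_set0 : g_sigma_preimage rV_coord set0.
Proof. exact: sigma_algebra0. Qed.

Let rV_setC A : g_sigma_preimage rV_coord A -> g_sigma_preimage rV_coord (~` A).
Proof. exact: sigma_algebraC. Qed.

Let rV_bigcup (F : _^nat) : (forall i, g_sigma_preimage rV_coord (F i)) ->
  g_sigma_preimage rV_coord (\bigcup_i (F i)).
Proof. exact: sigma_algebra_bigcup. Qed.

HB.instance Definition _ := @isMeasurable.Build default_measure_display
  'rV[R]_n (g_sigma_preimage rV_coord) rV_set0 rV_setC rV_bigcup.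

Lemma measurable_rV_coord (i : 'I_n) : measurable_fun setT (rV_coord i).
Proof.
move=> _ Y mY; rewrite setTI; apply: sub_sigma_algebra => /=.
rewrite -bigcup_seq/=; exists i => /=; first by rewrite mem_index_enum.
by exists Y => //; rewrite setTI.
Qed.

Lemma measurable_fun_rV d (T : measurableType d) (f : T -> 'rV[R]_n) :
  (forall i, measurable_fun setT (fun z => f z ord0 i)) -> measurable_fun setT f.
Proof.
move=> mf.
suff H : g_sigma_preimage rV_coord `<=` [set A | measurable (f @^-1` A)].
  by move=> _ A mA; rewrite setTI; exact: H.
apply: smallest_sub.
  split => /=.
  - by rewrite preimage_set0.
  - by move=> A mA; rewrite setTD preimage_setC; exact: measurableC.
  - by move=> F mF; rewrite preimage_bigcup; exact: bigcupT_measurable.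
rewrite -bigcup_seq/= => A [i _ [B mB <-]] /=; rewrite setTI.
by have := mf i measurableT B mB; rewrite setTI.
Qed.

End rV_measurable.

(* The library's own instance is shadowed by the one for subprobabilities. *)
Lemma product_sigma_finite d1 d2 (T1 : measurableType d1)
    (T2 : measurableType d2) (R : realType)
    (m1 : {measure set T1 -> \bar R})
    (m2 : {sigma_finite_measure set T2 -> \bar R}) :
  sigma_finite setT m1 -> sigma_finite setT (m1 \x m2)%E.
Proof.
move=> /sigma_finiteP[F [TF ndF Foo]].
have /sigma_finiteP[G [TG ndG Goo]] := sigma_finiteT m2.
exists (fun n => F n `*` G n).
  rewrite -setXTT TF TG predeqE => -[x y]; split.
    move=> [/= [n _ Fnx] [k _ Gky]]; exists (maxn n k) => //; split.
    - by move: x Fnx; exact/subsetPset/ndF/leq_maxl.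
    - by move: y Gky; exact/subsetPset/ndG/leq_maxr.
  by move=> [n _ []/= ? ?]; split; exists n.
move=> k; have [? ?] := Foo k; have [? ?] := Goo k.
split; first exact: measurableX.
by rewrite product_measure1E// lte_mul_pinfty// ge0_fin_numE.
Qed.

(* Lebesgue measure on R^n, by recursion on n: the image of the product of the
   one-dimensional Lebesgue measure with the Lebesgue measure of R^n under the
   identification R x R^n = R^(n+1). *)
Section rV_lebesgue.
Context {R : realType}.

Definition rV_cons n (z : R * 'rV[R]_n) : 'rV[R]_n.+1 :=
  \row_i oapp (z.2 ord0) z.1 (unlift ord0 i).

Lemma measurable_rV_cons n : measurable_fun setT (@rV_cons n).
Proof.
apply: measurable_fun_rV => i; case: (unliftP ord0 i) => [j|] ->.
- rewrite (_ : (fun _ => _) = @rV_coord R n j \o snd); last first.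
    by apply/funext => z /=; rewrite mxE liftK.
  by apply: measurableT_comp; [exact: measurable_rV_coord|exact: measurable_snd].
- rewrite (_ : (fun _ => _) = fst); first exact: measurable_fst.
  by apply/funext => z /=; rewrite mxE unlift_none.
Qed.

Definition rV_uncons n (v : 'rV[R]_n.+1) : R * 'rV[R]_n :=
  (v ord0 ord0, \row_i v ord0 (lift ord0 i)).

Lemma rV_consK n : cancel (@rV_cons n) (@rV_uncons n).
Proof.
move=> [a v]; rewrite /rV_uncons /rV_cons mxE unlift_none /=; congr pair.
by apply/rowP => i; rewrite !mxE liftK.
Qed.

Lemma measurable_rV_uncons n : measurable_fun setT (@rV_uncons n).
Proof.
apply/measurable_fun_pairP; split; first exact: measurable_rV_coord.
apply: measurable_fun_rV => i.
rewrite (_ : (fun _ => _) = @rV_coord R n.+1 (lift ord0 i)).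
  exact: measurable_rV_coord.
by apply/funext => v /=; rewrite mxE.
Qed.

Section step.
Variables (n : nat) (mu : {sigma_finite_measure set 'rV[R]_n -> \bar R}).

Definition rV_lebesgueS : set 'rV[R]_n.+1 -> \bar R :=
  pushforward (lebesgue_measure \x mu)%E (@rV_cons n).

Let m : {measure set 'rV[R]_n.+1 -> \bar R} :=
  measure_function_pushforward__canonical__measure_function_Measure
    (lebesgue_measure \x mu)%E (@measurable_rV_cons n).

HB.instance Definition _ := isMeasure.Build _ _ _ rV_lebesgueS
  (measure0 m) (measure_ge0 m) (@measure_semi_sigma_additive _ _ _ m).

Let rV_lebesgueS_sigma_finite : sigma_finite setT rV_lebesgueS.
Proof.
have [F TF Foo] :=
  product_sigma_finite mu (sigma_finiteT (@lebesgue_measure R)).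
exists (fun k => @rV_uncons n @^-1` F k); first by rewrite -preimage_bigcup -TF.
move=> k; have [mF Fk] := Foo k; split.
  by rewrite -[X in measurable X]setTI; exact: measurable_rV_uncons.
rewrite /rV_lebesgueS /pushforward [X in (_ \x _)%E X](_ : _ = F k) //.
by apply/seteqP; split => z /=; rewrite rV_consK.
Qed.

HB.instance Definition _ := Measure_isSigmaFinite.Build _ _ _ rV_lebesgueS
  rV_lebesgueS_sigma_finite.

End step.

Fixpoint rV_lebesgue n : {sigma_finite_measure set 'rV[R]_n -> \bar R} :=
  match n with
  | 0 => \d_ (0 : 'rV[R]_0)
  | n'.+1 => rV_lebesgueS (rV_lebesgue n')
  end.

End rV_lebesgue.

(* Points of the Heisenberg group H^n = R^(2n+1), written ((x, y), t); its Borel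
   sigma-algebra and its topology are the product ones. *)
Notation heis R n := ('rV[R]_n * 'rV[R]_n * R)%type.

Section heisenberg.
Context {R : realType} {n : nat}.
Local Notation H := (heis R n).

(* The Haar measure dx dy dt. *)
Definition heis_lebesgue : set H -> \bar R :=
  (rV_lebesgue n \x rV_lebesgue n \x lebesgue_measure)%E.

Let m2 : {measure set ('rV[R]_n * 'rV[R]_n)%type -> \bar R} :=
  (rV_lebesgue n \x rV_lebesgue n)%E.

Let m : {measure set ('rV[R]_n * 'rV[R]_n * measurableTypeR R)%type -> \bar R} :=
  (m2 \x lebesgue_measure)%E.

HB.instance Definition _ := isMeasure.Build _ H R heis_lebesgue
  (measure0 m) (measure_ge0 m) (@measure_semi_sigma_additive _ _ _ m).

Let heis_lebesgue_sigma_finite : sigma_finite setT heis_lebesgue.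
Proof.
exact: (product_sigma_finite (@lebesgue_measure R)
  (product_sigma_finite (m1 := rV_lebesgue n) (rV_lebesgue n)
    (sigma_finiteT (rV_lebesgue n)))).
Qed.

HB.instance Definition _ := Measure_isSigmaFinite.Build _ H R heis_lebesgue
  heis_lebesgue_sigma_finite.

Definition bounded_domain (Omega : set H) : Prop :=
  [/\ open Omega, connected Omega, Omega !=set0 & bounded_set Omega].

(* The left-invariant vector fields d/dx_i + 2 y_i d/dt and d/dy_i - 2 x_i d/dt. *)
Definition fieldX (i : 'I_n) (f : H -> R) (z : H) : R :=
  'D_((delta_mx 0 i, 0, 0) : H) f z
  + 2 * z.1.2 ord0 i * 'D_((0, 0, 1) : H) f z.

Definition fieldY (i : 'I_n) (f : H -> R) (z : H) : R :=
  'D_((0, delta_mx 0 i, 0) : H) f z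
  - 2 * z.1.1 ord0 i * 'D_((0, 0, 1) : H) f z.

Definition hgrad (f : H -> R) (z : H) : 'rV[R]_(n + n) :=
  row_mx (\row_i fieldX i f z) (\row_i fieldY i f z).

Definition dotv m (v w : 'rV[R]_m) : R := \sum_i v ord0 i * w ord0 i.

Definition enorm m (v : 'rV[R]_m) : R := Num.sqrt (dotv v v).

(* C^oo: every iterated directional derivative is Frechet differentiable. *)
Fixpoint iter_dir_derive (s : seq H) (f : H -> R) : H -> R :=
  if s is v :: s' then 'D_v (iter_dir_derive s' f) else f.

Definition smooth (f : H -> R) : Prop :=
  forall (s : seq H) (z : H), differentiable (iter_dir_derive s f) z.

Definition test_function (Omega : set H) (f : H -> R) : Prop :=
  [/\ smooth f, compact (closure [set z | f z != 0]) &
      closure [set z | f z != 0] `<=` Omega].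

(* Du is the weak horizontal gradient of u: the fields X_i, Y_i are
   divergence-free, hence formally skew-adjoint. *)
Definition weak_hgrad (Omega : set H) (u : H -> R) (Du : H -> 'rV[R]_(n + n)) :
    Prop :=
  forall f, test_function Omega f -> forall i : 'I_(n + n),
    (\int[heis_lebesgue]_(z in Omega) (u z * hgrad f z ord0 i)%:E =
     - \int[heis_lebesgue]_(z in Omega) (Du z ord0 i * f z)%:E)%E.

Definition Lp_energy (p : R) (Omega : set H) m (F : H -> 'rV[R]_m) : \bar R :=
  (\int[heis_lebesgue]_(z in Omega) (enorm (F z) `^ p)%:E)%E.

(* u is in L^p(Omega), with weak horizontal gradient Du in L^p(Omega). *)
Record horizontal_sobolev (p : R) (Omega : set H) (u : H -> R)
    (Du : H -> 'rV[R]_(n + n)) : Prop := {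
  sobolev_measurable : measurable_fun Omega u ;
  sobolev_measurable_grad :
    forall i, measurable_fun Omega (fun z => Du z ord0 i) ;
  sobolev_Lp :
    (\int[heis_lebesgue]_(z in Omega) (`|u z| `^ p)%:E < +oo)%E ;
  sobolev_Lp_grad : (Lp_energy p Omega Du < +oo)%E ;
  sobolev_weak_hgrad : weak_hgrad Omega u Du
}.

(* u is in D^{1,p}_0(Omega), with horizontal gradient Du.  Gradient convergence
   alone determines u only up to a constant.  On a bounded Omega the Poincare
   inequality makes a gradient-Cauchy sequence of test functions converge in
   L^p(Omega), and u is that limit. *)
Definition D1p0 (p : R) (Omega : set H) (u : H -> R)
    (Du : H -> 'rV[R]_(n + n)) : Prop :=
  horizontal_sobolev p Omega u Du /\
  exists f : nat -> H -> R,
    [/\ forall k, test_function Omega (f k),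
        (fun k => Lp_energy p Omega (fun z => hgrad (f k) z - Du z))
          @ \oo --> 0%E &
        (fun k => \int[heis_lebesgue]_(z in Omega)
          (`|f k z - u z| `^ p)%:E)%E @ \oo --> 0%E].

(* - div_H (|Du|^(p-2) Du) = mu in the sense of distributions on Omega.  Where
   Du = 0 the integrand is 0 for every p > 1, whatever the value of 0 `^ (p - 2). *)
Definition pLaplace_eq (p : R) (Omega : set H) (Du : H -> 'rV[R]_(n + n))
    (mu : set H -> \bar R) : Prop :=
  forall f, test_function Omega f ->
    (\int[heis_lebesgue]_(z in Omega)
       (enorm (Du z) `^ (p - 2) * dotv (Du z) (hgrad f z))%:E =
     \int[mu]_(z in Omega) (f z)%:E)%E.

(* The p-capacity of E relative to Omega. *)
Definition pcapacity (p : R) (Omega E : set H) : \bar R :=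
  ereal_inf [set e | exists (v : H -> R) (Dv : H -> 'rV[R]_(n + n)) (U : set H),
    [/\ D1p0 p Omega v Dv,
        [/\ open U, E `<=` U & U `<=` Omega],
        {ae heis_lebesgue, forall z, U z -> 1 <= v z} &
        e = Lp_energy p Omega Dv]].

(* An element of D^{1,p}_0(Omega) is an a.e. class, but has a quasicontinuous
   representative, unique up to sets of capacity zero; solutions of
   pLaplace_eq force mu to vanish on such sets, so that this representative can
   be integrated against mu. *)
Definition quasicontinuous (p : R) (Omega : set H) (u : H -> R) : Prop :=
  forall e : R, 0 < e -> exists U : set H,
    [/\ open U, U `<=` Omega, (pcapacity p Omega U < e%:E)%E &
        {within Omega `\` U, continuous u}].

End heisenberg.

(* Main.v *)
(* Let E_i be the integral of |grad u_i|^p.  Testing the i-th equation with u_i shows that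
   the integral of u_i against mu_i is E_i, and Picone's inequality, obtained by testing it
   with u_j^p / u_i^(p-1), bounds the integral of u_j^p / u_i^(p-1) against mu_i by E_j.
   So the first integral of the theorem is at least E_1 - E_2 and the second is at most
   E_1 - E_2.  The convention a / 0 = 0 at zeros of u_i only changes the integrals in the
   favourable direction, so no strong maximum principle is needed.

   These test functions are limits of smooth ones.  For a test function f, the integral of
   |f| against mu_i is at most a constant times the L^p norm of grad f; hence mu_i charges
   an open set O as little as one wants if some function of small energy is at least 1 on O.
   Applied to the sets where a quasicontinuous u differs from its smooth approximations,
   together with exceptional sets of small capacity, this gives convergence mu_i-a.e. of
   the approximations.  Absolute values and powers are regularized by r |-> (r^2 + s^2)^q,
   which keeps all test functions smooth. *)
From HB Require Import structures.
Require Import Defs.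
From mathcomp Require Import all_boot all_order all_algebra.
From mathcomp Require Import all_classical all_reals all_analysis.
From mathcomp Require Import measurable_realfun ring lra.
Set Implicit Arguments.
Unset Strict Implicit.
Unset Printing Implicit Defensive.
Import Order.TTheory GRing.Theory Num.Theory numFieldNormedType.Exports.
Local Open Scope classical_set_scope.
Local Open Scope ring_scope.

(** * Smooth functions of one real variable *)

(** The obstacle is that the facts on [u_i] and on capacitary potentials hold only Lebesgue-a.e.,
    while they are needed [mu]-a.e., and [mu] may be singular. Smooth approximations of a potential
    that is at least 1 a.e. on an open set may still be small on a Lebesgue-small part of it that
    carries much of [mu], so Chebyshev's inequality for them under [mu] says nothing. The bridge is
    the test function [phi^2 * damp m f1 f2], with [phi] a cutoff of the open set. On the Lebesgue
    side the limit in [f1], [f2] is taken first, and the factor is then tiny because the limits are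
    large. On the [mu] side a pointwise inequality bounds [phi^2] by this test function plus
    [|f1| + |f2|]. A rational damping takes the place of a truncation, which would not be smooth. It
    has two arguments, since a maximum would not be smooth either: one serves the exceptional set of
    a quasicontinuous function, the other the set where that function is bad, and it is their union
    that is open. *)

Section smooth_real.
Context {R : realType}.
Implicit Types g : R -> R.

(** A coinductive notion: a set of functions stable under differentiation serves as a certificate.
    This spares all formulas for higher derivatives. *)
Definition smoothR g := exists2 C : set (R -> R), C g &
  forall h, C h -> exists2 h' : R -> R, C h' & forall x : R, is_derive x (1:R) h (h' x).

Lemma smoothR_derive g : smoothR g ->
  exists2 g' : R -> R, smoothR g' & forall x : R, is_derive x (1:R) g (g' x).
Proof.
by move=> [C Cg dC]; have [g' Cg' dg] := dC _ Cg; exists g' => //; exists C.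
Qed.

Definition lin_comb (I : Type) (B : I -> R -> R) (l : seq (R * I)) : R -> R :=
  fun x => \sum_(c <- l) c.1 * B c.2 x.

(** The linear span of the family is the certificate, so only the first derivatives of its members
    have to be expressed in the family. *)
Lemma smoothR_basis (I : Type) (B : I -> R -> R) :
  (forall i, exists l, forall x : R, is_derive x (1:R) (B i) (lin_comb B l x)) ->
  forall i, smoothR (B i).
Proof.
move=> dB i; exists [set h | exists l, h = lin_comb B l].
  exists [:: (1, i)]; apply/funext => x.
  by rewrite /lin_comb big_seq1 mul1r.
move=> _ [l ->]; elim: l => [|[c j] l [_ [l' ->] IH]].
  exists (lin_comb B [::]); first by exists [::].
  move=> x; rewrite (_ : lin_comb B [::] = cst 0).
    exact: is_derive_cst.
  by apply/funext => y; rewrite /lin_comb big_nil.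
have [lj Bj] := dB j.
exists (lin_comb B ([seq (c * d.1, d.2) | d <- lj] ++ l')); first by eexists.
move=> x; rewrite (_ : lin_comb B ((c, j) :: l) = (c *: B j) + lin_comb B l); last first.
  by apply/funext => y; rewrite /lin_comb big_cons /= /GRing.scale /=.
apply: (is_derive_eq (is_deriveD (is_deriveZ c (Bj x)) (IH x))).
rewrite /lin_comb big_cat /= big_map /= /GRing.scale /= mulr_sumr.
by congr +%R; apply: eq_bigr => d _; rewrite mulrA.
Qed.

Lemma is_derive_sqrD_powR (s q x : R) : 0 < s ->
  is_derive x 1 (fun r => (r ^+ 2 + s ^+ 2) `^ q)
   (2 * q * x * (x ^+ 2 + s ^+ 2) `^ (q - 1)).
Proof.
move=> s0; have xs : 0 < x ^+ 2 + s ^+ 2 by rewrite ltr_wpDl ?sqr_ge0 ?exprn_gt0.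
have d1 : is_derive x 1 (fun r : R => r ^+ 2 + s ^+ 2) (2 * x).
  apply: (is_derive_eq (is_deriveD (is_deriveX 2 (is_derive_id x 1)) (is_derive_cst (s ^+ 2) x 1))).
  by rewrite /GRing.scale /= addr0 mulr1 expr1.
have d2 : is_derive (x ^+ 2 + s ^+ 2) 1 (@powR R ^~ q)
   (q * (x ^+ 2 + s ^+ 2) `^ (q - 1)).
  apply: DeriveDef.
    by apply: derivable_powR; rewrite in_itv /= andbT.
  by rewrite -derive1E powR_derive1 // in_itv /= andbT.
rewrite (_ : 2 * q * x * _ = q * (x ^+ 2 + s ^+ 2) `^ (q - 1) * (2 * x)); last by ring.
exact: (@is_derive1_comp _ (@powR R ^~ q) (fun r : R => r ^+ 2 + s ^+ 2) x _ _ d2 d1).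
Qed.

Lemma smoothR_sqrD_powR (s q : R) : 0 < s ->
  smoothR (fun r => (r ^+ 2 + s ^+ 2) `^ q).
Proof.
move=> s0.
(* Differentiation shifts both the power of [r] and the exponent, so the family is indexed by both.
   For [j = 0] the truncated predecessor [j.-1] comes with the coefficient 0. *)
pose B (i : nat * R) (r : R) := r ^+ i.1 * (r ^+ 2 + s ^+ 2) `^ i.2.
suff : smoothR (B (0%N, q)).
  by congr smoothR; apply/funext => r; rewrite /B /= expr0 mul1r.
apply: smoothR_basis => -[j {}q].
exists [:: (j%:R, (j.-1, q)); (2 * q, (j.+1, q - 1))] => x.
rewrite (_ : B (j, q) = (@id R ^+ j) * (fun r => (r ^+ 2 + s ^+ 2) `^ q)); last first.
  by apply/funext => r; rewrite /B /GRing.mul /= exprfctE.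
apply: (is_derive_eq (is_deriveM (is_deriveX j (is_derive_id x 1)) (is_derive_sqrD_powR q x s0))).
rewrite /lin_comb big_cons big_seq1 /B /= /GRing.scale /= mulr1 !exprfctE -mulr_natl.
by rewrite addrC [x ^+ j.+1]exprS; congr (_ + _); ring.
Qed.

(** The classical flat function [exp(-1/x)], with powers of [1/x] added to make the family stable
    under differentiation: [flat k] has derivative [flat k.+2 - k * flat k.+1]. *)
Definition flat (k : nat) (x : R) : R :=
  if 0 < x then x^-1 ^+ k * expR (- x^-1) else 0.

Lemma flat_gt0 k x : 0 < x -> 0 < flat k x.
Proof. by move=> x0; rewrite /flat x0 mulr_gt0 ?expR_gt0 ?exprn_gt0 ?invr_gt0. Qed.

Lemma flat_le0 k x : x <= 0 -> flat k x = 0.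
Proof. by rewrite /flat leNgt => /negbTE ->. Qed.

Lemma flat_ge0 k x : 0 <= flat k x.
Proof. by have [/(flat_le0 k)->//|/(flat_gt0 k)/ltW] := leP x 0. Qed.

(** Comes from [exp y >= y^(k+2) / (k+2)!] at [y = 1/x]. The quadratic bound makes the difference
    quotient at 0 vanish in [is_derive_flat]. *)
Lemma flat_le_sqr k x : flat k x <= k.+2`!%:R * x ^+ 2.
Proof.
have [x0|x0] := leP x 0; first by rewrite flat_le0 // mulr_ge0 ?sqr_ge0.
rewrite /flat x0; set y := x^-1.
have y0 : 0 < y by rewrite invr_gt0.
have : y ^+ k.+2 / k.+2`!%:R <= expR y.
  by apply: le_trans (expR_ge1Dxn k.+1 (ltW y0)); rewrite lerDr.
rewrite ler_pdivrMr ?ltr0n ?fact_gt0 // => h.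
rewrite expRN ler_pdivrMr ?expR_gt0 //.
have -> : x ^+ 2 = y ^- 2 by rewrite /y exprVn invrK.
rewrite mulrAC ler_pdivlMr ?exprn_gt0 //.
by rewrite -exprD addn2 mulrC.
Qed.

Lemma is_derive_flat k (x : R) :
  is_derive x 1 (flat k) (flat k.+2 x - k%:R * flat k.+1 x).
Proof.
have [x0|x0|->] := ltgtP x 0.
- rewrite !flat_le0 ?(ltW x0) // mulr0 subr0.
  apply: (@near_eq_is_derive _ _ _ (cst 0)).
    by near=> y; rewrite flat_le0 //=; apply/ltW; near: y; exact: lt_nbhsl.
- pose f := (fun y : R => y^-1) ^+ k * (fun y : R => expR (- y^-1)).
  apply: (@near_eq_is_derive _ _ _ f).
    near=> y; rewrite /flat ifT; first by rewrite /f /GRing.mul /= exprfctE.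
    by near: y; exact: lt_nbhsr.
  have xn0 : x != 0 by rewrite gt_eqF.
  have dV : is_derive x 1 (fun y : R => y^-1) (- x ^- 2).
    by apply: (is_derive_eq (is_deriveV (f := id) xn0 (is_derive_id x 1))); rewrite /GRing.scale /= mulr1.
  have d1 := is_deriveX k dV.
  have d2 : is_derive x 1 (fun y : R => expR (- y^-1)) (x ^- 2 * expR (- x^-1)).
    rewrite -[x ^- 2]opprK mulrC.
    exact: (@is_derive1_comp _ expR (fun y : R => - y^-1) x _ _ (is_derive_expR _) (is_deriveN dV)).
  apply: (is_derive_eq (is_deriveM d1 d2)).
  rewrite /flat x0 !exprfctE /= /GRing.scale /= -mulr_natl.
  case: k d1 @f => [|k] _ _ /=.
    by rewrite !expr0 !exprVn; ring.
  by rewrite -!exprVn /= !exprS; ring.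
- rewrite !flat_le0 // mulr0 subr0.
  have h0 : (fun h : R => h^-1 *: (flat k (h *: (1:R) + 0) - flat k 0)) @ 0^' --> (0:R).
    apply/cvgrPdist_le => /= e e0.
    pose c : R := k.+2`!%:R.
    have c0 : 0 < c by rewrite ltr0n fact_gt0.
    near=> h; rewrite sub0r normrN /GRing.scale /= mulr1 addr0 (flat_le0 k (lexx 0)) subr0.
    have hn0 : h != 0 by near: h; exact: nbhs_dnbhs_neq.
    rewrite normrM normfV ler_pdivrMl ?normr_gt0 // ger0_norm ?flat_ge0 //.
    apply: le_trans (flat_le_sqr k h) _; rewrite -[h ^+ 2]real_normK ?num_real // expr2 mulrA -/c mulrC.
    rewrite ler_pM2l ?normr_gt0 // -ler_pdivlMl // mulrC.
    near: h; apply: dnbhs0_le; exact: divr_gt0.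
  apply: DeriveDef; first by apply/cvg_ex; exists 0.
  by apply/cvg_lim.
Unshelve. all: by end_near.
Qed.

Lemma smoothR_flat k : smoothR (flat k).
Proof.
apply: smoothR_basis => {}k; exists [:: (1, k.+2); (- k%:R, k.+1)] => x.
apply: (is_derive_eq (is_derive_flat k x)).
by rewrite /lin_comb big_cons big_seq1 /= mul1r mulNr.
Qed.

End smooth_real.

(** * Smooth functions and test functions on the Heisenberg group *)
Section smooth_heis.
Context {R : realType} {n : nat}.
Local Notation H := (heis R n).
Implicit Types (f : H -> R) (Omega : set H).

Lemma smooth_differentiable f z : smooth f -> differentiable f z.
Proof. by move=> /(_ [::] z). Qed.

Lemma smooth_derivable f z v : smooth f -> derivable f z v.
Proof. by move=> /smooth_differentiable/diff_derivable; exact. Qed.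

Lemma smooth_derive f v : smooth f -> smooth ('D_v f).
Proof.
move=> sf s z; rewrite (_ : iter_dir_derive _ _ = iter_dir_derive (rcons s v) f).
  exact: sf.
by elim: s => //= w s ->.
Qed.

(** Coinduction for [smooth]: iterated derivatives are handled here once and for all. *)
Lemma smooth_class (C : set (H -> R)) :
  (forall f, C f -> (forall z, differentiable f z) /\ forall v, C ('D_v f)) ->
  forall f, C f -> smooth f.
Proof.
move=> HC f Cf s.
suff : C (iter_dir_derive s f) by move=> /HC[].
by elim: s => //= v s /HC[_]; exact.
Qed.

Lemma derive_comp_real (g g' : R -> R) f z v :
  (forall x : R, is_derive x (1:R) g (g' x)) -> differentiable f z ->
  'D_v (g \o f) z = g' (f z) * 'D_v f z.
Proof.
move=> dg df; have dgf : differentiable g (f z).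
  by apply/derivable1_diffP; have [] := dg (f z).
rewrite deriveE; last exact: differentiable_comp.
rewrite diff_comp //= deriv1E; last exact/derivable1_diffP.
rewrite derive1E /GRing.scale /=.
by have [_ ->] := dg (f z); rewrite -deriveE // mulrC.
Qed.

(** The chain and Leibniz rules keep this syntactic closure stable under directional derivatives, so
    the closure of [smooth] under sums, products and composition follows from a single
    coinduction. *)
Inductive smooth_alg : (H -> R) -> Prop :=
| Smooth_base f : smooth f -> smooth_alg f
| Smooth_comp g f : smoothR g -> smooth f -> smooth_alg (g \o f)
| Smooth_add f g : smooth_alg f -> smooth_alg g -> smooth_alg (f + g)
| Smooth_mul f g : smooth_alg f -> smooth_alg g -> smooth_alg (f * g).

Lemma smooth_alg_smooth f : smooth_alg f -> smooth f.
Proof.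
apply: smooth_class => {}f; elim=> {f}.
- move=> f sf; split; first by move=> z; exact: smooth_differentiable.
  by move=> v; apply: Smooth_base; exact: smooth_derive.
- move=> g f /smoothR_derive[g' sg' dg] sf.
  have df z := smooth_differentiable z sf.
  split=> [z|v].
    apply: differentiable_comp => //.
    by apply/derivable1_diffP; have [] := dg (f z).
  rewrite (_ : 'D_v _ = (g' \o f) * 'D_v f).
    by apply: Smooth_mul; [exact: Smooth_comp|apply: Smooth_base; exact: smooth_derive].
  by apply/funext => z; rewrite (derive_comp_real _ dg).
- move=> f g _ [df Df] _ [dg Dg]; split=> [z|v]; first exact: differentiableD.
  rewrite (_ : 'D_v _ = 'D_v f + 'D_v g); first exact: Smooth_add.
  by apply/funext => z; rewrite deriveD //; exact: diff_derivable.
- move=> f g sf [df Df] sg [dg Dg]; split=> [z|v]; first exact: differentiableM.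
  rewrite (_ : 'D_v _ = f * 'D_v g + g * 'D_v f).
    by apply: Smooth_add; apply: Smooth_mul.
  by apply/funext => z; rewrite deriveM //; exact: diff_derivable.
Qed.

Lemma smoothD f g : smooth f -> smooth g -> smooth (f + g).
Proof. by move=> sf sg; apply/smooth_alg_smooth/Smooth_add; exact: Smooth_base. Qed.

Lemma smoothM f g : smooth f -> smooth g -> smooth (f * g).
Proof. by move=> sf sg; apply/smooth_alg_smooth/Smooth_mul; exact: Smooth_base. Qed.

Lemma smooth_comp g f : smoothR g -> smooth f -> smooth (g \o f).
Proof. by move=> sg sf; apply/smooth_alg_smooth/Smooth_comp. Qed.

Lemma smooth_linear (f : {linear H -> R}) : continuous f -> smooth (f : H -> R).
Proof.
move=> cf; apply: (@smooth_class [set g : H -> R | g = f \/ exists c, g = cst c]); last by left.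
move=> g [->|[c ->]]; split.
- by move=> z; exact: linear_differentiable.
- move=> v; right; exists (f v); apply/funext => z.
  by rewrite deriveE ?diff_lin //; exact: linear_differentiable.
- by move=> z; exact: differentiable_cst.
- by move=> v; right; exists 0; apply/funext => z; rewrite derive_cst.
Qed.

Lemma smooth_cst (c : R) : smooth (cst c : H -> R).
Proof.
apply: (@smooth_class [set g | exists c, g = cst c]); last by exists c.
move=> g [{}c ->]; split; first by move=> z; exact: differentiable_cst.
by move=> v; exists 0; apply/funext => z; rewrite derive_cst.
Qed.

Lemma smooth_continuous f : smooth f -> continuous f.
Proof. by move=> sf z; apply: differentiable_continuous; exact: smooth_differentiable. Qed.

(** At a fixed point both families of fields have the shape [D_v + c D_w], so each rule of calculus
    for [hgrad] is proved once. As [c] depends on [z], continuity has to treat the two families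
    separately. *)
Lemma hgradE (z : H) (i : 'I_(n + n)) : exists v w c, forall f,
  hgrad f z ord0 i = 'D_v f z + c * 'D_w f z.
Proof.
case: (split_ordP i) => j ->.
- exists (delta_mx 0 j, 0, 0), (0, 0, 1), (2 * z.1.2 ord0 j) => f.
  by rewrite /hgrad row_mxEl mxE.
- exists (0, delta_mx 0 j, 0), (0, 0, 1), (- (2 * z.1.1 ord0 j)) => f.
  by rewrite /hgrad row_mxEr mxE /fieldY mulNr.
Qed.

Lemma hgrad_comp g g' f z : (forall x : R, is_derive x (1:R) g (g' x)) -> smooth f ->
  hgrad (g \o f) z = g' (f z) *: hgrad f z.
Proof.
move=> dg sf; apply/rowP => i; rewrite [RHS]mxE.
have [v [w [c E]]] := hgradE z i; rewrite !E.
have df := smooth_differentiable z sf.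
by rewrite !(derive_comp_real _ dg df); ring.
Qed.

Lemma hgradD f g z : smooth f -> smooth g ->
  hgrad (f + g) z = hgrad f z + hgrad g z.
Proof.
move=> sf sg; apply/rowP => i; rewrite [RHS]mxE.
have [v [w [c E]]] := hgradE z i; rewrite !E.
rewrite !deriveD; try exact: smooth_derivable.
move: ('D_v f z) ('D_w f z) ('D_v g z) ('D_w g z) => d1 d2 d3 d4; ring.
Qed.

Lemma hgradM f g z : smooth f -> smooth g ->
  hgrad (f * g) z = f z *: hgrad g z + g z *: hgrad f z.
Proof.
move=> sf sg; apply/rowP => i; rewrite [RHS]mxE [X in X + _]mxE [X in _ + X]mxE.
have [v [w [c E]]] := hgradE z i; rewrite !E.
rewrite !deriveM; try exact: smooth_derivable.
rewrite /GRing.scale /=.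
move: ('D_v f z) ('D_w f z) ('D_v g z) ('D_w g z) => d1 d2 d3 d4; ring.
Qed.

Lemma hgrad_cst (c : R) (z : H) : hgrad (cst c) z = 0.
Proof.
apply/rowP => i; rewrite [RHS]mxE; have [v [w [d ->]]] := hgradE z i.
by rewrite !derive_cst mulr0 addr0.
Qed.

Lemma continuous_hgrad f i : smooth f -> continuous (fun z => hgrad f z ord0 i).
Proof.
move=> sf.
have cD v : continuous ('D_v f) by apply: smooth_continuous; exact: smooth_derive.
case: (split_ordP i) => j ->.
- rewrite (_ : (fun _ => _) = fun z => 'D_((delta_mx 0 j, 0, 0) : H) f z
    + 2 * z.1.2 ord0 j * 'D_((0, 0, 1) : H) f z); last first.
    by apply/funext => z; rewrite /hgrad row_mxEl mxE.
  move=> z; apply: cvgD; first exact: cD.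
  apply: cvgM; last exact: cD.
  apply: cvgM; first exact: cvg_cst.
  apply: (@continuous_comp _ _ _ (fun z : H => z.1.2) (fun v => v ord0 j)).
    by apply: (@continuous_comp _ _ _ fst snd); [exact: cvg_fst|exact: cvg_snd].
  exact: coord_continuous.
- rewrite (_ : (fun _ => _) = fun z => 'D_((0, delta_mx 0 j, 0) : H) f z
    - 2 * z.1.1 ord0 j * 'D_((0, 0, 1) : H) f z); last first.
    by apply/funext => z; rewrite /hgrad row_mxEr mxE.
  move=> z; apply: cvgB; first exact: cD.
  apply: cvgM; last exact: cD.
  apply: cvgM; first exact: cvg_cst.
  apply: (@continuous_comp _ _ _ (fun z : H => z.1.1) (fun v => v ord0 j)).
    by apply: (@continuous_comp _ _ _ fst fst); exact: cvg_fst.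
  exact: coord_continuous.
Qed.

(** Reduces the support condition to an inclusion of zero sets, which is immediate for products and
    for functions of [f] that vanish at 0. *)
Lemma test_function_sub Omega f g : smooth g -> test_function Omega f ->
  (forall z, f z = 0 -> g z = 0) -> test_function Omega g.
Proof.
move=> sg [sf cf fO] fg0.
have sub : closure [set z | g z != 0] `<=` closure [set z | f z != 0].
  by apply: closure_subset => z /=; apply: contra_neq; exact: fg0.
split => //; last exact: subset_trans fO.
by apply: subclosed_compact cf sub; exact: closed_closure.
Qed.

Lemma test_functionMl Omega f g : smooth g -> test_function Omega f ->
  test_function Omega (g * f).
Proof.
move=> sg tf; apply: test_function_sub (tf) _.
  by apply: smoothM => //; case: tf.
by move=> z fz0; rewrite /GRing.mul /= fz0 mulr0.
Qed.

Lemma test_functionD Omega f g : test_function Omega f -> test_function Omega g ->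
  test_function Omega (f + g).
Proof.
move=> [sf cf fO] [sg cg gO].
have sub : closure [set z | (f + g) z != 0] `<=`
    closure [set z | f z != 0] `|` closure [set z | g z != 0].
  rewrite -closureU; apply: closure_subset => z /=.
  have [fz0|] := eqVneq (f z) 0; last by left.
  by have [gz0|] := eqVneq (g z) 0; [rewrite /GRing.add /= fz0 gz0 addr0 eqxx|right].
split; first exact: smoothD.
- by apply: subclosed_compact (compactU cf cg) sub; exact: closed_closure.
- by apply: subset_trans sub _; rewrite subUset.
Qed.

Lemma test_function0 Omega : test_function Omega (cst 0).
Proof.
have -> : cst 0 = (fun _ => 0) :> (H -> R) by [].
split; first exact: smooth_cst.
- rewrite (_ : [set _ | _] = set0) ?closure0; first exact: compact0.
  by apply/seteqP; split => // z /=; rewrite eqxx.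
- rewrite (_ : [set _ | _] = set0) ?closure0 //.
  by apply/seteqP; split => // z /=; rewrite eqxx.
Qed.

Lemma test_function_bounded Omega f : test_function Omega f ->
  exists M : R, forall z, `|f z| <= M.
Proof.
move=> [sf cf _].
have [M [_ HM]] : bounded_set (f @` closure [set z | f z != 0]).
  apply: compact_bounded; apply: continuous_compact => //.
  by apply: continuous_subspaceT; exact: smooth_continuous.
exists (Num.max 0 (M + 1)) => z.
have [->|fz0] := eqVneq (f z) 0; first by rewrite normr0 le_max lexx.
rewrite le_max; apply/orP; right; apply: (HM (M + 1)); first by rewrite ltrDl.
by exists z => //; exact: subset_closure.
Qed.

End smooth_heis.

(** * Open sets and smooth cutoffs *)
Section heis_coordinates.
Context {R : realType} {n : nat}.
Local Notation H := (heis R n).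

Definition coordT : finType := ('I_n + 'I_n + unit)%type.

Definition coord (j : coordT) (z : H) : R :=
  match j with
  | inl (inl i) => z.1.1 ord0 i
  | inl (inr i) => z.1.2 ord0 i
  | inr _ => z.2
  end.

Lemma coord_linear j : linear (coord j).
Proof. by case: j => [[i|i]|[]] c u v //=; rewrite !mxE. Qed.

Lemma continuous_coord j : continuous (coord j).
Proof.
case: j => [[i|i]|[]] z /=; last exact: cvg_snd.
- apply: (@continuous_comp _ _ _ (fun z : H => z.1.1) (fun v => v ord0 i)).
    by apply: (@continuous_comp _ _ _ fst fst); exact: cvg_fst.
  exact: coord_continuous.
- apply: (@continuous_comp _ _ _ (fun z : H => z.1.2) (fun v => v ord0 i)).
    by apply: (@continuous_comp _ _ _ fst snd); [exact: cvg_fst|exact: cvg_snd].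
  exact: coord_continuous.
Qed.

Lemma smooth_coord j : smooth (coord j).
Proof.
pose L : {linear H -> R} := HB.pack (coord j) (GRing.isLinear.Build _ _ _ _ _ (coord_linear j)).
have h : continuous (L : H -> R) by exact: continuous_coord.
exact: (smooth_linear h).
Qed.

Lemma measurable_coord j : measurable_fun setT (coord j).
Proof.
case: j => [[i|i]|[]] /=; last exact: measurable_snd.
- apply: (measurableT_comp (measurable_rV_coord i)).
  exact: (measurableT_comp measurable_fst measurable_fst).
- apply: (measurableT_comp (measurable_rV_coord i)).
  exact: (measurableT_comp measurable_snd measurable_fst).
Qed.

Lemma ball_coord (z w : H) (e : R) : 0 < e ->
  (forall j, `|coord j z - coord j w| < e) -> ball z e w.
Proof.
move=> e0 h; split; first split.
- by split=> // i j; rewrite (ord1 i); exact: (h (inl (inl j))).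
- by split=> // i j; rewrite (ord1 i); exact: (h (inl (inr j))).
- exact: (h (inr tt)).
Qed.

Definition closed_box (a : coordT -> R) (r : R) : set H :=
  [set z | forall j, `|coord j z - a j| <= r].

Lemma compact_closed_box a r : compact (closed_box a r).
Proof.
have E (b : 'I_n -> R) : compact [set v : 'rV[R]_n | forall i, v ord0 i \in `[b i - r, b i + r]].
  by apply: (@rV_compact _ _ (fun i => [set` `[b i - r, b i + r]])) => i; exact: segment_compact.
rewrite (_ : closed_box a r =
  ([set v : 'rV[R]_n | forall i, v ord0 i \in `[a (inl (inl i)) - r, a (inl (inl i)) + r]] `*`
   [set v : 'rV[R]_n | forall i, v ord0 i \in `[a (inl (inr i)) - r, a (inl (inr i)) + r]]) `*`
   [set` `[a (inr tt) - r, a (inr tt) + r]]).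
  apply: compact_setX; last exact: segment_compact.
  by apply: compact_setX; exact: E.
apply/seteqP; split => z.
  move=> h; split; first split.
  - by move=> i /=; rewrite in_itv /= -ler_distlC distrC; exact: (h (inl (inl i))).
  - by move=> i /=; rewrite in_itv /= -ler_distlC distrC; exact: (h (inl (inr i))).
  - by rewrite /= in_itv /= -ler_distlC distrC; exact: (h (inr tt)).
move=> [[h1 h2] h3] [[i|i]|[]] /=.
- by have := h1 i; rewrite /= in_itv /= -ler_distlC distrC.
- by have := h2 i; rewrite /= in_itv /= -ler_distlC distrC.
- by move: h3; rewrite /= in_itv /= -ler_distlC distrC.
Qed.

(** The two factors for [j] are positive exactly when the coordinate is less than [a j + r] and
    greater than [a j - r], so the product is positive exactly on the open box. *)
Definition bump (a : coordT -> R) (r : R) (z : H) : R :=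
  \prod_j (flat 0 (r + a j - coord j z) * flat 0 (r - a j + coord j z)).

Lemma bump_ge0 a r z : 0 <= bump a r z.
Proof. by apply: prodr_ge0 => j _; rewrite mulr_ge0 ?flat_ge0. Qed.

Lemma bump_gt0 a r z : (forall j, `|coord j z - a j| < r) -> 0 < bump a r z.
Proof.
move=> h; apply: prodr_gt0 => j _; have := h j; rewrite ltr_norml => /andP[h1 h2].
by rewrite mulr_gt0 // flat_gt0 //; lra.
Qed.

Lemma bump_neq0 a r z : bump a r z != 0 -> closed_box a r z.
Proof.
move=> h j; rewrite leNgt; apply: contra h => h.
rewrite /bump (bigD1 j) //= mulf_eq0; apply/orP; left; rewrite mulf_eq0.
have [h1|h1] := leP (r + a j - coord j z) 0; first by rewrite flat_le0 // eqxx.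
rewrite [X in _ || X](_ : _ = true) ?orbT //; apply/eqP; apply: flat_le0.
move: h; rewrite ltr_normr => /orP[]; lra.
Qed.

Lemma smooth_bump a r : smooth (bump a r).
Proof.
have saff (c d : R) j : smooth (fun z => c + d * coord j z).
  have -> : (fun z => c + d * coord j z) = cst c + cst d * coord j by [].
  by apply: smoothD; [exact: smooth_cst|apply: smoothM; [exact: smooth_cst|exact: smooth_coord]].
suff h (s : seq coordT) : smooth (fun z => \prod_(j <- s)
    (flat 0 (r + a j - coord j z) * flat 0 (r - a j + coord j z))).
  exact: h.
elim: s => [|j s IH].
  rewrite (_ : (fun _ => _) = cst 1); first exact: smooth_cst.
  by apply/funext => z; rewrite big_nil.
rewrite (_ : (fun _ => _) = ((flat 0 \o (fun z => (r + a j) + (- 1) * coord j z)) *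
    (flat 0 \o (fun z => (r - a j) + 1 * coord j z))) *
    (fun z => \prod_(j <- s)
    (flat 0 (r + a j - coord j z) * flat 0 (r - a j + coord j z)))); last first.
  apply/funext => z; rewrite big_cons; apply: (congr2 *%R) => //.
  by apply: (congr2 *%R); rewrite /= ?mulN1r ?mul1r.
apply: smoothM => //; apply: smoothM; apply: smooth_comp; by [exact: smoothR_flat|exact: saff].
Qed.

Lemma test_function_bump (Omega : set H) a r : closed_box a r `<=` Omega ->
  test_function Omega (bump a r).
Proof.
move=> h.
have cb : closed (closed_box a r).
  rewrite (_ : closed_box a r = \bigcap_j [set z | `|coord j z - a j| <= r]).
    apply: closed_bigI => j _.
    have := @closed_comp _ _ (fun z => `|coord j z - a j|) [set y | y <= r].
    apply; last exact: closed_le.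
    move=> z _; apply: cvg_norm; apply: cvgB; [exact: continuous_coord|exact: cvg_cst].
  by apply/seteqP; split => [z hz j _|z hz j]; [exact: hz|exact: (hz j I)].
have sub : closure [set z | bump a r z != 0] `<=` closed_box a r.
  rewrite [X in _ `<=` X]((closure_id _).1 cb); apply: closure_subset => z; exact: bump_neq0.
split; first exact: smooth_bump.
- exact: (subclosed_compact (@closed_closure _ _) (@compact_closed_box a r) sub).
- exact: subset_trans h.
Qed.

(** Checked on coordinates, because the measurability of continuous functions on the group will
    itself be derived from these bumps. *)
Lemma measurable_bump a r : measurable_fun setT (bump a r).
Proof.
have mflat : measurable_fun setT (@flat R 0).
  apply: continuous_measurable_fun => x; apply: differentiable_continuous.
  by apply/derivable1_diffP; have [] := is_derive_flat 0 x.
rewrite (_ : bump a r = fun z => \prod_(j <- index_enum coordT)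
    (flat 0 (r + a j - coord j z) * flat 0 (r - a j + coord j z))) //.
apply: measurable_prod => j _; apply: measurable_funM; apply: (measurableT_comp mflat).
- by apply: measurable_funB; [exact: measurable_cst|exact: measurable_coord].
- by apply: measurable_funD; [exact: measurable_cst|exact: measurable_coord].
Qed.

(** The boxes with rational centres and radii [1/(k+1)] that fit into [O] are countably many and
    cover it. Hence open sets belong to the product sigma-algebra, and finite sums of bumps yield
    cutoffs. *)
Lemma open_bumps (O : set H) : open O ->
  exists b : nat -> H -> R, [/\ forall j, test_function O (b j),
    forall j z, 0 <= b j z, forall j, measurable_fun setT (b j) &
    forall z, O z -> exists j, 0 < b j z].
Proof.
move=> oO.
pose box (q : {ffun coordT -> rat} * nat) := closed_box (fun j => ratr (q.1 j)) (q.2.+1%:R^-1).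
(* Codes of no pair, and boxes that leave [O], contribute the zero function. *)
pose b k : H -> R := if unpickle k is Some q then
  if `[< box q `<=` O >] then bump (fun j => ratr (q.1 j)) (q.2.+1%:R^-1) else cst 0
  else cst 0.
exists b; split.
- move=> k; rewrite /b; case: unpickle => [q|]; last exact: test_function0.
  by case: asboolP => h; [exact: test_function_bump|exact: test_function0].
- move=> k z; rewrite /b; case: unpickle => [q|] //.
  by case: ifP => // _; exact: bump_ge0.
- move=> k; rewrite /b; case: unpickle => [q|] //.
  by case: ifP => // _; exact: measurable_bump.
- move=> z Oz.
  have /nbhs_ballP[e /= e0 he] : nbhs z O by exact: open_nbhs_nbhs.
  (* Half of [e], because the rational centre is only within [r] of [z], so a point of the box is
     within [2 r] of [z]. *)
  have [k hk] : exists k, k.+1%:R^-1 < e / 2.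
    have e2 : 0 < e / 2 by rewrite divr_gt0.
    have [k _ /(_ k (leqnn k))] := near_infty_natSinv_lt (PosNum e2).
    by exists k.
  have k0 : 0 < (k.+1%:R : R)^-1 by rewrite invr_gt0.
  set r := k.+1%:R^-1 in hk k0.
  have /choice[q hq] (j : coordT) : exists q : rat, `|coord j z - ratr q| < r.
    have [|q] := @rat_in_itvoo _ (coord j z - r) (coord j z + r); first by lra.
    by rewrite in_itv /= => /andP[h1 h2]; exists q; rewrite ltr_norml; apply/andP; split; lra.
  exists (pickle ([ffun j => q j] : {ffun coordT -> rat}, k)).
  rewrite /b pickleK /=; case: asboolP => [_|[]].
    by apply: bump_gt0 => j; rewrite ffunE.
  move=> w hw; apply: he; apply: ball_coord => // j.
  have := hw j; rewrite /= ffunE -/r => hwj; have hqj := hq j.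
  rewrite (_ : _ - _ = (coord j z - ratr (q j)) - (coord j w - ratr (q j))); last by ring.
  by apply: le_lt_trans (ler_normB _ _) _; lra.
Qed.

Lemma open_measurable_heis (O : set H) : open O -> measurable O.
Proof.
move=> /open_bumps[b [tb b0 mb Ob]].
rewrite (_ : O = \bigcup_j (b j @^-1` `]0, +oo[)).
  apply: bigcup_measurable => j _; rewrite -[X in measurable X]setTI.
  by apply: mb => //; exact: measurable_itv.
apply/seteqP; split => [z /Ob[j bj]|z [j _]].
  by exists j => //=; rewrite in_itv /= bj.
rewrite /= in_itv /= andbT => bj; have [_ _] := tb j; apply.
by apply: subset_closure => /=; rewrite gt_eqF.
Qed.

Lemma continuous_measurable_heis (f : H -> R) :
  continuous f -> measurable_fun setT f.
Proof.
move=> /continuousP cf; apply: (measurability _ (RGenOpens.measurableE R)).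
move=> _ [_ [a [b ->] <-]]; rewrite setTI; apply: open_measurable_heis.
exact/cf/interval_open.
Qed.

Lemma open_cutoff (O : set H) : open O ->
  exists phi : nat -> H -> R, [/\ forall k, test_function O (phi k),
    forall k z, 0 <= phi k z <= 1 &
    forall z, O z -> phi ^~ z @ \oo --> (1 : R)].
Proof.
move=> /open_bumps[b [tb b0 mb Ob]].
pose psi k : H -> R := \sum_(j < k) b j.
have psiE k z : psi k z = \sum_(j < k) b j z by rewrite /psi fct_sumE.
have tpsi k : test_function O (psi k).
  rewrite /psi; elim: k => [|k IH].
    by rewrite big_ord0; exact: test_function0.
  by rewrite big_ord_recr; exact: test_functionD.
pose s (k : nat) : R := k.+1%:R^-1.
have s0 k : 0 < s k by rewrite invr_gt0.
(* This is [psi^2 / (psi^2 + s^2)], in a form that exhibits it as a smooth function of [psi]. *)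
pose phi k : H -> R := fun z => 1 - s k ^+ 2 * (psi k z ^+ 2 + s k ^+ 2) `^ (- 1).
have D0 k z : 0 < psi k z ^+ 2 + s k ^+ 2.
  by rewrite ltr_wpDl ?sqr_ge0 ?exprn_gt0.
have phiE k z : phi k z = 1 - s k ^+ 2 / (psi k z ^+ 2 + s k ^+ 2).
  by rewrite /phi powR_inv1 // ltW.
exists phi; split => [k|k z|z /Ob[j bj]].
- apply: test_function_sub (tpsi k) _.
    rewrite (_ : phi k = cst 1 + cst (- s k ^+ 2) *
        ((fun r => (r ^+ 2 + s k ^+ 2) `^ (- 1)) \o psi k)).
      apply: smoothD; [exact: smooth_cst|apply: smoothM; first exact: smooth_cst].
      by apply: smooth_comp; [exact: smoothR_sqrD_powR|case: (tpsi k)].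
    by apply/funext => z; rewrite /phi -mulNr.
  move=> z pz; rewrite phiE pz expr0n add0r divff ?subrr //.
  by rewrite expf_neq0 // gt_eqF.
- rewrite phiE subr_ge0 ler_pdivrMr // mul1r lerDr sqr_ge0 /=.
  by rewrite gerBl divr_ge0 ?sqr_ge0 // ltW.
(* Once the [j]-th bump has entered the sum, [1 - phi k] is at most [s^2 / psi^2], hence at most
   [s / (b j)^2] since [s <= 1]. *)
- apply/cvgrPdist_lt => /= e e0.
  have : (fun k => s k * (b j z ^+ 2)^-1) @ \oo --> (0 : R).
    rewrite -(mul0r (b j z ^+ 2)^-1); apply: cvgM; last exact: cvg_cst.
    exact: cvg_harmonic.
  move=> /cvgrPdist_lt/(_ _ e0); apply: filter_app; near=> k.
  rewrite sub0r normrN => h.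
  rewrite phiE opprB addrC subrK.
  have psb : b j z <= psi k z.
    rewrite psiE; have jk : (j < k)%N by near: k; exact: nbhs_infty_gt.
    by rewrite (bigD1 (Ordinal jk)) //= lerDl sumr_ge0.
  rewrite ger0_norm ?divr_ge0 ?sqr_ge0 ?ltW //.
  apply: (le_lt_trans _ h); rewrite ger0_norm; last by rewrite divr_ge0 ?sqr_ge0 ?ltW.
  have s1 : s k <= 1 by rewrite invf_le1 // ler1n.
  apply: ler_pM; rewrite ?sqr_ge0 ?invr_ge0 //; first by rewrite ltW.
    by rewrite expr2 ler_piMl // ltW.
  rewrite lef_pV2 ?posrE ?exprn_gt0 //.
  apply: (@le_trans _ _ (psi k z ^+ 2)); last by rewrite lerDl sqr_ge0.
  by rewrite ler_pXn2r // ?nnegrE ?ltW // (lt_le_trans bj).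
Unshelve. all: by end_near.
Qed.

Lemma test_functionS (O Omega : set H) f : O `<=` Omega ->
  test_function O f -> test_function Omega f.
Proof. by move=> OO [sf cf fO]; split=> //; exact: subset_trans OO. Qed.

End heis_coordinates.

(** * Convergence of integrals *)
Section measure_convergence.
Local Open Scope ereal_scope.
Context d (T : measurableType d) (R : realType) (m : {measure set T -> \bar R}).
Implicit Types (D : set T) (f g b : T -> R).

Lemma ecvg0P (u : (\bar R)^nat) : (forall k, 0 <= u k) ->
  u @ \oo --> 0 <-> forall e : R, (0 < e)%R -> \forall k \near \oo, u k <= e%:E.
Proof.
move=> u0; split.
  move=> /fine_cvgP[uf /cvgrPdist_le uc] e e0.
  have := uc e e0; apply: filterS2 uf => k uk.
  rewrite sub0r normrN /= ger0_norm ?fine_ge0 // => h.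
  by rewrite -(fineK uk) lee_fin.
move=> h; apply/fine_cvgP; split.
  have := h 1%R ltr01; apply: filterS => k hk.
  by rewrite ge0_fin_numE // (le_lt_trans hk) // ltry.
apply/cvgrPdist_le => e e0; have := h e e0; apply: filterS => k hk.
rewrite sub0r normrN /= ger0_norm ?fine_ge0 //.
by rewrite -lee_fin fineK // ge0_fin_numE // (le_lt_trans hk) // ltry.
Qed.

Lemma cvg_EFinP (u : R^nat) (l : R) :
  (fun k => (u k)%:E) @ \oo --> l%:E <-> u @ \oo --> l.
Proof.
split; first by move/fine_cvgP => [_].
by move=> h; apply/fine_cvgP; split => //; exact: nearW.
Qed.

(** The form of Fatou's lemma used when only an upper bound survives the limit, and this up to an
    error [e]. *)
Lemma fatou_le D (g_ : nat -> T -> R) g (C : \bar R) : measurable D ->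
  (forall k, measurable_fun D (g_ k)) -> measurable_fun D g ->
  (forall k x, D x -> (0 <= g_ k x)%R) -> (forall x, D x -> (0 <= g x)%R) ->
  {ae m, forall x, D x -> g_ ^~ x @ \oo --> g x} ->
  (forall e : R, (0 < e)%R ->
     \forall k \near \oo, \int[m]_(x in D) (g_ k x)%:E <= C + e%:E) ->
  \int[m]_(x in D) (g x)%:E <= C.
Proof.
move=> mD mg_ mg g_0 g0 gcvg hC; apply/lee_addgt0Pr => e e0.
have mEg_ k : measurable_fun D (EFin \o g_ k) by exact/measurable_EFinP/mg_.
have -> : \int[m]_(x in D) (g x)%:E =
    \int[m]_(x in D) limn_einf (fun k => (g_ k x)%:E).
  apply: ge0_ae_eq_integral => //.
  - exact/measurable_EFinP.
  - rewrite (_ : (fun _ => _) = (fun x => - limn_esup (fun k => - (g_ k x)%:E))).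
      apply: measurableT_comp => //; apply: measurable_fun_limn_esup => k.
      have : measurable_fun D (EFin \o (fun x => - g_ k x)%R).
        by apply/measurable_EFinP; exact: measurableT_comp.
      exact.
    by apply/funext => x; rewrite -[RHS]limn_einfN; congr limn_einf; apply/funext => k /=; rewrite opprK.
  - move=> x Dx; rewrite limn_einf_lim; apply: lime_ge; first exact: is_cvg_einfs.
    apply: nearW => k; apply: le_ereal_inf_tmp => _ [j _ <-].
    by rewrite lee_fin g_0.
  - move: gcvg; apply: filterS => x h Dx.
    by have [-> _] := cvg_limn_einf_sup ((cvg_EFinP _ _).2 (h Dx)).
apply: (le_trans (@fatou _ _ _ m D mD _ mEg_ _)).
  by move=> k x Dx; rewrite lee_fin g_0.
rewrite limn_einf_lim; apply: lime_le; first exact: is_cvg_einfs.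
have := hC e e0; apply: filterS => k; apply: le_trans.
by apply: ereal_inf_lbound; exists k => //=.
Qed.

Lemma cvg_integral_L1 D (g_ : nat -> T -> R) g : measurable D ->
  (forall k, m.-integrable D (EFin \o g_ k)) -> m.-integrable D (EFin \o g) ->
  (fun k => \int[m]_(x in D) `|g_ k x - g x|%:E) @ \oo --> 0 ->
  (fun k => \int[m]_(x in D) (g_ k x)%:E) @ \oo --> \int[m]_(x in D) (g x)%:E.
Proof.
move=> mD ig_ ig h.
suff : (fun k => `|\int[m]_(x in D) (g_ k x)%:E - \int[m]_(x in D) (g x)%:E|) @ \oo --> 0.
  move/cvg_abse0P/sube_cvg0; apply.
  exact: (integrable_fin_num mD ig).
apply: (@squeeze_cvge _ _ _ _ (cst 0) _ (fun k => \int[m]_(x in D) `|g_ k x - g x|%:E)) => //.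
- apply: nearW => k; rewrite abse_ge0 /=.
  rewrite -(integralB_EFin mD (ig_ k) ig).
  apply: le_trans (le_abse_integral _ _ _) _ => //.
  by have := measurable_int m (integrableB mD (ig_ k) ig).
- exact: cvg_cst.
Qed.

Lemma bounded_mul_integrable D b g M : measurable D -> measurable_fun D b ->
  (forall x, D x -> `|b x| <= M)%R -> m.-integrable D (EFin \o g) ->
  m.-integrable D (fun x => (b x * g x)%:E).
Proof.
move=> mD mb bM ig; have := integrableMr mD mb _ ig; apply.
by exists M; split; [exact: num_real|move=> y My x Dx; apply: le_trans (bM _ Dx) (ltW My)].
Qed.

(** Split [b_ k g_ k - b g] as [b_ k (g_ k - g) + (b_ k - b) g]: the first part is controlled by the
    convergence in [L^1], the second by dominated convergence with bound [M |g|]. In the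
    applications [g_ k] is a flux and [b_ k] a bounded function of the approximations. *)
Lemma cvg_integral_bounded_mul D (g_ : nat -> T -> R) g (b_ : nat -> T -> R) b M :
  measurable D ->
  (forall k, m.-integrable D (EFin \o g_ k)) -> m.-integrable D (EFin \o g) ->
  (fun k => \int[m]_(x in D) `|g_ k x - g x|%:E) @ \oo --> 0 ->
  (forall k, measurable_fun D (b_ k)) -> measurable_fun D b ->
  (forall k x, D x -> `|b_ k x| <= M)%R -> (forall x, D x -> `|b x| <= M)%R ->
  {ae m, forall x, D x -> b_ ^~ x @ \oo --> b x} ->
  (fun k => \int[m]_(x in D) (b_ k x * g_ k x)%:E) @ \oo -->
    \int[m]_(x in D) (b x * g x)%:E.
Proof.
move=> mD ig_ ig gg mb_ mb b_M bM bb.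
have mg_ k : measurable_fun D (g_ k) by apply/measurable_EFinP; exact: (measurable_int m (ig_ k)).
have mg : measurable_fun D g by apply/measurable_EFinP; exact: (measurable_int m ig).
apply: cvg_integral_L1 => //.
- by move=> k; apply: (bounded_mul_integrable (M := M)) => //; exact: b_M.
- exact: (bounded_mul_integrable (M := M)).
have M0 x : D x -> (0 <= M)%R by move=> Dx; apply: le_trans (bM _ Dx).
have h1 : (fun k => M%:E * \int[m]_(x in D) `|g_ k x - g x|%:E) @ \oo --> 0.
  rewrite -(mule0 M%:E); apply: cvgeZl => //.
have h2 : (fun k => \int[m]_(x in D) `|b_ k x * g x - b x * g x|%:E) @ \oo --> 0.
  have f1 k : measurable_fun D (fun x => (b_ k x * g x)%:E).
    by apply/measurable_EFinP; apply: measurable_funM.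
  have f2 : measurable_fun D (fun x => (b x * g x)%:E).
    by apply/measurable_EFinP; apply: measurable_funM.
  have f3 : {ae m, forall x, D x -> (fun k => (b_ k x * g x)%:E) @ \oo --> (b x * g x)%:E}.
    move: bb; apply: filterS => x h Dx; apply/cvg_EFinP.
    by apply: cvgM; [exact: h|exact: cvg_cst].
  have f4 : m.-integrable D (fun x => `|M%:E * (g x)%:E|).
    by apply: integrable_abse; exact: integrableZl.
  have f5 : {ae m, forall x k, D x -> `|(b_ k x * g x)%:E| <= `|M%:E * (g x)%:E|}.
    apply: aeW => x k Dx; rewrite -EFinM /= !lee_fin !normrM ler_wpM2r //.
    by rewrite (ger0_norm (M0 x Dx)) b_M.
  by have [_ + _] := dominated_convergence mD f1 f2 f3 f4 f5.
have := cvgeD _ h1 h2; rewrite adde0 => /(_ _ isT) h.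
apply: (@squeeze_cvge _ _ _ _ (cst 0) _ _ _ _ _ h); last exact: cvg_cst.
apply: nearW => k; rewrite integral_ge0 /=; last by move=> x _; rewrite lee_fin.
have mgg : measurable_fun D (fun x => `|g_ k x - g x|%:E).
  by apply/measurable_EFinP; apply: measurableT_comp => //; exact: measurable_funB.
have mbb : measurable_fun D (fun x => `|b_ k x * g x - b x * g x|%:E).
  apply/measurable_EFinP; apply: measurableT_comp => //.
  by apply: measurable_funB; apply: measurable_funM.
(* The sign of [M] is only known from a point of [D]. *)
have [Dn0|D0] := pselect (exists x, D x); last first.
  have -> : D = set0 by apply/seteqP; split => // x Dx; case: D0; exists x.
  by rewrite !integral_set0 mule0 adde0.
have {M0}M0 : (0 <= M)%R by have [x Dx] := Dn0; exact: M0 Dx.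
rewrite -ge0_integralZl_EFin // -?ge0_integralD //.
- apply: ge0_le_integral => //.
  + apply/measurable_EFinP; apply: measurableT_comp => //.
    by apply: measurable_funB; apply: measurable_funM.
  + by apply: emeasurable_funD => //; exact: measurable_funeM.
  + move=> x Dx; rewrite -EFinM -EFinD lee_fin.
    rewrite (_ : (_ - _ = b_ k x * (g_ k x - g x) + (b_ k x * g x - b x * g x))%R); last by ring.
    apply: le_trans (ler_normD _ _) _; rewrite lerD2r normrM.
    by apply: ler_wpM2r => //; exact: b_M.
- by move=> x _; rewrite -EFinM lee_fin mulr_ge0.
- exact: measurable_funeM.
Qed.

Lemma integrable_of_fin_num D f : measurable D -> measurable_fun D f ->
  \int[m]_(x in D) (f x)%:E \is a fin_num -> m.-integrable D (EFin \o f).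
Proof.
move=> mD mf h; apply/integrableP; split; first exact/measurable_EFinP.
by move: h; rewrite -integral_fin_num_abs.
Qed.

(** Borel-Cantelli along indices whose exceptional sets have measure at most [2^-(k+1)]. The indices
    only satisfy [k <= s k], which is enough to inherit limits. *)
Lemma cvg_measure_ae D (f_ : nat -> T -> R) f :
  (forall e r : R, (0 < e)%R -> (0 < r)%R -> \forall k \near \oo,
     exists O : set T, [/\ measurable O, m O <= r%:E &
       forall x, D x -> (e <= `|f_ k x - f x|)%R -> O x]) ->
  exists s : nat -> nat, (forall k, (k <= s k)%N) /\
    {ae m, forall x, D x -> (fun k => f_ (s k) x) @ \oo --> f x}.
Proof.
move=> h; pose r_ k : R := (1 / (2 ^ (k + 1))%:R)%R.
have r0 k : (0 < r_ k)%R by rewrite divr_gt0 // ltr0n expn_gt0.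
have rcvg : r_ @ \oo --> (0%R : R).
  apply: (@squeeze_cvgr _ _ _ _ (cst 0%R) (@harmonic R)); last exact: cvg_harmonic.
    apply: nearW => k; rewrite /= ltW //= /r_ /harmonic /= div1r lef_pV2 ?posrE ?ltr0n ?expn_gt0 //.
    by rewrite ler_nat addn1 ltnW // ltn_expl.
  exact: cvg_cst.
have /choice[s hs] (k : nat) : exists j : nat, (k <= j)%N /\ exists O : set T,
    [/\ measurable O, m O <= (r_ k)%:E &
       forall x, D x -> (r_ k <= `|f_ j x - f x|)%R -> O x].
  have [N _ hN] := h _ _ (r0 k) (r0 k).
  exists (maxn k N); split; first exact: leq_maxl.
  by apply: hN; exact: leq_maxr.
exists s; split; first by move=> k; have [] := hs k.
have [U hU] := choice (fun k => (hs k).2).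
have mU k : measurable (U k) by have [] := hU k.
exists (lim_sup_set U); split.
- by apply: bigcap_measurable => // k _; exact: bigcup_measurable.
- apply: lim_sup_set_cvg0 => //.
  apply: (@le_lt_trans _ _ (\sum_(k <oo) (r_ k)%:E)).
    by apply: lee_nneseries => // k _; have [] := hU k.
  have /cvg_lim -> // := @cvg_geometric_eseries_half R 1%R 0.
  by rewrite ltry.
- move=> x; apply: contra_notP => nx Dx.
  have [N hN] : exists N, forall k, (N <= k)%N -> ~ U k x.
    apply: contrapT => hN; apply: nx => N _.
    apply: contrapT => hN2; apply: hN; exists N => k Nk Ukx.
    by apply: hN2; exists k.
  apply/cvgrPdist_lt => e e0.
  move/cvgrPdist_lt : rcvg => /(_ e e0); apply: filter_app; near=> k.
  rewrite sub0r normrN ger0_norm ?ltW // => hk.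
  have /contra_not := (let: And3 _ _ q := hU k in q) x Dx.
  move=> /(_ (hN k _)) => h2; rewrite distrC; apply: le_lt_trans hk.
  rewrite leNgt; apply/negP => h3; apply: h2; last exact: ltW.
  by near: k; exact: nbhs_infty_ge.
Unshelve. all: by end_near.
Qed.

(** Chebyshev's inequality puts convergence in [L^p] into the form that [cvg_measure_ae] expects. *)
Lemma Lp_cvg_ae D (f_ : nat -> T -> R) f (p : R) : measurable D -> (0 < p)%R ->
  (forall k, measurable_fun D (f_ k)) -> measurable_fun D f ->
  (fun k => \int[m]_(x in D) (`|f_ k x - f x| `^ p)%:E) @ \oo --> 0 ->
  exists s : nat -> nat, (forall k, (k <= s k)%N) /\
    {ae m, forall x, D x -> (fun k => f_ (s k) x) @ \oo --> f x}.
Proof.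
move=> mD p0 mf_ mf h; apply: cvg_measure_ae => e r e0 r0.
have ep : (0 < e `^ p)%R by rewrite powR_gt0.
have h0 k : 0 <= \int[m]_(x in D) (`|f_ k x - f x| `^ p)%:E.
  by apply: integral_ge0 => x _; rewrite lee_fin powR_ge0.
have hk := (ecvg0P h0).1 h _ (mulr_gt0 ep r0).
apply: filterS hk => k hk.
pose g x := (`|f_ k x - f x| `^ p)%:E.
have mg : measurable_fun D g.
  apply/measurable_EFinP; apply: (measurableT_comp (measurable_powR p)).
  by apply: measurableT_comp => //; exact: measurable_funB.
exists (D `&` [set x | (e `^ p)%:E <= `|g x|]); split.
- by apply: emeasurable_fun_c_infty => //; exact: measurableT_comp.
- rewrite -(@lee_pmul2l _ (e `^ p)%:E) ?lte_fin //.
  apply: le_trans (le_integral_abse m mD mg ep) _; rewrite -EFinM.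
  apply: le_trans hk; apply: ge0_le_integral => //.
    exact: measurableT_comp.
  by move=> x _; rewrite /g abse_EFin lee_fin ger0_norm // powR_ge0.
- move=> x Dx h2; split => //=; rewrite lee_fin ger0_norm ?powR_ge0 //.
  by apply: ge0_ler_powR => //; rewrite ?nnegrE ?ltW.
Qed.

End measure_convergence.

(** * Inequalities in Euclidean space *)
Section euclidean.
Context {R : realType} {m : nat}.
Implicit Types v w : 'rV[R]_m.

Lemma dotvC v w : dotv v w = dotv w v.
Proof. by apply: eq_bigr => i _; rewrite mulrC. Qed.

Lemma dotvDr u v w : dotv u (v + w) = dotv u v + dotv u w :> R.
Proof.
by rewrite /dotv -big_split; apply: eq_bigr => i _; rewrite mxE mulrDr.
Qed.

Lemma dotvZr u c v : dotv u (c *: v) = c * dotv u v :> R.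
Proof. by rewrite /dotv mulr_sumr; apply: eq_bigr => i _; rewrite mxE; ring. Qed.

Lemma dotvv_ge0 v : 0 <= dotv v v.
Proof. by apply: sumr_ge0 => i _; rewrite -expr2 sqr_ge0. Qed.

Lemma enorm_ge0 v : 0 <= enorm v.
Proof. exact: sqrtr_ge0. Qed.

Lemma sqr_enorm v : enorm v ^+ 2 = dotv v v.
Proof. by rewrite sqr_sqrtr // dotvv_ge0. Qed.

Lemma enorm0 : enorm (0 : 'rV[R]_m) = 0.
Proof. by rewrite /enorm /dotv big1 ?sqrtr0 // => i _; rewrite mxE mul0r. Qed.

Lemma enorm_eq0 v : enorm v = 0 -> v = 0.
Proof.
move=> h; have /eqP : dotv v v = 0 by rewrite -sqr_enorm h expr0n.
rewrite psumr_eq0 => [/allP h2|i _]; last by rewrite -expr2 sqr_ge0.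
apply/rowP => i; rewrite mxE.
by have := h2 i (mem_index_enum i); rewrite /= -expr2 sqrf_eq0 => /eqP.
Qed.

Lemma enormZ c v : enorm (c *: v) = `|c| * enorm v.
Proof.
rewrite /enorm dotvZr dotvC dotvZr mulrA -expr2 sqrtrM ?sqr_ge0 //.
by rewrite sqrtr_sqr.
Qed.

(** Cauchy-Schwarz, by expanding the squared norms of [|w| v + |v| w] and [|w| v - |v| w]. *)
Lemma normr_dotv v w : `|dotv v w| <= enorm v * enorm w.
Proof.
have [/enorm_eq0 ->|v0] := eqVneq (enorm v) 0.
  by rewrite /dotv big1 ?normr0 ?mulr_ge0 ?enorm_ge0 // => i _; rewrite mxE mul0r.
have [/enorm_eq0 ->|w0] := eqVneq (enorm w) 0.
  by rewrite /dotv big1 ?normr0 ?mulr_ge0 ?enorm_ge0 // => i _; rewrite mxE mulr0.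
have vp : 0 < enorm v by rewrite lt_neqAle eq_sym v0 enorm_ge0.
have wp : 0 < enorm w by rewrite lt_neqAle eq_sym w0 enorm_ge0.
have expand (e : R) : dotv (enorm w *: v + (e * enorm v) *: w)
   (enorm w *: v + (e * enorm v) *: w) =
   (1 + e ^+ 2) * (enorm v * enorm w) ^+ 2 + 2 * e * (enorm v * enorm w) * dotv v w.
  rewrite !dotvDr !dotvZr !(dotvC (_ + _)) !dotvDr !dotvZr (dotvC w v) -!sqr_enorm.
  ring.
have := dotvv_ge0 (enorm w *: v + (1 * enorm v) *: w).
have := dotvv_ge0 (enorm w *: v + (-1 * enorm v) *: w).
rewrite !expand; have := mulr_gt0 vp wp; set P := enorm v * enorm w => P0 h1 h2.
rewrite ler_norml; apply/andP; split.
  rewrite -subr_ge0 opprK -(pmulr_rge0 _ (mulr_gt0 (ltr0Sn R 1) P0)).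
  by apply: le_trans h2 _; rewrite le_eqVlt; apply/orP; left; apply/eqP; ring.
rewrite -subr_ge0 -(pmulr_rge0 _ (mulr_gt0 (ltr0Sn R 1) P0)).
by apply: le_trans h1 _; rewrite le_eqVlt; apply/orP; left; apply/eqP; ring.
Qed.

Lemma enormD v w : enorm (v + w) <= enorm v + enorm w.
Proof.
rewrite -(@ler_pXn2r _ 2) ?nnegrE ?enorm_ge0 ?addr_ge0 ?enorm_ge0 //.
rewrite sqr_enorm dotvDr !(dotvC (_ + _)) !dotvDr (dotvC w v) -!sqr_enorm.
have := le_trans (ler_norm _) (normr_dotv v w); set a := enorm v; set b := enorm w.
by rewrite sqrrD mulr2n => h; lra.
Qed.

Lemma ge0_powRD (p a b : R) : 0 <= p -> 0 <= a -> 0 <= b ->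
  (a + b) `^ p <= 2 `^ p * (a `^ p + b `^ p).
Proof.
move=> p0 a0 b0.
wlog ab : a b a0 b0 / a <= b.
  by move=> h; have [/h|/ltW/h] := leP a b; [exact|rewrite addrC [X in _ * X]addrC; exact].
apply: (@le_trans _ _ ((2 * b) `^ p)).
  by apply: ge0_ler_powR; rewrite ?nnegrE ?addr_ge0 ?mulr_ge0 //; lra.
by rewrite powRM // ler_wpM2l ?powR_ge0 // lerDr powR_ge0.
Qed.

Lemma enormD_powR (p : R) v w : 0 <= p ->
  enorm (v + w) `^ p <= 2 `^ p * (enorm v `^ p + enorm w `^ p).
Proof.
move=> p0; apply: le_trans (ge0_powRD p0 (enorm_ge0 v) (enorm_ge0 w)).
by apply: ge0_ler_powR; rewrite ?nnegrE ?addr_ge0 ?enorm_ge0 ?enormD.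
Qed.

(** Comparing [b] with [t a] shows that one of the two terms on the right is already enough. With
    [t] free, this does the work of Hoelder's inequality below. *)
Lemma young_eps (p a b t : R) : 1 < p -> 0 <= a -> 0 <= b -> 0 < t ->
  a `^ (p - 1) * b <= t * a `^ p + t `^ (1 - p) * b `^ p.
Proof.
move=> p1 a0 b0 t0.
have p0 : 0 < p by lra.
have [h|h] := leP b (t * a).
  apply: (@le_trans _ _ (t * a `^ p)).
    rewrite -(mulr_powRB1 a0 p0) mulrA mulrC.
    by rewrite ler_wpM2r ?powR_ge0.
  by rewrite lerDl mulr_ge0 ?powR_ge0.
apply: (@le_trans _ _ (t `^ (1 - p) * b `^ p)); last first.
  by rewrite lerDr mulr_ge0 ?powR_ge0 // ltW.
rewrite -(mulr_powRB1 b0 p0) [b * _]mulrC mulrA ler_wpM2r //.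
have -> : t `^ (1 - p) = (t^-1) `^ (p - 1).
  by rewrite -(powR_inv1 (ltW t0)) -powRrM; congr (_ `^ _); ring.
rewrite -powRM ?invr_ge0 ?(ltW t0) //.
apply: ge0_ler_powR; rewrite ?nnegrE ?mulr_ge0 ?invr_ge0 ?(ltW t0) //; first by lra.
by rewrite mulrC ler_pdivlMr // mulrC ltW.
Qed.

Lemma lte_EFin_mul (c : R) (x : \bar R) : 0 <= c -> (x < +oo)%E -> (c%:E * x < +oo)%E.
Proof. by move=> c0; apply: lte_mul_pinfty; rewrite ?lee_fin. Qed.

Lemma sube_exchange_ge0 (x y a b : R) : (a%:E <= y%:E)%E -> (b%:E <= x%:E)%E ->
  (0 <= x%:E - a%:E - - (y%:E - b%:E))%E.
Proof.
rewrite !lee_fin => ay bx.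
by change (0%:E <= (x - a - - (y - b))%:E)%E; rewrite lee_fin; lra.
Qed.

Lemma lee_sum3 (c a0 a1 a2 x0 x1 x2 : \bar R) :
  (0 <= x0)%E -> (0 <= x1)%E -> (0 <= x2)%E ->
  (`|a0| <= c * x0)%E -> (`|a1| <= c * x1)%E -> (`|a2| <= c * x2)%E ->
  (a0 + (a1 + a2) <= c * (x0 + x1 + x2))%E.
Proof.
move=> h0 h1 h2 k0 k1 k2; rewrite ge0_muleDr ?adde_ge0 // ge0_muleDr // -addeA.
apply: leeD; first exact: le_trans (lee_abs _) k0.
by apply: leeD; [exact: le_trans (lee_abs _) k1|exact: le_trans (lee_abs _) k2].
Qed.

End euclidean.

(** * Regularized powers *)
Section regularized_power.
Context {R : realType} {n : nat}.
Local Notation H := (heis R n).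
Implicit Types (Omega : set H) (f g : H -> R) (q r s : R).

Definition regpow s q r : R := (r ^+ 2 + s ^+ 2) `^ q.

Lemma regpow_gt0 s q r : 0 < s -> 0 < regpow s q r.
Proof. by move=> s0; rewrite powR_gt0 // ltr_wpDl ?sqr_ge0 ?exprn_gt0. Qed.

Lemma regpow_half s r : regpow s 2^-1 r = Num.sqrt (r ^+ 2 + s ^+ 2).
Proof. by rewrite /regpow powR12_sqrt // addr_ge0 ?sqr_ge0. Qed.

Lemma regpow0 s : 0 <= s -> regpow s 2^-1 0 = s.
Proof. by move=> s0; rewrite regpow_half expr0n add0r sqrtr_sqr ger0_norm. Qed.

(** Reduces estimates to the exponent 1/2, where the regularization lies between [|r|] and
    [|r| + s]. *)
Lemma regpow_half_powR s q r : regpow s q r = (regpow s 2^-1 r) `^ (2 * q).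
Proof. by rewrite /regpow -powRrM; congr (_ `^ _); field. Qed.

Lemma le_regpow_norm s r : `|r| <= regpow s 2^-1 r.
Proof.
by rewrite regpow_half -sqrtr_sqr ler_wsqrtr // lerDl sqr_ge0.
Qed.

Lemma le_regpow_eps s r : 0 <= s -> s <= regpow s 2^-1 r.
Proof.
by move=> s0; rewrite regpow_half -{1}(ger0_norm s0) -sqrtr_sqr ler_wsqrtr // lerDr sqr_ge0.
Qed.

Lemma regpow_le s r : 0 <= s -> regpow s 2^-1 r <= `|r| + s.
Proof.
move=> s0; rewrite regpow_half -[leRHS]ger0_norm ?addr_ge0 // -sqrtr_sqr ler_wsqrtr //.
rewrite -[r ^+ 2]real_normK ?num_real //.
have := mulr_ge0 (normr_ge0 r) s0; nra.
Qed.

Lemma regpow_cvg (s : R^nat) r : (forall k, 0 < s k) -> s @ \oo --> (0 : R) ->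
  (fun k => regpow (s k) 2^-1 r) @ \oo --> `|r|.
Proof.
move=> s0 sc.
apply: (@squeeze_cvgr _ _ _ _ (cst `|r|) (fun k => `|r| + s k)).
- by apply: nearW => k; rewrite /= le_regpow_norm regpow_le // ltW.
- exact: cvg_cst.
- by rewrite -[X in _ --> X]addr0; apply: cvgD => //; exact: cvg_cst.
Qed.

Lemma smooth_regpow s q f : 0 < s -> smooth f -> smooth (regpow s q \o f).
Proof. by move=> s0 sf; apply: smooth_comp => //; exact: smoothR_sqrD_powR. Qed.

Lemma hgrad_regpow s q f z : 0 < s -> smooth f ->
  hgrad (regpow s q \o f) z = (2 * q * f z * regpow s (q - 1) (f z)) *: hgrad f z.
Proof.
move=> s0 sf.
have dg (x : R) : is_derive x (1:R) (regpow s q) (2 * q * x * regpow s (q - 1) x).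
  exact: is_derive_sqrD_powR.
by rewrite (hgrad_comp z dg sf).
Qed.

Lemma smoothDl (c : R) f : smooth f -> smooth (fun z => f z + c).
Proof.
by move=> sf; have -> : (fun z => f z + c) = f + cst c by []; apply: smoothD => //; exact: smooth_cst.
Qed.

Lemma hgradDl (c : R) f z : smooth f -> hgrad (fun z => f z + c) z = hgrad f z.
Proof.
move=> sf; have -> : (fun z => f z + c) = f + cst c by [].
by rewrite hgradD //; [rewrite hgrad_cst addr0|exact: smooth_cst].
Qed.

Lemma smoothZ (c : R) f : smooth f -> smooth (fun z => c * f z).
Proof.
by move=> sf; have -> : (fun z => c * f z) = cst c * f by []; apply: smoothM => //; exact: smooth_cst.
Qed.

Lemma hgradZ (c : R) f z : smooth f -> hgrad (fun z => c * f z) z = c *: hgrad f z.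
Proof.
move=> sf; have -> : (fun z => c * f z) = cst c * f by [].
by rewrite hgradM //; [rewrite hgrad_cst scaler0 addr0|exact: smooth_cst].
Qed.

Lemma smoothX f m : smooth f -> smooth (fun z => f z ^+ m).
Proof.
move=> sf; elim: m => [|m IH].
  have -> : (fun z => f z ^+ 0) = cst 1 by apply/funext => z; rewrite expr0.
  exact: smooth_cst.
have -> : (fun z => f z ^+ m.+1) = f * (fun z => f z ^+ m).
  by apply/funext => z; rewrite exprS.
exact: smoothM.
Qed.

Lemma hgradX f m z : smooth f ->
  hgrad (fun z => f z ^+ m.+1) z = (m.+1%:R * f z ^+ m) *: hgrad f z.
Proof.
move=> sf; elim: m => [|m IH].
  have -> : (fun z => f z ^+ 1) = f by [].
  by rewrite mulr1 scale1r.
have -> : (fun z => f z ^+ m.+2) = f * (fun z => f z ^+ m.+1).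
  by apply/funext => w; rewrite exprS.
rewrite hgradM //; last exact: smoothX.
rewrite IH.
rewrite scalerA -scalerDl; congr (_ *: _).
by rewrite [f z ^+ m.+1]exprS -[m.+2%:R]natr1; ring.
Qed.

Lemma test_functionZ Omega (c : R) f :
  test_function Omega f -> test_function Omega (fun z => c * f z).
Proof. exact: (test_functionMl (smooth_cst c)). Qed.

Lemma test_functionB Omega f g : test_function Omega f -> test_function Omega g ->
  test_function Omega (fun z => f z - g z).
Proof.
move=> tf tg; have -> : (fun z => f z - g z) = f + (fun z => -1 * g z).
  by apply/funext => w; rewrite /GRing.add /= mulN1r.
exact: test_functionD tf (test_functionZ (-1) tg).
Qed.

Lemma hgradB f g z : smooth f -> smooth g ->
  hgrad (fun z => f z - g z) z = hgrad f z - hgrad g z.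
Proof.
move=> sf sg; have -> : (fun z => f z - g z) = f + (fun z => -1 * g z).
  by apply/funext => w; rewrite /GRing.add /= mulN1r.
rewrite hgradD //; last exact: smoothZ.
by rewrite hgradZ // scaleN1r.
Qed.

End regularized_power.

(** * A smooth damping factor in place of a truncation *)

Section damping.
Context {R : realType}.
Implicit Types (a b : R) (m : nat).

Lemma regpow_continuous (s q : R) : 0 < s -> continuous (regpow s q).
Proof.
move=> s0 x; apply: differentiable_continuous; apply/derivable1_diffP.
by have [] := is_derive_sqrD_powR q x s0.
Qed.

(* At least [1/2] where [a^2 + b^2 <= 1], and at most [2^-m] where [a^2 + b^2 >= 4]. *)
Definition damp m a b : R := regpow 1 (- 1) ((a ^+ 2 + b ^+ 2) ^+ m.+1).

(* The partial derivative of [damp m] with respect to its first variable. *)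
Definition ddamp m a b : R :=
  2 * (- 1) * (a ^+ 2 + b ^+ 2) ^+ m.+1 *
    regpow 1 (- 1 - 1) ((a ^+ 2 + b ^+ 2) ^+ m.+1) *
  (m.+1%:R * (a ^+ 2 + b ^+ 2) ^+ m) * (2 * a).

Lemma dampE m a b : damp m a b = (((a ^+ 2 + b ^+ 2) ^+ m.+1) ^+ 2 + 1)^-1.
Proof. by rewrite /damp /regpow expr1n powR_inv1 // addr_ge0 ?sqr_ge0. Qed.

Lemma damp_ge0 m a b : 0 <= damp m a b.
Proof. by rewrite ltW // regpow_gt0. Qed.

Lemma damp_le1 m a b : damp m a b <= 1.
Proof. by rewrite dampE invf_le1 ?lerDr ?sqr_ge0 // ltr_wpDl ?sqr_ge0. Qed.

Lemma damp_ge m a b : a ^+ 2 + b ^+ 2 <= 1 -> 1 <= 2 * damp m a b.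
Proof.
move=> V1; rewrite dampE ler_pdivlMr ?ltr_wpDl ?sqr_ge0 // mul1r.
have : ((a ^+ 2 + b ^+ 2) ^+ m.+1) ^+ 2 <= 1.
  by rewrite -exprM exprn_ile1 // addr_ge0 ?sqr_ge0.
lra.
Qed.

(** The denominator is at least [4^(m+1)]: one factor [2^(m+1)] absorbs the [m+1] that
    differentiation produces, the other leaves [2^-m]. *)
Lemma damp_le m a b : 4 <= a ^+ 2 + b ^+ 2 -> m.+1%:R * damp m a b <= 2^-1 ^+ m.
Proof.
move=> V4; rewrite dampE; set V := _ + _ in V4 *.
have q1 : 1 <= V ^+ m.+1 by rewrite exprn_ege1 //; lra.
have h : 2 ^+ m.+1 * 2 ^+ m.+1 <= (V ^+ m.+1) ^+ 2 + 1.
  rewrite -exprMn; apply: (@le_trans _ _ (V ^+ m.+1)).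
    by rewrite lerXn2r ?nnegrE //; lra.
  nra.
have D0 : 0 < (V ^+ m.+1) ^+ 2 + 1 by rewrite ltr_wpDl ?sqr_ge0.
rewrite ler_pdivrMr //; apply: le_trans (ler_wpM2l _ h); last by rewrite exprn_ge0.
rewrite exprVn mulrC ler_pdivlMr ?exprn_gt0 //.
apply: ler_pM; rewrite ?exprn_ge0 //.
  by rewrite -natrX ler_nat ltnW // ltn_expl.
by apply: ler_weXn2l => //; lra.
Qed.

(** With [V = a^2 + b^2] and [q = V^(m+1)] the derivative is [-4 (m+1) q V^m a / (q^2 + 1)^2], and
    [q V^m |a| <= 3 (q^2 + 1)], whence 12. So the derivative is bounded, and small wherever
    [(m+1) * damp] is. *)
Lemma normr_ddamp m a b : `|ddamp m a b| <= 12 * (m.+1%:R * damp m a b).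
Proof.
rewrite /ddamp; set V := a ^+ 2 + b ^+ 2; set q := V ^+ m.+1.
have V0 : 0 <= V by rewrite addr_ge0 ?sqr_ge0.
have q0 : 0 <= q by rewrite exprn_ge0.
have D0 : 0 < q ^+ 2 + 1 by rewrite ltr_wpDl ?sqr_ge0.
have -> : regpow 1 (- 1 - 1) q = (q ^+ 2 + 1)^-1 * (q ^+ 2 + 1)^-1.
  rewrite /regpow expr1n powRD ?(gt_eqF D0) ?implybT //.
  by rewrite powR_inv1 // ltW.
have -> : damp m a b = (q ^+ 2 + 1)^-1 by rewrite dampE.
set D := (q ^+ 2 + 1)^-1.
have D1 : 0 < D by rewrite invr_gt0.
have aV : `|a| <= 1 + V.
  have : `|a| ^+ 2 <= V by rewrite real_normK ?num_real // lerDl sqr_ge0.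
  have := normr_ge0 a; nra.
have Vm : V ^+ m <= 1 + q.
  have [V1|V1] := leP V 1.
    by apply: (@le_trans _ _ 1); [rewrite exprn_ile1|rewrite lerDl].
  rewrite /q exprS; apply: (@le_trans _ _ (V * V ^+ m)); last by rewrite lerDr.
  by rewrite ler_peMl ?exprn_ge0 // ltW.
have VmV : V ^+ m * V = q by rewrite /q exprSr.
have Vm0 : 0 <= V ^+ m by rewrite exprn_ge0.
have key : q * V ^+ m * `|a| <= 3 * D^-1.
  rewrite /D invrK; apply: (@le_trans _ _ (q * V ^+ m * (1 + V))).
    by rewrite ler_wpM2l // mulr_ge0.
  rewrite mulrDr mulr1 -[_ * _ * V]mulrA VmV.
  have : q * V ^+ m <= q * (1 + q) by rewrite ler_wpM2l.
  have := sqr_ge0 (q - 1); nra.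
rewrite (_ : _ * _ = - (4 * m.+1%:R * D * D * (q * V ^+ m * a))); last by ring.
rewrite normrN normrM [X in X * _]ger0_norm; last by rewrite !mulr_ge0 // ltW.
rewrite normrM [X in _ * (X * _)]ger0_norm ?mulr_ge0 //.
apply: le_trans (ler_wpM2l _ key) _; first by rewrite !mulr_ge0 // ltW.
by rewrite le_eqVlt; apply/orP; left; apply/eqP; field; rewrite gt_eqF.
Qed.

(** Either [a^2 + b^2 <= 1] and the damping factor is at least 1/2, or [|a| + |b| >= 1]. Being valid
    at every point, it can be integrated against any measure. *)
Lemma sqr_le_damp m a b c : 0 <= c <= 1 ->
  c ^+ 2 <= 2 * (c ^+ 2 * damp m a b) + (`|a| + `|b|).
Proof.
move=> /andP[c0 c1]; have [V1|V1] := leP (a ^+ 2 + b ^+ 2) 1.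
  have := damp_ge m V1; have := normr_ge0 a; have := normr_ge0 b; have := sqr_ge0 c.
  nra.
have h : 1 <= `|a| + `|b|.
  move: V1; rewrite -(real_normK (num_real a)) -(real_normK (num_real b)).
  have := normr_ge0 a; have := normr_ge0 b; nra.
have := mulr_ge0 (sqr_ge0 c) (damp_ge0 m a b); nra.
Qed.

Lemma cvg_exprn k (u : R^nat) (l : R) : u @ \oo --> l ->
  (fun i => u i ^+ k) @ \oo --> l ^+ k.
Proof. exact: (continuous_cvg _ (@exprn_continuous _ k l)). Qed.

Lemma damp_cvg m (a b : R^nat) (x y : R) : a @ \oo --> x -> b @ \oo --> y ->
  (fun k => damp m (a k) (b k)) @ \oo --> damp m x y.
Proof.
move=> ax bx; apply: (continuous_cvg _ (@regpow_continuous 1 (- 1) ltr01 _)).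
apply: (@cvg_exprn _ (fun k => a k ^+ 2 + b k ^+ 2)).
by apply: cvgD; apply: cvg_exprn.
Qed.

Lemma ddamp_cvg m (a b : R^nat) (x y : R) : a @ \oo --> x -> b @ \oo --> y ->
  (fun k => ddamp m (a k) (b k)) @ \oo --> ddamp m x y.
Proof.
move=> ax bx.
have V : (fun k => a k ^+ 2 + b k ^+ 2) @ \oo --> x ^+ 2 + y ^+ 2.
  by apply: cvgD; apply: cvg_exprn.
apply: cvgM; last by apply: cvgM => //; exact: cvg_cst.
apply: cvgM; last by apply: cvgM; [exact: cvg_cst|exact: cvg_exprn].
apply: cvgM; first by apply: cvgM; [exact: cvg_cst|exact: cvg_exprn].
by apply: (continuous_cvg _ (@regpow_continuous 1 (- 1 - 1) ltr01 _)); exact: cvg_exprn.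
Qed.

End damping.

Section damping_measurable.
Context d (T : measurableType d) (R : realType) (D : set T).
Implicit Types f g : T -> R.

Lemma measurable_regpow (s q : R) f : measurable_fun D f ->
  measurable_fun D (fun x => regpow s q (f x)).
Proof.
move=> mf; apply: (measurableT_comp (measurable_powR _)).
by apply: measurable_funD => //; exact: measurable_funX.
Qed.

Lemma measurable_damp m f g : measurable_fun D f -> measurable_fun D g ->
  measurable_fun D (fun x => damp m (f x) (g x)).
Proof.
move=> mf mg; apply: measurable_regpow; apply: measurable_funX.
by apply: measurable_funD; exact: measurable_funX.
Qed.

Lemma measurable_ddamp m f g : measurable_fun D f -> measurable_fun D g ->
  measurable_fun D (fun x => ddamp m (f x) (g x)).
Proof.
move=> mf mg; have mV : measurable_fun D (fun x => f x ^+ 2 + g x ^+ 2).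
  by apply: measurable_funD; exact: measurable_funX.
apply: measurable_funM; last exact: measurable_funM.
apply: measurable_funM; last by apply: measurable_funM => //; exact: measurable_funX.
apply: measurable_funM; first by apply: measurable_funM => //; exact: measurable_funX.
by apply: measurable_regpow; exact: measurable_funX.
Qed.

End damping_measurable.

Section damping_heis.
Context {R : realType} {n : nat}.
Local Notation H := (heis R n).
Implicit Types (f g : H -> R) (m : nat).

Lemma smooth_damp m f g : smooth f -> smooth g ->
  smooth (fun z => damp m (f z) (g z)).
Proof.
move=> sf sg; apply: (@smooth_regpow _ _ 1 (- 1) (fun z => (f z ^+ 2 + g z ^+ 2) ^+ m.+1)) => //.
apply: (@smoothX _ _ (fun z => f z ^+ 2 + g z ^+ 2)).
by apply: (@smoothD _ _ (fun z => f z ^+ 2) (fun z => g z ^+ 2)); exact: smoothX.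
Qed.

Lemma hgrad_damp m f g z : smooth f -> smooth g ->
  hgrad (fun z => damp m (f z) (g z)) z =
  ddamp m (f z) (g z) *: hgrad f z + ddamp m (g z) (f z) *: hgrad g z.
Proof.
move=> sf sg.
have sf2 := smoothX 2 sf; have sg2 := smoothX 2 sg.
have sV := smoothD sf2 sg2; set W := (X in smooth X) in sV.
have -> : (fun z => damp m (f z) (g z)) = regpow 1 (- 1) \o (fun z => W z ^+ m.+1) by [].
rewrite (hgrad_regpow _ _ ltr01 (smoothX m.+1 sV)) (hgradX m z sV).
rewrite (hgradD z sf2 sg2) (hgradX 1 z sf) (hgradX 1 z sg) scalerA scalerDr !scalerA.
rewrite /ddamp [g z ^+ 2 + _]addrC.
by congr (_ *: _ + _ *: _); rewrite !expr1 /W /=.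
Qed.

End damping_heis.

(** * The pointwise Picone inequality *)
Section picone_real.
Context {R : realType}.
Implicit Types a b c p q r s x : R.

(** Young's inequality for the exponents [p] and [p / (p - 1)], with equality at [b = c]; Picone's
    inequality rests on it. *)
Lemma young_picone p b c : 1 < p -> 0 <= b -> 0 <= c ->
  p * (c `^ (p - 1) * b) <= b `^ p + (p - 1) * c `^ p.
Proof.
move=> p1 b0 c0; have p0 : 0 < p by lra.
have q0 : 0 < p / (p - 1) by rewrite divr_gt0 //; lra.
have pq : p^-1 + (p / (p - 1))^-1 = 1 by field; rewrite !gt_eqF //; lra.
have := conjugate_powR b0 (powR_ge0 c (p - 1)) p0 q0 pq.
rewrite -powRrM (_ : (p - 1) * _ = p); last by field; rewrite gt_eqF //; lra.
rewrite -(ler_pM2l p0) => h; rewrite [c `^ _ * b]mulrC; apply: le_trans h _.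
by rewrite le_eqVlt; apply/orP; left; apply/eqP; field; rewrite !gt_eqF //; lra.
Qed.

(* [regpow s (p / 2) phi] and [regpow s ((1 - p) / 2) x] regularize [|phi|^p] and
   [x^(1-p)]; the two summands on the left are the coefficients of the horizontal
   gradient of their product, tested against [|Du|^(p-2) Du]. *)
Lemma picone_regularized p s a v phi D g X : 1 < p -> 0 < s -> 0 < a -> 0 <= v ->
  0 <= D -> 0 <= g -> `|X| <= D `^ (p - 1) * g ->
  2 * (p / 2) * phi * regpow s (p / 2 - 1) phi * regpow s ((1 - p) / 2) (v + a) * X +
  (regpow s (p / 2) phi - regpow s (p / 2) 0) *
    (2 * ((1 - p) / 2) * (v + a) * regpow s ((1 - p) / 2 - 1) (v + a)) * D `^ p <=
  g `^ p + (p - 1) * (s `^ p + (regpow s (p / 2) phi - regpow s (p / 2) 0) * (s / a))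
    / a `^ p * D `^ p.
Proof.
move=> p1 s0 a0 v0 D0 g0 hX.
have alg1 (x b y z d h : R) : b != 0 ->
  x * (y / b ^+ 2) * z * (b * (d * h)) = x * (y / b * d * z * h) by move=> *; field.
have alg2 (x y z t u w : R) : t != 0 -> u != 0 ->
  y * (2 * ((1 - x) / 2) * z / (t * u)) * w = - ((x - 1) * (y * (z / t)) * (w / u)).
  by move=> t0 u0; field; rewrite t0 u0.
have alg3 (x y z t w : R) : x * ((y + z) * w) + - (x * (y * t) * w) =
  x * ((z + y * (1 - t)) * w) by ring.
have alg4 (x y z w : R) : x * y / z * w = x * (y * (w / z)) by ring.
have p2 : 2 * (p / 2) = p by field.
have p0 : 0 < p by lra.
have va : 0 < v + a by lra.
set B := regpow s 2^-1 phi; set N := regpow s 2^-1 (v + a).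
have B0 : 0 < B by exact: regpow_gt0.
have N0 : 0 < N by exact: regpow_gt0.
have Bn : B != 0 by rewrite gt_eqF.
have Nn : N != 0 by rewrite gt_eqF.
have Bphi : `|phi| <= B by exact: le_regpow_norm.
have Nva : v + a <= N by rewrite -{1}(ger0_norm (ltW va)); exact: le_regpow_norm.
have Nvs : N <= v + a + s.
  by have := regpow_le (v + a) (ltW s0); rewrite (ger0_norm (ltW va)).
have -> : regpow s (p / 2) 0 = s `^ p.
  by rewrite regpow_half_powR regpow0 ?ltW //; congr (_ `^ _); field.
have -> : regpow s (p / 2) phi = B `^ p.
  by rewrite regpow_half_powR; congr (_ `^ _); field.
have -> : regpow s (p / 2 - 1) phi = B `^ p / B ^+ 2.
  rewrite regpow_half_powR -(powR_mulrn 2 (ltW B0)) -powRB; last by rewrite Bn implybT.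
  by congr (_ `^ _); field.
have -> : regpow s ((1 - p) / 2) (v + a) = N / N `^ p.
  rewrite regpow_half_powR -/N -[X in _ = X / _](powRr1 (ltW N0)) -powRB; last by rewrite Nn implybT.
  by congr (_ `^ _); field.
have -> : regpow s ((1 - p) / 2 - 1) (v + a) = (N * N `^ p)^-1.
  rewrite regpow_half_powR -/N -[X in _ = (X * _)^-1](powRr1 (ltW N0)) -powRD; last by rewrite Nn implybT.
  by rewrite -powRN; congr (_ `^ _); field.
have Bp : s `^ p <= B `^ p.
  apply: (ge0_ler_powR (ltW p0)); rewrite ?nnegrE; [exact: ltW|exact: ltW|].
  exact: (le_regpow_eps _ (ltW s0)).
set A := B `^ p - s `^ p; have A0 : 0 <= A by rewrite subr_ge0.
have Np0 : 0 < N `^ p by rewrite powR_gt0.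
have Npn : N `^ p != 0 by rewrite gt_eqF.
have Dp0 := powR_ge0 D p.
have Bp1 : B `^ (p - 1) = B `^ p / B by rewrite powRB ?Bn ?implybT // powRr1 // ltW.
have Np1 : N `^ (p - 1) = N `^ p / N by rewrite powRB ?Nn ?implybT // powRr1 // ltW.
have BDN q : (B * D / N) `^ q = B `^ q * D `^ q / N `^ q.
  rewrite powRM; [|exact: mulr_ge0 (ltW B0) D0|by rewrite invr_ge0 ltW].
  rewrite (powRM _ (ltW B0) D0); congr (_ * _).
  by rewrite -(powR_inv1 (ltW N0)) -powRrM mulN1r powRN.
(* Young's inequality with [c = B D / N], where [B] and [N] stand for [|phi|] and [v + a]. *)
have t1 : 2 * (p / 2) * phi * (B `^ p / B ^+ 2) * (N / N `^ p) * X <=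
    g `^ p + (p - 1) * (B * D / N) `^ p.
  have c0 : 0 <= B * D / N by exact: divr_ge0 (mulr_ge0 (ltW B0) D0) (ltW N0).
  apply: le_trans (young_picone p1 g0 c0).
  apply: le_trans (ler_norm _) _.
  have -> : (B * D / N) `^ (p - 1) = (B `^ p / B) * D `^ (p - 1) * (N / N `^ p).
    by rewrite BDN Bp1 Np1 invf_div.
  have k0 : 0 <= p * (B `^ p / B ^+ 2) * (N / N `^ p).
    by rewrite !mulr_ge0 ?invr_ge0 ?powR_ge0 ?sqr_ge0 ?(ltW N0) ?(ltW p0).
  have -> : 2 * (p / 2) * phi * (B `^ p / B ^+ 2) * (N / N `^ p) * X =
      p * (B `^ p / B ^+ 2) * (N / N `^ p) * (phi * X) by rewrite p2; ring.
  rewrite normrM (ger0_norm k0).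
  have h : `|phi * X| <= B * (D `^ (p - 1) * g) by rewrite normrM ler_pM.
  apply: le_trans (ler_wpM2l k0 h) _.
  by rewrite alg1.
(* For [s = 0] this negative term would cancel the second half of Young's bound exactly; what
   remains is the error term of the statement. *)
have t2 : A * (2 * ((1 - p) / 2) * (v + a) / (N * N `^ p)) * D `^ p =
    - ((p - 1) * (A * ((v + a) / N)) * (D `^ p / N `^ p)).
  exact: alg2.
have t3 : (B * D / N) `^ p = (A + s `^ p) * (D `^ p / N `^ p).
  by rewrite BDN /A subrK mulrA.
rewrite t2; apply: le_trans (lerD t1 (lexx _)) _; rewrite t3 -addrA lerD2l.
clearbody A N B.
have sp0 := powR_ge0 s p; have ap0 : 0 < a `^ p by rewrite powR_gt0.
have NpA : a `^ p <= N `^ p.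
  apply: (ge0_ler_powR (ltW p0)); rewrite ?nnegrE; [exact: ltW|exact: ltW|].
  by apply: le_trans Nva; rewrite lerDr.
rewrite alg3 [leRHS]alg4.
have vN : (v + a) / N <= 1 by rewrite ler_pdivrMr // mul1r.
(* Uses [N <= v + a + s] in the numerator and [a <= N] in the denominator. *)
have h2 : 1 - (v + a) / N <= s / a.
  have -> : 1 - (v + a) / N = (N - (v + a)) / N by rewrite mulrBl divff.
  apply: ler_pM; [by rewrite subr_ge0|by rewrite invr_ge0 ltW|by rewrite lerBlDr addrC|].
  by rewrite lef_pV2 ?posrE //; apply: le_trans Nva; rewrite lerDr.
apply: ler_wpM2l; first by rewrite subr_ge0 ltW.
apply: ler_pM.
- by rewrite addr_ge0 // mulr_ge0 // subr_ge0.
- by rewrite divr_ge0 // ltW.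
- by rewrite lerD2l ler_wpM2l.
- by rewrite ler_wpM2l // lef_pV2.
Qed.

Lemma regpowD s q r x : 0 < s -> regpow s (q + r) x = regpow s q x * regpow s r x.
Proof.
move=> s0; have h : x ^+ 2 + s ^+ 2 != 0 by rewrite gt_eqF // ltr_wpDl ?sqr_ge0 ?exprn_gt0.
by rewrite /regpow powRD // h implybT.
Qed.

Lemma regpow_le0 s q x : 0 < s -> q <= 0 -> regpow s q x <= regpow s q 0.
Proof.
move=> s0 q0; rewrite /regpow expr0n add0r -[q]opprK !(powRN _ (- q)).
have q0' : 0 <= - q by rewrite oppr_ge0.
rewrite lef_pV2 ?posrE ?powR_gt0 ?exprn_gt0 //; last by rewrite ltr_wpDl ?sqr_ge0 ?exprn_gt0.
by apply: (ge0_ler_powR q0'); rewrite ?nnegrE ?addr_ge0 ?sqr_ge0 // lerDr sqr_ge0.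
Qed.

(** Half a power of [x^2 + s^2] pays for the factor [x]. This bounds the derivative of a regularized
    negative power uniformly in [x]. *)
Lemma normr_mul_regpow_le s q x : 0 < s -> q + 2^-1 <= 0 ->
  `|x * regpow s q x| <= regpow s (q + 2^-1) 0.
Proof.
move=> s0 q0; apply: le_trans (regpow_le0 x s0 q0).
rewrite regpowD // mulrC normrM ger0_norm ?(ltW (regpow_gt0 _ _ s0)) //.
by rewrite ler_wpM2l ?(ltW (regpow_gt0 _ _ s0)) // le_regpow_norm.
Qed.

Lemma regpow_cvg_powR (s : R^nat) q r : (forall k, 0 < s k) -> s @ \oo --> (0 : R) ->
  r != 0 -> (fun k => regpow (s k) q r) @ \oo --> `|r| `^ (2 * q).
Proof.
move=> s0 sc r0.
rewrite (_ : (fun k => _) = (@powR R ^~ (2 * q)) \o (fun k => regpow (s k) 2^-1 r)); last first.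
  by apply/funext => k; rewrite /= -regpow_half_powR.
have c : {for `|r|, continuous (@powR R ^~ (2 * q))}.
  apply: differentiable_continuous; apply/derivable1_diffP; apply: derivable_powR.
  by rewrite in_itv /= andbT normr_gt0.
apply: (continuous_cvg _ c); exact: regpow_cvg.
Qed.

Lemma powR_cvg_0 p : 1 <= p -> (fun k => (harmonic k : R) `^ p) @ \oo --> (0 : R).
Proof.
move=> p1; apply: (@squeeze_cvgr _ _ _ _ (cst 0) (@harmonic R)).
- apply: nearW => k; rewrite powR_ge0 /=; apply: ge1r_powR => //.
  by rewrite /harmonic /= invr_gt0 ltr0Sn /= invf_le1 ?ler1n.
- exact: cvg_cst.
- exact: cvg_harmonic.
Qed.

Lemma regpow_sub_cvg p r : 1 < p ->
  (fun k => regpow (harmonic k) (p / 2) r - regpow (harmonic k) (p / 2) 0) @ \oo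
    --> `|r| `^ p.
Proof.
move=> p1; have s0 k : 0 < harmonic k :> R by rewrite /harmonic /= invr_gt0.
have [->|r0] := eqVneq r 0.
  under eq_fun do rewrite subrr.
  rewrite normr0 powR0; last by rewrite gt_eqF //; lra.
  exact: cvg_cst.
rewrite -[X in _ --> X]subr0; apply: cvgB.
  have -> : `|r| `^ p = `|r| `^ (2 * (p / 2)) by congr (_ `^ _); field.
  by apply: regpow_cvg_powR => //; exact: cvg_harmonic.
rewrite (_ : (fun k => _) = (fun k => (harmonic k : R) `^ p)); last first.
  by apply/funext => k; rewrite regpow_half_powR (regpow0 (ltW (s0 k))); congr (_ `^ _); field.
exact: powR_cvg_0 (ltW p1).
Qed.

Lemma regpow_sub_le p s r K : 1 < p -> 0 < s <= 1 -> `|r| <= K ->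
  0 <= regpow s (p / 2) r - regpow s (p / 2) 0 <= (K + 1) `^ p.
Proof.
move=> p1 /andP[s0 s1] rK; have p0 : 0 <= p by lra.
have K0 : 0 <= K by apply: le_trans rK.
have e : 2 * (p / 2) = p by field.
rewrite !(regpow_half_powR s (p / 2)) e (regpow0 (ltW s0)).
apply/andP; split.
  rewrite subr_ge0; apply: (ge0_ler_powR p0); rewrite ?nnegrE ?(ltW s0) ?(ltW (regpow_gt0 _ _ s0)) //.
  exact: (le_regpow_eps _ (ltW s0)).
apply: (@le_trans _ _ (regpow s 2^-1 r `^ p)); first by rewrite gerBl powR_ge0.
apply: (ge0_ler_powR p0); rewrite ?nnegrE ?(ltW (regpow_gt0 _ _ s0)) ?addr_ge0 //.
by apply: le_trans (regpow_le _ (ltW s0)) _; rewrite lerD.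
Qed.

(* A form of [(a + b)^p <= a^p + ...] that is sharp in [a], used instead of Minkowski. *)
Lemma powRD_eps p t a b : 0 <= p -> 0 < t -> 0 <= a -> 0 <= b ->
  (a + b) `^ p <= (1 + t) `^ p * a `^ p + (1 + t^-1) `^ p * b `^ p.
Proof.
move=> p0 t0 a0 b0; have ti : 0 < t^-1 by rewrite invr_gt0.
have [h|h] := leP b (t * a).
  apply: (@le_trans _ _ ((1 + t) `^ p * a `^ p)); last first.
    by rewrite lerDl mulr_ge0 ?powR_ge0.
  rewrite -powRM ?addr_ge0 ?(ltW t0) //.
  by apply: (ge0_ler_powR p0); rewrite ?nnegrE ?mulr_ge0 ?addr_ge0 ?(ltW t0) //; lra.
apply: (@le_trans _ _ ((1 + t^-1) `^ p * b `^ p)); last first.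
  by rewrite lerDr mulr_ge0 ?powR_ge0.
rewrite -powRM ?addr_ge0 ?(ltW ti) //.
apply: (ge0_ler_powR p0); rewrite ?nnegrE ?mulr_ge0 ?addr_ge0 ?(ltW ti) //.
rewrite mulrDl mul1r addrC lerD2l mulrC ler_pdivlMr // mulrC; exact: ltW.
Qed.

Lemma cvg_norm_powR p (x_ : R^nat) x : 1 <= p -> x_ @ \oo --> x ->
  (fun k => `|x_ k| `^ p) @ \oo --> `|x| `^ p.
Proof.
move=> p1 xc; have nc : (fun k => `|x_ k|) @ \oo --> `|x| by exact: cvg_norm.
have [x0|x0] := eqVneq x 0.
  rewrite x0 normr0 powR0; last by rewrite gt_eqF //; lra.
  rewrite x0 normr0 in nc.
  apply: (@squeeze_cvgr _ _ _ _ (cst 0) (fun k => `|x_ k|)); [|exact: cvg_cst|exact: nc].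
  have near1 : \forall k \near \oo, `|x_ k| < 1.
    by move/cvgr_lt : nc; apply; exact: ltr01.
  apply: filterS near1 => k hk; rewrite powR_ge0 /=.
  have [->|n0] := eqVneq (x_ k) 0; first by rewrite normr0 powR0 // gt_eqF //; lra.
  by apply: ge1r_powR => //; rewrite normr_gt0 n0 ltW.
have c : {for `|x|, continuous (@powR R ^~ p)}.
  apply: differentiable_continuous; apply/derivable1_diffP; apply: derivable_powR.
  by rewrite in_itv /= andbT normr_gt0.
by apply: (continuous_cvg _ c); exact: nc.
Qed.

Lemma cvg_powR_gt0 q (x_ : R^nat) x : 0 < x -> x_ @ \oo --> x ->
  (fun k => x_ k `^ q) @ \oo --> x `^ q.
Proof.
move=> x0 xc; have c : {for x, continuous (@powR R ^~ q)}.
  apply: differentiable_continuous; apply/derivable1_diffP; apply: derivable_powR.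
  by rewrite in_itv /= andbT.
by apply: (continuous_cvg _ c); exact: xc.
Qed.

End picone_real.

(** * Potential theory of one equation *)
Section potential.
Context {R : realType} {n : nat}.
Local Notation H := (heis R n).
Local Notation L := (@heis_lebesgue R n).
Local Notation V := 'rV[R]_(n + n).
Variables (p : R) (Omega : set H) (Du : H -> V).
Variable mu : {finite_measure set H -> \bar R}.
Hypotheses (p1 : 1 < p) (oOmega : open Omega).
Hypothesis mDu : forall i, measurable_fun Omega (fun z => Du z ord0 i).
Hypothesis EDu : (Lp_energy p Omega Du < +oo)%E.
Hypothesis eqDu : pLaplace_eq p Omega Du mu.
Implicit Types (f : H -> R) (F G : H -> V).

(** * The flux of a field, controlled by its energy *)

Definition mfield F := forall i, measurable_fun Omega (fun z => F z ord0 i).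

Let p0 : 0 < p. Proof. exact: lt_trans p1. Qed.
Let mOmega : measurable Omega. Proof. exact: open_measurable_heis. Qed.

Definition flux F (z : H) : R := enorm (Du z) `^ (p - 2) * dotv (Du z) (F z).

Lemma measurable_dotv F G : mfield F ->
  mfield G ->
  measurable_fun Omega (fun z => dotv (F z) (G z)).
Proof.
by move=> mF mG; apply: measurable_sum => i; apply: measurable_funM.
Qed.

Lemma measurable_enorm F : mfield F ->
  measurable_fun Omega (fun z => enorm (F z)).
Proof.
move=> mF; rewrite (_ : (fun _ => _) = fun z => dotv (F z) (F z) `^ 2^-1).
  by apply: (measurableT_comp (measurable_powR _)); exact: measurable_dotv.
by apply/funext => z; rewrite powR12_sqrt // dotvv_ge0.
Qed.

Lemma measurable_enorm_powR q F : mfield F ->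
  measurable_fun Omega (fun z => enorm (F z) `^ q).
Proof.
by move=> mF; apply: (measurableT_comp (measurable_powR _)); exact: measurable_enorm.
Qed.

Lemma measurable_flux F : mfield F ->
  measurable_fun Omega (flux F).
Proof.
by move=> mF; apply: measurable_funM; [exact: measurable_enorm_powR|exact: measurable_dotv].
Qed.

Lemma normr_flux F z : `|flux F z| <= enorm (Du z) `^ (p - 1) * enorm (F z).
Proof.
rewrite /flux normrM ger0_norm ?powR_ge0 //.
(* Where [Du] vanishes the power with exponent [p - 2] gives no estimate, but the scalar product is
   0. *)
have [/enorm_eq0 D0|D0] := eqVneq (enorm (Du z)) 0.
  rewrite D0 /dotv big1 => [|i _]; last by rewrite mxE mul0r.
  by rewrite normr0 mulr0 mulr_ge0 ?powR_ge0 ?enorm_ge0.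
apply: le_trans (ler_wpM2l (powR_ge0 _ _) (normr_dotv _ _)) _.
rewrite mulrA ler_wpM2r ?enorm_ge0 // -{2}(powRr1 (enorm_ge0 (Du z))).
by rewrite -powRD ?D0 ?implybT // (_ : p - 2 + 1 = p - 1) //; ring.
Qed.

Lemma normr_flux_eps F z t : 0 < t ->
  `|flux F z| <= t * enorm (Du z) `^ p + t `^ (1 - p) * enorm (F z) `^ p.
Proof.
by move=> t0; apply: le_trans (normr_flux F z) (young_eps _ _ _ _); rewrite ?enorm_ge0.
Qed.

Lemma flux_self z : flux Du z = enorm (Du z) `^ p.
Proof.
rewrite /flux -sqr_enorm.
have [->|D0] := eqVneq (enorm (Du z)) 0.
  by rewrite expr0n mulr0 powR0 // gt_eqF.
rewrite -(powR_mulrn 2 (enorm_ge0 _)) -powRD ?D0 ?implybT //.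
by congr (_ `^ _); ring.
Qed.

Lemma fluxZ (c : H -> R) F z : flux (fun z => c z *: F z) z = c z * flux F z.
Proof. by rewrite /flux dotvZr; ring. Qed.

Lemma fluxB F G z : flux (fun z => F z - G z) z = flux F z - flux G z.
Proof. by rewrite /flux -mulrBr dotvDr -[- G z]scaleN1r dotvZr mulN1r. Qed.

Lemma energy_ge0 F : (0 <= Lp_energy p Omega F)%E.
Proof. by apply: integral_ge0 => z _; rewrite lee_fin powR_ge0. Qed.

Lemma measurable_test f : smooth f -> measurable_fun Omega f.
Proof.
move=> sf; apply: measurable_funTS; apply: continuous_measurable_heis.
exact: smooth_continuous.
Qed.

Lemma measurable_hgrad f i : smooth f ->
  measurable_fun Omega (fun z => hgrad f z ord0 i).
Proof.
move=> sf; apply: measurable_funTS; apply: continuous_measurable_heis.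
exact: continuous_hgrad.
Qed.

Lemma mu_fin : (mu Omega < +oo)%E.
Proof. by rewrite -ge0_fin_numE // fin_num_measure. Qed.

Lemma integrable_test f : test_function Omega f -> mu.-integrable Omega (EFin \o f).
Proof.
move=> tf; apply: measurable_bounded_integrable => //.
- exact: mu_fin.
- by apply: measurable_test; case: tf.
- have [M hM] := test_function_bounded tf.
  by exists M; split; [exact: num_real|move=> y My x _; apply: le_trans (hM _) (ltW My)].
Qed.

Lemma integral_flux_test f : test_function Omega f ->
  (\int[L]_(z in Omega) (flux (hgrad f) z)%:E = \int[mu]_(z in Omega) (f z)%:E)%E.
Proof. by move=> /eqDu. Qed.

(** Finiteness comes from the equation: the integral of the flux equals a finite integral against
    [mu], and a finite value of the integral forces both the positive and the negative part to be
    integrable. *)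
Lemma integrable_flux_test f : test_function Omega f ->
  L.-integrable Omega (EFin \o flux (hgrad f)).
Proof.
move=> tf; apply: integrable_of_fin_num => //.
  by apply: measurable_flux => i; apply: measurable_hgrad; case: tf.
rewrite integral_flux_test //; apply: integrable_fin_num => //.
exact: integrable_test.
Qed.

Lemma integral_flux_le F t : 0 < t -> mfield F ->
  (\int[L]_(z in Omega) `|flux F z|%:E <=
    t%:E * Lp_energy p Omega Du + (t `^ (1 - p))%:E * Lp_energy p Omega F)%E.
Proof.
move=> t0 mF.
have mp G : mfield G ->
    measurable_fun Omega (fun z => (enorm (G z) `^ p)%:E).
  by move=> mG; apply/measurable_EFinP; exact: measurable_enorm_powR.
rewrite /Lp_energy -!ge0_integralZl_EFin ?powR_ge0 ?(ltW t0) //; try exact: mp.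
- rewrite -ge0_integralD //.
  + apply: ge0_le_integral => //.
    * by apply/measurable_EFinP; apply: measurableT_comp => //; exact: measurable_flux.
    * by apply: emeasurable_funD; apply: measurable_funeM; exact: mp.
    * by move=> z _; rewrite -!EFinM -EFinD lee_fin normr_flux_eps.
  + by move=> z _; rewrite -EFinM lee_fin mulr_ge0 ?powR_ge0 // ltW.
  + by apply: measurable_funeM; exact: mp.
  + by move=> z _; rewrite -EFinM lee_fin mulr_ge0 ?powR_ge0.
  + by apply: measurable_funeM; exact: mp.
- by move=> z _; rewrite lee_fin powR_ge0.
- by move=> z _; rewrite lee_fin powR_ge0.
Qed.

(** Continuity of the flux at 0 with respect to the energy: in [integral_flux_le], [t] is chosen
    first, so that the fixed energy of [Du] contributes at most [r / 2], and then [e]. *)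
Lemma integral_flux_small (r : R) : 0 < r -> exists2 e : R, 0 < e &
  forall F, mfield F ->
    (Lp_energy p Omega F <= e%:E)%E ->
    (\int[L]_(z in Omega) `|flux F z|%:E <= r%:E)%E.
Proof.
move=> r0; pose A := fine (Lp_energy p Omega Du).
have A0 : 0 <= A by exact/fine_ge0/energy_ge0.
have EA : Lp_energy p Omega Du = A%:E by rewrite fineK // ge0_fin_numE // energy_ge0.
(* [A + 1] keeps the denominator positive when [Du] has zero energy. *)
pose t := r / 2 / (A + 1).
have t0 : 0 < t by rewrite !divr_gt0 //; lra.
have c0 : 0 < t `^ (1 - p) by rewrite powR_gt0.
exists (r / 2 / t `^ (1 - p)); first by rewrite !divr_gt0.
move=> F mF hF; apply: le_trans (integral_flux_le t0 mF) _.
rewrite EA -EFinM; apply: (@le_trans _ _ (t * A + r / 2)%:E).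
  rewrite EFinD leeD2l // -[in leRHS](divfK (lt0r_neq0 c0) (r / 2)) mulrC EFinM.
  by rewrite lee_pmul2l // lte_fin.
have : t * A <= r / 2.
  rewrite /t mulrAC ler_pdivrMr; last by lra.
  by rewrite ler_wpM2l //; lra.
by rewrite lee_fin; lra.
Qed.

Lemma integrable_flux F : mfield F ->
  (Lp_energy p Omega F < +oo)%E -> L.-integrable Omega (EFin \o flux F).
Proof.
move=> mF EF; apply/integrableP; split.
  by apply/measurable_EFinP; exact: measurable_flux.
apply: le_lt_trans (integral_flux_le ltr01 mF) _.
by apply: lte_add_pinfty; apply: lte_EFin_mul => //; exact: powR_ge0.
Qed.

Lemma harmonic_gt0 k : 0 < harmonic k :> R.
Proof. by rewrite /harmonic /= invr_gt0. Qed.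

(* Test the equation with the smooth approximation [sqrt (f^2 + s^2) - s] of [|f|]. *)
Lemma integral_test_le_flux f : test_function Omega f ->
  (\int[mu]_(z in Omega) `|f z|%:E <= \int[L]_(z in Omega) `|flux (hgrad f) z|%:E)%E.
Proof.
move=> tf; have [sf _ _] := tf.
pose s : R^nat := harmonic; pose g k z := regpow (s k) 2^-1 (f z) - s k.
have s0 k : 0 < s k by exact: harmonic_gt0.
have tg k : test_function Omega (g k).
  apply: test_function_sub (tf) _.
    by apply: (@smoothDl _ _ (- s k) (regpow (s k) 2^-1 \o f)); exact: smooth_regpow.
  by move=> z fz0; rewrite /g fz0 regpow0 ?subrr // ltW.
have g0 k z : 0 <= g k z by rewrite subr_ge0 le_regpow_eps // ltW.
apply: (@fatou_le _ _ _ _ _ g) => //.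
- by move=> k; apply: measurable_test; case: (tg k).
- by apply: measurableT_comp => //; exact: measurable_test.
- apply: aeW => z _; rewrite -[X in _ --> X]subr0; apply: cvgB.
    by apply: regpow_cvg => //; exact: cvg_harmonic.
  exact: cvg_harmonic.
move=> e e0; apply: nearW => k; rewrite -integral_flux_test //.
apply: (@le_trans _ _ (\int[L]_(z in Omega) `|flux (hgrad f) z|%:E)%E); last first.
  by rewrite leeDl // lee_fin ltW.
(* The gradient of [sqrt (f^2 + s^2)] is that of [f] times a factor of absolute value at most 1. *)
have fE z : flux (hgrad (g k)) z = f z * regpow (s k) (- 2^-1) (f z) * flux (hgrad f) z.
  rewrite -(fluxZ (fun z => f z * regpow (s k) (- 2^-1) (f z))) /flux /g.
  rewrite (@hgradDl _ _ (- s k) (regpow (s k) 2^-1 \o f)); last exact: smooth_regpow.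
  by rewrite hgrad_regpow // divff ?mul1r // (_ : 2^-1 - 1 = - 2^-1 :> R) //; lra.
apply: (@le_trans _ _ (\int[L]_(z in Omega) `|flux (hgrad (g k)) z|%:E)%E).
  apply: le_trans (lee_abs _) _; apply: le_abse_integral => //.
  apply/measurable_EFinP; apply: measurable_flux => i; apply: measurable_hgrad.
  by case: (tg k).
apply: ge0_le_integral; first exact: mOmega.
- by move=> z _; rewrite lee_fin.
- apply/measurable_EFinP; apply: measurableT_comp; first exact: normr_measurable.
  by apply: measurable_flux => i; apply: measurable_hgrad; case: (tg k).
- apply/measurable_EFinP; apply: measurableT_comp; first exact: normr_measurable.
  by apply: measurable_flux => i; exact: measurable_hgrad.
move=> z _; rewrite lee_fin fE normrM ler_piMl //.
rewrite /regpow powRN -/(regpow _ _ _) normrM normfV ler_pdivrMr ?normr_gt0 ?gt_eqF ?regpow_gt0 //.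
by rewrite mul1r [leRHS]ger0_norm ?le_regpow_norm // ltW // regpow_gt0.
Qed.

Lemma integral_test_small (r : R) : 0 < r -> exists2 e : R, 0 < e &
  forall f, test_function Omega f -> (Lp_energy p Omega (hgrad f) <= e%:E)%E ->
    (\int[mu]_(z in Omega) `|f z|%:E <= r%:E)%E.
Proof.
move=> /integral_flux_small[e e0 he]; exists e => // f tf hf.
apply: le_trans (integral_test_le_flux tf) (he _ _ hf) => i.
by apply: measurable_hgrad; case: tf.
Qed.

(** * Energies, and limits of test functions in energy *)

Lemma measurable_energy F : mfield F ->
  measurable_fun Omega (fun z => (enorm (F z) `^ p)%:E).
Proof. by move=> mF; apply/measurable_EFinP; exact: measurable_enorm_powR. Qed.

Lemma energyD_le F G : mfield F -> mfield G ->
  (Lp_energy p Omega (fun z => F z + G z)%R <=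
    (2 `^ p)%:E * (Lp_energy p Omega F + Lp_energy p Omega G))%E.
Proof.
move=> mF mG; have mFG : mfield (fun z => F z + G z).
  move=> i; rewrite (_ : (fun _ => _) = fun z => F z ord0 i + G z ord0 i).
    exact: measurable_funD.
  by apply/funext => z; rewrite mxE.
have E0 K z : Omega z -> (0 <= (enorm (K z) `^ p)%:E :> \bar R)%E.
  by move=> _; rewrite lee_fin powR_ge0.
rewrite /Lp_energy -ge0_integralD //; try exact: measurable_energy; try exact: E0.
rewrite -ge0_integralZl_EFin ?powR_ge0 //.
- apply: ge0_le_integral; first exact: mOmega.
  + exact: E0.
  + exact: (measurable_energy mFG).
  + by apply: measurable_funeM; apply: emeasurable_funD; exact: measurable_energy.
  + by move=> z _; rewrite -EFinD -EFinM lee_fin enormD_powR // ltW.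
- by move=> z Oz; rewrite adde_ge0 ?E0.
- by apply: emeasurable_funD; exact: measurable_energy.
Qed.

Lemma energyZ (c : R) F : mfield F ->
  Lp_energy p Omega (fun z => c *: F z) = ((`|c| `^ p)%:E * Lp_energy p Omega F)%E.
Proof.
move=> mF; rewrite /Lp_energy -ge0_integralZl_EFin ?powR_ge0 //.
- by apply: eq_integral => z _; rewrite enormZ powRM ?enorm_ge0.
- by move=> z _; rewrite lee_fin powR_ge0.
- exact: measurable_energy.
Qed.

Lemma energyB F G : Lp_energy p Omega (fun z => F z - G z) =
  Lp_energy p Omega (fun z => G z - F z).
Proof.
by apply: eq_integral => z _; rewrite -opprB -scaleN1r enormZ normrN1 mul1r.
Qed.

Lemma mfieldB F G : mfield F -> mfield G -> mfield (fun z => F z - G z).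
Proof.
move=> mF mG i; rewrite (_ : (fun _ => _) = fun z => F z ord0 i - G z ord0 i).
  exact: measurable_funB.
by apply/funext => z; rewrite !mxE.
Qed.

Lemma mfield_hgrad f : smooth f -> mfield (hgrad f).
Proof. by move=> sf i; exact: measurable_hgrad. Qed.

(* What is kept of [D1p0], with convergence a.e. instead of in L^p: unlike [D1p0], it is
   seen at once to be stable under differences with test functions. *)
Record approximable (f_ : nat -> H -> R) (w : H -> R) (Dw : H -> V) : Prop := {
  approx_test : forall k, test_function Omega (f_ k) ;
  approx_measurable : measurable_fun Omega w ;
  approx_mfield : mfield Dw ;
  approx_energy : (Lp_energy p Omega Dw < +oo)%E ;
  approx_cvg_energy :
    (fun k => Lp_energy p Omega (fun z => hgrad (f_ k) z - Dw z)) @ \oo --> 0%E ;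
  approx_ae : {ae L, forall z, Omega z -> f_ ^~ z @ \oo --> w z} }.

Lemma approximable_flux (f_ : nat -> H -> R) w Dw : approximable f_ w Dw ->
  (fun k => \int[L]_(z in Omega) `|flux (hgrad (f_ k)) z - flux Dw z|%:E)%E @ \oo --> 0%E.
Proof.
move=> [tf mw mDw EDw cDw _]; apply/ecvg0P.
  by move=> k; apply: integral_ge0 => z _; rewrite lee_fin.
move=> r /integral_flux_small[e e0 he].
have := (ecvg0P (fun k => energy_ge0 _)).1 cDw e e0; apply: filterS => k hk.
have mk : mfield (fun z => hgrad (f_ k) z - Dw z).
  by apply: mfieldB => //; apply: mfield_hgrad; case: (tf k).
have := he _ mk hk; congr (_ <= _)%E; apply: eq_integral => z _.
by rewrite fluxB.
Qed.

Lemma approximable0 : approximable (fun _ => cst 0) (cst 0) (fun _ => 0).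
Proof.
have E0 : Lp_energy p Omega (fun=> 0 : V) = 0%E.
  by rewrite /Lp_energy enorm0 powR0 ?gt_eqF // integral0.
split.
- by move=> k; exact: test_function0.
- exact: measurable_cst.
- by move=> i; under eq_fun do rewrite mxE; exact: measurable_cst.
- by rewrite E0.
- rewrite (_ : (fun k => _) = cst 0%E); first exact: cvg_cst.
  apply/funext => k; rewrite -[RHS]E0; congr Lp_energy; apply/funext => z.
  by rewrite hgrad_cst subr0.
- by apply: aeW => z _; exact: cvg_cst.
Qed.

(** Used with [c = 4 / e] to magnify the error of an approximation, and with [c = -2], [g = 0] to
    double a capacitary potential. *)
Lemma approximable_affine (f_ : nat -> H -> R) w Dw (c : R) g : test_function Omega g ->
  (Lp_energy p Omega (fun z => hgrad g z - Dw z)%R < +oo)%E ->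
  approximable f_ w Dw ->
  approximable (fun k z => c * (g z - f_ k z)) (fun z => c * (g z - w z))
    (fun z => c *: (hgrad g z - Dw z)).
Proof.
move=> tg Eg [tf mw mDw EDw cDw aew]; have [sg _ _] := tg.
have sf k : smooth (f_ k) by case: (tf k).
have tBf k : test_function Omega (fun z => g z - f_ k z) by exact: test_functionB.
have mgw := mfieldB (mfield_hgrad sg) mDw.
split.
- by move=> k; exact: test_functionZ.
- apply: measurable_funM => //; apply: measurable_funB => //; exact: measurable_test.
- move=> i; rewrite (_ : (fun _ => _) = fun z => c * (hgrad g z - Dw z) ord0 i).
    by apply: measurable_funM => //; exact: mgw.
  by apply/funext => z; rewrite [LHS]mxE.
- by rewrite energyZ //; apply: lte_EFin_mul => //; exact: powR_ge0.
- rewrite (_ : (fun _ => _) = fun k => ((`|c| `^ p)%:E *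
    Lp_energy p Omega (fun z => hgrad (f_ k) z - Dw z)%R)%E); last first.
    apply/funext => k; rewrite [X in (_ = _ * X)%E]energyB -energyZ; last first.
      by apply: mfieldB mDw _; exact: mfield_hgrad.
    congr Lp_energy; apply/funext => z; rewrite hgradZ; last by case: (tBf k).
    by rewrite hgradB // -scalerBr opprB addrC addrA subrK.
  by rewrite -(mule0 (`|c| `^ p)%:E); apply: cvgeZl.
- apply: filterS aew => z h Oz; apply: cvgM; first exact: cvg_cst.
  by apply: cvgB; [exact: cvg_cst|exact: h].
Qed.

(* Test the equation with [phi^2 * damp m f1 f2]: where [w1^2 + w2^2 >= 4], the limits of
   the damping factor and of its derivatives are at most [12 * 2^-m]. *)
Lemma approximable_sqr_damp (f1_ f2_ : nat -> H -> R) w1 Dw1 w2 Dw2 phi (m : nat) :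
  approximable f1_ w1 Dw1 -> approximable f2_ w2 Dw2 -> test_function Omega phi ->
  (forall z, 0 <= phi z <= 1) ->
  {ae L, forall z, Omega z -> phi z != 0 -> 4 <= w1 z ^+ 2 + w2 z ^+ 2} ->
  exists2 I : \bar R,
    (fun k => \int[mu]_(z in Omega) (phi z ^+ 2 * damp m (f1_ k z) (f2_ k z))%:E)%E
      @ \oo --> I &
    (I <= (12 * 2^-1 ^+ m)%:E * (\int[L]_(z in Omega) `|flux (hgrad phi) z|%:E +
      \int[L]_(z in Omega) `|flux Dw1 z|%:E +
      \int[L]_(z in Omega) `|flux Dw2 z|%:E))%E.
Proof.
move=> A1 A2 tphi phi01 big.
have [tf1 mw1 mDw1 EDw1 cDw1 ae1] := A1; have [tf2 mw2 mDw2 EDw2 cDw2 ae2] := A2.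
have [sphi _ _] := tphi.
have sf1 k : smooth (f1_ k) by case: (tf1 k).
have sf2 k : smooth (f2_ k) by case: (tf2 k).
have mf1 k := measurable_test (sf1 k); have mf2 k := measurable_test (sf2 k).
have mphi := measurable_test sphi.
have phi2 z : 0 <= phi z ^+ 2 <= 1.
  by have /andP[h0 h1] := phi01 z; rewrite sqr_ge0 exprn_ile1.
pose h k z := phi z ^+ 2 * damp m (f1_ k z) (f2_ k z).
have sd k : smooth (fun z => damp m (f1_ k z) (f2_ k z)) by exact: smooth_damp.
have sp2 := smoothX 2 sphi.
have th k : test_function Omega (h k).
  apply: test_function_sub (tphi) _; first exact: smoothM.
  by move=> z pz; rewrite /h pz expr0n mul0r.
(* Coefficients of the three fluxes in the product rule for [h k]; [c0], [c1], [c2] are their limits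
   a.e. *)
pose b0 k z := 2 * phi z * damp m (f1_ k z) (f2_ k z).
pose b1 k z := phi z ^+ 2 * ddamp m (f1_ k z) (f2_ k z).
pose b2 k z := phi z ^+ 2 * ddamp m (f2_ k z) (f1_ k z).
pose c0 z := 2 * phi z * damp m (w1 z) (w2 z).
pose c1 z := phi z ^+ 2 * ddamp m (w1 z) (w2 z).
pose c2 z := phi z ^+ 2 * ddamp m (w2 z) (w1 z).
have fh k z : flux (hgrad (h k)) z = b0 k z * flux (hgrad phi) z +
    (b1 k z * flux (hgrad (f1_ k)) z + b2 k z * flux (hgrad (f2_ k)) z).
  rewrite /flux (hgradM z sp2 (sd k)) (hgrad_damp m z (sf1 k) (sf2 k)) (hgradX 1 z sphi).
  move: (hgrad phi z) (hgrad (f1_ k) z) (hgrad (f2_ k) z) => G0 G1 G2.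
  by rewrite !dotvDr !dotvZr dotvDr !dotvZr /b0 /b1 /b2 expr1; ring.
have bd (x y c M : R) : 0 <= c <= 1 -> `|ddamp m x y| <= M -> `|c * ddamp m x y| <= M.
  move=> /andP[k0 k1] hM; rewrite normrM ger0_norm //.
  by apply: le_trans hM; rewrite ler_piMl.
have dd (x y : R) : `|ddamp m x y| <= 12 * m.+1%:R.
  apply: le_trans (normr_ddamp m x y) _; rewrite ler_wpM2l //.
  by rewrite ler_piMr ?damp_le1.
have b0M (x y : R) z : `|2 * phi z * damp m x y| <= 2.
  have /andP[h0 h1] := phi01 z; have k0 := damp_ge0 m x y; have k1 := damp_le1 m x y.
  rewrite ger0_norm; last by rewrite !mulr_ge0.
  by rewrite -[leRHS]mulr1 -mulrA ler_wpM2l // mulr_ile1.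
have iphi := integrable_flux_test tphi.
have i1 k := integrable_flux_test (tf1 k); have i2 k := integrable_flux_test (tf2 k).
have j1 := integrable_flux mDw1 EDw1; have j2 := integrable_flux mDw2 EDw2.
have mb0 k : measurable_fun Omega (b0 k).
  by apply: measurable_funM; [exact: measurable_funM|exact: measurable_damp].
have mb1 k : measurable_fun Omega (b1 k).
  by apply: measurable_funM; [exact: measurable_funX|exact: measurable_ddamp].
have mb2 k : measurable_fun Omega (b2 k).
  by apply: measurable_funM; [exact: measurable_funX|exact: measurable_ddamp].
have mc0 : measurable_fun Omega c0.
  by apply: measurable_funM; [exact: measurable_funM|exact: measurable_damp].
have mc1 : measurable_fun Omega c1.
  by apply: measurable_funM; [exact: measurable_funX|exact: measurable_ddamp].
have mc2 : measurable_fun Omega c2.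
  by apply: measurable_funM; [exact: measurable_funX|exact: measurable_ddamp].
have l0 : (fun k => \int[L]_(z in Omega) (b0 k z * flux (hgrad phi) z)%:E)%E @ \oo -->
    (\int[L]_(z in Omega) (c0 z * flux (hgrad phi) z)%:E)%E.
  have phi0 : (fun k : nat => \int[L]_(z in Omega) `|flux (hgrad phi) z - flux (hgrad phi) z|%:E)%E @ \oo --> 0%E.
    rewrite (_ : (fun _ => _) = cst 0%E); first exact: cvg_cst.
    apply/funext => k; under eq_integral do rewrite subrr normr0.
    exact: integral0.
  apply: (cvg_integral_bounded_mul mOmega (fun _ => iphi) iphi phi0 mb0 mc0 (M := 2)).
  - by move=> k z _; exact: b0M.
  - by move=> z _; exact: b0M.
  - apply: filterS2 ae1 ae2 => z h1 h2 Oz.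
    by apply: cvgM; [exact: cvg_cst|apply: damp_cvg; [exact: h1|exact: h2]].
have l1 : (fun k => \int[L]_(z in Omega) (b1 k z * flux (hgrad (f1_ k)) z)%:E)%E @ \oo -->
    (\int[L]_(z in Omega) (c1 z * flux Dw1 z)%:E)%E.
  apply: (cvg_integral_bounded_mul mOmega i1 j1 (approximable_flux A1) mb1 mc1 (M := 12 * m.+1%:R)).
  - by move=> k z _; exact: bd.
  - by move=> z _; exact: bd.
  - apply: filterS2 ae1 ae2 => z h1 h2 Oz.
    by apply: cvgM; [exact: cvg_cst|apply: ddamp_cvg; [exact: h1|exact: h2]].
have l2 : (fun k => \int[L]_(z in Omega) (b2 k z * flux (hgrad (f2_ k)) z)%:E)%E @ \oo -->
    (\int[L]_(z in Omega) (c2 z * flux Dw2 z)%:E)%E.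
  apply: (cvg_integral_bounded_mul mOmega i2 j2 (approximable_flux A2) mb2 mc2 (M := 12 * m.+1%:R)).
  - by move=> k z _; exact: bd.
  - by move=> z _; exact: bd.
  - apply: filterS2 ae1 ae2 => z h1 h2 Oz.
    by apply: cvgM; [exact: cvg_cst|apply: ddamp_cvg; [exact: h2|exact: h1]].
(* Smallness is available for the limit coefficients only, since the lower bound on the support of
   [phi] concerns [w1] and [w2], not their approximations. *)
have small (b : H -> R) F : mfield F -> L.-integrable Omega (EFin \o flux F) -> measurable_fun Omega b ->
    {ae L, forall z, Omega z -> `|b z| <= 12 * 2^-1 ^+ m} ->
    (`|\int[L]_(z in Omega) (b z * flux F z)%:E| <=
      (12 * 2^-1 ^+ m)%:E * \int[L]_(z in Omega) `|flux F z|%:E)%E.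
  move=> mF iF mb hb.
  have mbF : measurable_fun Omega (fun z => (b z * flux F z)%:E).
    by apply/measurable_EFinP; apply: measurable_funM => //; exact: measurable_flux.
  apply: le_trans (le_abse_integral L mOmega mbF) _.
  have r0 : 0 <= 12 * 2^-1 ^+ m :> R by rewrite mulr_ge0 ?exprn_ge0.
  have mabs : measurable_fun Omega (fun z => `|flux F z|%:E).
    by apply/measurable_EFinP; apply: measurableT_comp; [exact: normr_measurable|exact: measurable_flux].
  rewrite -ge0_integralZl_EFin //.
  apply: ae_ge0_le_integral => //.
  - by apply: measurableT_comp mbF; exact: abse_measurable.
  - exact: measurable_funeM.
  - by apply: filterS hb => z hz Oz; rewrite -EFinM lee_fin normrM ler_wpM2r // hz.
have rho0 : 0 <= 12 * 2^-1 ^+ m :> R by rewrite mulr_ge0 ?exprn_ge0.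
have bigd (x y : R) z : phi z != 0 -> 4 <= x ^+ 2 + y ^+ 2 -> `|phi z ^+ 2 * ddamp m x y| <= 12 * 2^-1 ^+ m.
  move=> _ hxy; apply: bd => //; apply: le_trans (normr_ddamp m x y) _.
  by rewrite ler_wpM2l // damp_le.
have s0 := small c0 _ (mfield_hgrad sphi) iphi mc0.
have s1 := small c1 _ mDw1 j1 mc1; have s2 := small c2 _ mDw2 j2 mc2.
have z0 (x y : R) z : phi z = 0 -> `|phi z ^+ 2 * ddamp m x y| <= 12 * 2^-1 ^+ m.
  by move=> ->; rewrite expr0n mul0r normr0.
have {}s1 : (`|\int[L]_(z in Omega) (c1 z * flux Dw1 z)%:E| <=
      (12 * 2^-1 ^+ m)%:E * \int[L]_(z in Omega) `|flux Dw1 z|%:E)%E.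
  apply: s1; apply: filterS big => z hz Oz.
  have [/z0 ->//|pz] := eqVneq (phi z) 0; apply: bigd => //; exact: hz.
have {}s2 : (`|\int[L]_(z in Omega) (c2 z * flux Dw2 z)%:E| <=
      (12 * 2^-1 ^+ m)%:E * \int[L]_(z in Omega) `|flux Dw2 z|%:E)%E.
  apply: s2; apply: filterS big => z hz Oz.
  have [/z0 ->//|pz] := eqVneq (phi z) 0; apply: bigd => //; rewrite addrC; exact: hz.
have {}s0 : (`|\int[L]_(z in Omega) (c0 z * flux (hgrad phi) z)%:E| <=
      (12 * 2^-1 ^+ m)%:E * \int[L]_(z in Omega) `|flux (hgrad phi) z|%:E)%E.
  apply: s0; apply: filterS big => z hz Oz; rewrite /c0.
  have [->|pz] := eqVneq (phi z) 0; first by rewrite mulr0 mul0r normr0.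
  have /andP[h0 h1] := phi01 z.
  rewrite ger0_norm; last by rewrite !mulr_ge0 // damp_ge0.
  apply: (@le_trans _ _ (12 * (m.+1%:R * damp m (w1 z) (w2 z)))); last first.
    by rewrite ler_wpM2l // damp_le // hz.
  have d0 := damp_ge0 m (w1 z) (w2 z).
  apply: (@le_trans _ _ (2 * damp m (w1 z) (w2 z))).
    by rewrite -mulrA ler_wpM2l // ler_piMl.
  have m1 : 1 <= m.+1%:R :> R by rewrite ler1n.
  by apply: ler_pM => //; [lra|exact: ler_peMl].
have k0 : L.-integrable Omega (fun z => (c0 z * flux (hgrad phi) z)%:E).
  by apply: (bounded_mul_integrable mOmega mc0 _ iphi (M := 2)) => z _; exact: b0M.
have k1 : L.-integrable Omega (fun z => (c1 z * flux Dw1 z)%:E).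
  by apply: (bounded_mul_integrable mOmega mc1 _ j1 (M := 12 * m.+1%:R)) => z _; exact: bd.
have k2 : L.-integrable Omega (fun z => (c2 z * flux Dw2 z)%:E).
  by apply: (bounded_mul_integrable mOmega mc2 _ j2 (M := 12 * m.+1%:R)) => z _; exact: bd.
have q0 := integrable_fin_num mOmega k0.
have q1 := integrable_fin_num mOmega k1.
have q2 := integrable_fin_num mOmega k2.
exists (\int[L]_(z in Omega) (c0 z * flux (hgrad phi) z)%:E +
   (\int[L]_(z in Omega) (c1 z * flux Dw1 z)%:E + \int[L]_(z in Omega) (c2 z * flux Dw2 z)%:E))%E.
  rewrite (_ : (fun _ => _) = fun k =>
     (\int[L]_(z in Omega) (b0 k z * flux (hgrad phi) z)%:E +
      (\int[L]_(z in Omega) (b1 k z * flux (hgrad (f1_ k)) z)%:E +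
       \int[L]_(z in Omega) (b2 k z * flux (hgrad (f2_ k)) z)%:E))%E).
    apply: cvgeD l0 _; first exact: fin_num_adde_defr.
    by apply: cvgeD l1 l2; exact: fin_num_adde_defr.
  apply/funext => k; rewrite -(integral_flux_test (th k)).
  have u0 : L.-integrable Omega (fun z => (b0 k z * flux (hgrad phi) z)%:E).
    by apply: (bounded_mul_integrable mOmega (mb0 k) _ iphi (M := 2)) => z _; exact: b0M.
  have u1 : L.-integrable Omega (fun z => (b1 k z * flux (hgrad (f1_ k)) z)%:E).
    by apply: (bounded_mul_integrable mOmega (mb1 k) _ (i1 k) (M := 12 * m.+1%:R)) => z _; exact: bd.
  have u2 : L.-integrable Omega (fun z => (b2 k z * flux (hgrad (f2_ k)) z)%:E).
    by apply: (bounded_mul_integrable mOmega (mb2 k) _ (i2 k) (M := 12 * m.+1%:R)) => z _; exact: bd.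
  have e12 := integralD mOmega u1 u2.
  have e := integralD mOmega u0 (integrableD mOmega u1 u2).
  apply: (etrans _ (etrans e (congr1 (adde _) e12))).
  by apply: eq_integral => z _; rewrite fh !EFinD.
by apply: lee_sum3 => //; apply: integral_ge0 => z _; rewrite lee_fin.
Qed.

(* The capacitary bound on [mu]; the two functions [w1], [w2] will be the difference
   between a test function and its limit, and a capacitary potential. *)
Lemma measure_small (r : R) : 0 < r -> exists2 d : R, 0 < d &
  forall (O : set H) (f1_ f2_ : nat -> H -> R) w1 Dw1 w2 Dw2, open O -> O `<=` Omega ->
    approximable f1_ w1 Dw1 -> approximable f2_ w2 Dw2 ->
    (Lp_energy p Omega Dw1 <= d%:E)%E -> (Lp_energy p Omega Dw2 <= d%:E)%E ->
    {ae L, forall z, O z -> 4 <= w1 z ^+ 2 + w2 z ^+ 2} -> (mu O <= r%:E)%E.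
Proof.
move=> r0; have r4 : 0 < r / 4 by rewrite divr_gt0.
have [e e0 he] := integral_test_small r4.
have pp : 0 < 2 `^ p :> R by rewrite powR_gt0.
(* By [energyD_le], two energies of size [e / 2 / 2^p] combine to at most [e]. *)
have d0 : 0 < e / 2 / 2 `^ p by rewrite !divr_gt0.
exists (e / 2 / 2 `^ p) => // U f1_ f2_ w1 Dw1 w2 Dw2 oU UO A1 A2 E1 E2 big.
have mU := open_measurable_heis oU.
have small (f_ : nat -> H -> R) w Dw : approximable f_ w Dw ->
    (Lp_energy p Omega Dw <= (e / 2 / 2 `^ p)%:E)%E ->
    \forall k \near \oo, (\int[mu]_(z in Omega) `|f_ k z|%:E <= (r / 4)%:E)%E.
  move=> [tf mw mDw EDw cDw _] hE.
  have := (ecvg0P (fun k => energy_ge0 _)).1 cDw _ d0; apply: filterS => k hk.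
  have sfk : smooth (f_ k) by case: (tf k).
  apply: he; first exact: tf.
  rewrite (_ : hgrad (f_ k) = fun z => (hgrad (f_ k) z - Dw z) + Dw z); last first.
    by apply/funext => z; rewrite subrK.
  apply: le_trans (energyD_le (mfieldB (mfield_hgrad sfk) mDw) mDw) _.
  rewrite muleC -lee_pdivlMr // -EFinM; apply: le_trans (leeD hk hE) _.
  by rewrite -EFinD lee_fin -mulrDl -splitr.
have [phi [tphi phi01 phi1]] := open_cutoff oU.
have tphiO k : test_function Omega (phi k) by exact: test_functionS UO (tphi k).
have step j : (\int[mu]_(z in Omega) (phi j z ^+ 2)%:E <= r%:E)%E.
  have bigj : {ae L, forall z, Omega z -> phi j z != 0 -> 4 <= w1 z ^+ 2 + w2 z ^+ 2}.
    apply: filterS big => z hz _ pz; apply: hz.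
    by have [_ _] := tphi j; apply; exact: subset_closure.
  (* The order of choices matters: the flux of the cutoff [phi j] is finite but may grow with [j],
     so [m] is chosen after [j], and [k] after both. The energy bound depends on none of them. *)
  pose C := (\int[L]_(z in Omega) `|flux (hgrad (phi j)) z|%:E +
      \int[L]_(z in Omega) `|flux Dw1 z|%:E + \int[L]_(z in Omega) `|flux Dw2 z|%:E)%E.
  have finF F : L.-integrable Omega (EFin \o flux F) ->
      (\int[L]_(z in Omega) `|flux F z|%:E < +oo)%E by move=> /integrableP[].
  have C0 : (0 <= C)%E.
    have a0 F : (0 <= \int[L]_(z in Omega) `|flux F z|%:E)%E.
      by apply: integral_ge0 => z _; rewrite lee_fin.
    exact: adde_ge0 (adde_ge0 (a0 _) (a0 _)) (a0 _).
  have CE : C = (fine C)%:E.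
    rewrite fineK // ge0_fin_numE // /C; apply: lte_add_pinfty.
      apply: lte_add_pinfty; apply: finF; first exact: integrable_flux_test.
      by case: A1 => _ _ mD1 F1 _ _; exact: integrable_flux.
    by apply: finF; case: A2 => _ _ mD2 F2 _ _; exact: integrable_flux.
  have c0 : 0 <= fine C by exact: fine_ge0.
  have [m hm] : exists m : nat, 12 * 2^-1 ^+ m * fine C < r / 4 / 2.
    have : (fun m => 12 * 2^-1 ^+ m * fine C) @ \oo --> (12 * 0 * fine C : R).
      apply: cvgM; last exact: cvg_cst.
      apply: cvgM; first exact: cvg_cst.
      have := @cvg_geometric R 1 2^-1; rewrite /geometric /=.
      under eq_fun do rewrite mul1r.
      by apply; rewrite ger0_norm // invf_lt1 // ltr1n.
    rewrite mulr0 mul0r => /cvgr_lt h.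
    have r8 : 0 < r / 4 / 2 by rewrite divr_gt0.
    by have [m _ /(_ m (leqnn m))] := h _ r8; exists m.
  have [I hI leI] := approximable_sqr_damp m A1 A2 (tphiO j) (phi01 j) bigj.
  have {}leI : (I < (r / 4 / 2)%:E)%E.
    by apply: le_lt_trans leI _; rewrite -/C CE -EFinM lte_fin.
  have near1 := hI _ (open_ereal_lt' leI).
  have near2 := small _ _ _ A1 E1; have near3 := small _ _ _ A2 E2.
  have [k [[k1 k2] k3]] : exists k, ((\int[mu]_(z in Omega)
       (phi j z ^+ 2 * damp m (f1_ k z) (f2_ k z))%:E < (r / 4 / 2)%:E)%E /\
     (\int[mu]_(z in Omega) `|f1_ k z|%:E <= (r / 4)%:E)%E) /\
     (\int[mu]_(z in Omega) `|f2_ k z|%:E <= (r / 4)%:E)%E.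
    near \oo => k; exists k; split; [split|]; near: k.
    - exact: near1.
    - exact: near2.
    - exact: near3.
  have [tf1 _ _ _ _ _] := A1; have [tf2 _ _ _ _ _] := A2.
  have sf1 : smooth (f1_ k) by case: (tf1 k).
  have sf2 : smooth (f2_ k) by case: (tf2 k).
  have sph : smooth (phi j) by case: (tphi j).
  have m1 : measurable_fun Omega (fun z => `|f1_ k z|%:E).
    apply/measurable_EFinP; apply: measurableT_comp; first exact: normr_measurable.
    exact: measurable_test.
  have m2 : measurable_fun Omega (fun z => `|f2_ k z|%:E).
    apply/measurable_EFinP; apply: measurableT_comp; first exact: normr_measurable.
    exact: measurable_test.
  have md : measurable_fun Omega (fun z => phi j z ^+ 2 * damp m (f1_ k z) (f2_ k z)).
    apply: measurable_funM; first by apply: measurable_funX; exact: measurable_test.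
    by apply: measurable_damp; exact: measurable_test.
  have md2 : measurable_fun Omega (fun z => (2 * (phi j z ^+ 2 * damp m (f1_ k z) (f2_ k z)))%:E).
    by apply/measurable_EFinP; apply: measurable_funM => //; exact: measurable_cst.
  have d_ge0 z : 0 <= phi j z ^+ 2 * damp m (f1_ k z) (f2_ k z).
    by rewrite mulr_ge0 ?sqr_ge0 // damp_ge0.
  have le1 : (\int[mu]_(z in Omega) (phi j z ^+ 2)%:E <=
      \int[mu]_(z in Omega) ((2 * (phi j z ^+ 2 * damp m (f1_ k z) (f2_ k z)))%:E +
        (`|f1_ k z|%:E + `|f2_ k z|%:E)))%E.
    apply: ge0_le_integral.
    - exact: mOmega.
    - by move=> z _; rewrite lee_fin sqr_ge0.
    - by apply/measurable_EFinP; apply: measurable_funX; exact: measurable_test.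
    - by apply: emeasurable_funD => //; exact: emeasurable_funD.
    - by move=> z _; rewrite -!EFinD lee_fin; exact: sqr_le_damp.
  apply: le_trans le1 _.
  rewrite ge0_integralD; [|exact: mOmega| | exact: md2 | | exact: emeasurable_funD]; last 2 first.
  - by move=> z _; rewrite lee_fin mulr_ge0.
  - by move=> z _; rewrite adde_ge0 // lee_fin.
  rewrite ge0_integralD; [|exact: mOmega| | exact: m1 | | exact: m2]; last 2 first.
  - by move=> z _; rewrite lee_fin.
  - by move=> z _; rewrite lee_fin.
  under eq_integral do rewrite EFinM.
  rewrite ge0_integralZl_EFin; [|exact: mOmega| | | by []]; last 2 first.
  - by move=> z _; rewrite lee_fin.
  - exact/measurable_EFinP.
  (* The budget: [2 * r/8 + r/4 + r/4 <= r]. *)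
  apply: (@le_trans _ _ (2%:E * (r / 4 / 2)%:E + ((r / 4)%:E + (r / 4)%:E))%E).
    apply: leeD; last exact: leeD.
    by rewrite lee_pmul2l // ltW.
  by rewrite -EFinM -!EFinD lee_fin; lra.
have -> : mu U = (\int[mu]_(z in U) (1%:E : \bar R))%E.
  by rewrite integral_cst // mul1e.
apply: (@fatou_le _ _ _ _ _ (fun j z => phi j z ^+ 2) (cst 1)) => //.
- move=> j; apply: measurable_funX; apply: measurable_funTS.
  by apply: continuous_measurable_heis; apply: smooth_continuous; case: (tphi j).
- by move=> j z _; exact: sqr_ge0.
- by apply: aeW => z Uz; rewrite -(expr1n R 2); apply: cvg_exprn; exact: phi1.
- move=> e' e'0; apply: nearW => j.
  apply: (@le_trans _ _ r%:E); last by rewrite leeDl // lee_fin ltW.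
  apply: le_trans (step j); apply: ge0_subset_integral => //.
    by apply/measurable_EFinP; apply: measurable_funX; apply: measurable_test; case: (tphi j).
  by move=> z _; rewrite lee_fin sqr_ge0.
Unshelve. all: by end_near.
Qed.

(** * From statements Lebesgue-a.e. to statements [mu]-a.e *)

Lemma cvg_subseq (T : topologicalType) (u : nat -> T) (s : nat -> nat) (l : T) :
  (forall k, (k <= s k)%N) -> u @ \oo --> l -> (fun k => u (s k)) @ \oo --> l.
Proof.
move=> hs ul A /ul[N _ hN]; exists N => // k Nk.
by apply: hN; exact: leq_trans (hs k).
Qed.

Lemma approximable_subseq (f_ : nat -> H -> R) w Dw (s : nat -> nat) :
  (forall k, (k <= s k)%N) -> approximable f_ w Dw ->
  approximable (fun k => f_ (s k)) w Dw.
Proof.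
move=> hs [tf mw mDw EDw cDw aew]; split.
- by move=> k; exact: tf.
- exact: mw.
- exact: mDw.
- exact: EDw.
- exact: (cvg_subseq hs cDw).
- by apply: filterS aew => z h Oz; exact: (cvg_subseq hs (h Oz)).
Qed.

Lemma D1p0_approximable (v : H -> R) Dv : D1p0 p Omega v Dv ->
  exists f_ : nat -> H -> R, approximable f_ v Dv.
Proof.
move=> [[mv mDv _ EDv _] [f [tf cE cL]]].
have mf k : measurable_fun Omega (f k) by apply: measurable_test; case: (tf k).
have [s [hs aes]] := Lp_cvg_ae mOmega p0 mf mv cL.
exists (fun k => f (s k)); split.
- by move=> k; exact: tf.
- exact: mv.
- exact: mDv.
- exact: EDv.
- exact: (cvg_subseq hs cE).
- exact: aes.
Qed.

(** Continuity off [U] makes the preimage of [A] open only relative to the complement of [U]; adding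
    [U] restores openness, at the price of a set of small capacity. *)
Lemma open_quasi (U : set H) (w : H -> R) (A : set R) : open U -> open A ->
  {within Omega `\` U, continuous w} ->
  open (U `|` [set z | Omega z /\ A (w z)] `\` U).
Proof.
move=> oU oA /subspace_continuousP cw; rewrite openE => z.
have [Uz|Uz] := pselect (U z).
  move=> _; have := open_nbhs_nbhs (conj oU Uz).
  by apply: filterS => y Uy; left.
move=> [//|[[Oz Az] _]].
have h1 : \forall y \near z, (Omega `\` U) y -> A (w y).
  exact: (cw z (conj Oz Uz) A (open_nbhs_nbhs (conj oA Az))).
have h2 := open_nbhs_nbhs (conj oOmega Oz).
apply: filterS2 h1 h2 => y h1 Oy.
have [Uy|Uy] := pselect (U y); first by left.
by right; split => //; split => //; apply: h1.
Qed.

(** Here information passes from Lebesgue measure to [mu]: the lower bound on [w] is assumed a.e.,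
    but [O] contains every point where [A (v z)] holds. [measure_small] is applied to [w] and to
    twice a capacitary potential of the exceptional set, so that on each piece of [O] one of the two
    squares reaches 4. *)
Lemma quasicontinuous_small (r : R) : 0 < r -> exists2 d : R, 0 < d &
  forall (v : H -> R) (A : set R) (f_ : nat -> H -> R) w Dw,
    quasicontinuous p Omega v -> open A -> approximable f_ w Dw ->
    (Lp_energy p Omega Dw <= d%:E)%E ->
    {ae L, forall z, Omega z -> A (v z) -> 4 <= w z ^+ 2} ->
    exists O : set H, [/\ measurable O, (mu O <= r%:E)%E &
      forall z, Omega z -> A (v z) -> O z].
Proof.
move=> /measure_small[d d0 hd]; exists d => // v A f_ w Dw qv oA Aw Ed aeA.
have pp : 0 < 2 `^ p :> R by rewrite powR_gt0.
(* The capacity allowed is [d / 2^p], because doubling the potential multiplies its energy by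
   [2^p]. *)
have [U [oU UO capU cv]] := qv _ (divr_gt0 d0 pp).
have [_ [y [Dy [W [Dyp0 [oW UW WO] aeW ->]]]] Ey] := ereal_inf_lt capU.
have [g_ Ag] := D1p0_approximable Dyp0.
have [tg my mDy EDy cDy aey] := Ag.
have E1 : (Lp_energy p Omega (fun z => hgrad (cst 0 : H -> R) z - Dy z)%R = Lp_energy p Omega Dy)%E.
  rewrite energyB; congr Lp_energy; apply/funext => z.
  by rewrite hgrad_cst subr0.
have A2 : approximable (fun k z => -2 * (cst 0 z - g_ k z)) (fun z => -2 * (cst 0 z - y z))
    (fun z => -2 *: (hgrad (cst 0 : H -> R) z - Dy z)).
  apply: approximable_affine Ag; first exact: test_function0.
  by rewrite E1.
exists (U `|` [set z | Omega z /\ A (v z)] `\` U).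
have oO := open_quasi oU oA cv.
split; first exact: open_measurable_heis.
- apply: (hd _ _ _ _ _ _ _ oO _ Aw A2 Ed).
  + by move=> z [/UO//|[[]]].
  + rewrite energyZ ?E1; last first.
      by apply: mfieldB mDy; apply: mfield_hgrad; exact: smooth_cst.
    have -> : `|-2| = 2 :> R by rewrite normrN normr_nat.
    rewrite muleC -lee_pdivlMr; last exact: pp.
    by rewrite -EFinM; exact: (ltW Ey).
  + apply: filterS2 aeA aeW => z h1 h2 [Uz|[[Oz Az] _]].
      have := h2 (UW _ Uz); rewrite sub0r mulrNN exprMn => y1.
      have := sqr_ge0 (w z); nra.
    by apply: le_trans (h1 Oz Az) _; rewrite lerDl sqr_ge0.
- move=> z Oz Az; have [Uz|Uz] := pselect (U z); first (left; exact: Uz).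
  right; split; last exact: Uz.
  by split; [exact: Oz|exact: Az].
Qed.

(** The choice [w = 0] works: [v] is negative on a Lebesgue-null set only, and this is where the
    lower bound on [w] is asked for. *)
Lemma quasicontinuous_ae_ge0 (v : H -> R) Dv : D1p0 p Omega v Dv ->
  quasicontinuous p Omega v -> {ae L, forall z, Omega z -> 0 <= v z} ->
  {ae mu, forall z, Omega z -> 0 <= v z}.
Proof.
move=> [[mv _ _ _ _] _] qv aev.
pose N := Omega `&` v @^-1` `]-oo, 0[.
have mN : measurable N by apply: mv.
exists N; split => //; last first.
  move=> z /= /not_implyP[Oz] /negP; rewrite -ltNge => vz.
  by split => //=; rewrite in_itv.
apply/eqP; rewrite eq_le measure_ge0 andbT.
apply/lee_addgt0Pr => r r0; rewrite add0e.
have [d d0 hd] := quasicontinuous_small r0.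
have E0 : (Lp_energy p Omega (fun=> 0%R : V) <= d%:E)%E.
  rewrite (_ : Lp_energy _ _ _ = 0%E) ?lee_fin ?ltW //.
  by rewrite /Lp_energy enorm0 powR0 ?integral0 // gt_eqF.
have aev0 : {ae L, forall z, Omega z -> [set x | x < 0] (v z) -> 4 <= (cst 0 z : R) ^+ 2}.
  by apply: filterS aev => z h Oz /= vz; have := h Oz; rewrite leNgt vz.
have [U [mU leU NU]] := hd v [set x | x < 0] _ _ _ qv (@open_lt R 0) approximable0 E0 aev0.
apply: le_trans leU; apply: le_measure; rewrite ?inE //.
by move=> z [Oz /=]; rewrite in_itv /=; exact: NU.
Qed.

Lemma quasicontinuousB (g v : H -> R) : continuous g -> quasicontinuous p Omega v ->
  quasicontinuous p Omega (fun z => g z - v z).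
Proof.
move=> cg qv e e0; have [U [oU UO capU cv]] := qv e e0; exists U.
split; [exact: oU|exact: UO|exact: capU|].
move/subspace_continuousP in cv; apply/subspace_continuousP => z Oz.
apply: cvgB; last exact: cv.
by apply: cvg_within_filter; exact: cg.
Qed.

Lemma quasicontinuous_cvg (v : H -> R) Dv : D1p0 p Omega v Dv ->
  quasicontinuous p Omega v ->
  exists2 f_ : nat -> H -> R, approximable f_ v Dv &
    {ae mu, forall z, Omega z -> f_ ^~ z @ \oo --> v z}.
Proof.
move=> Dv0 qv; have [f_ Af] := D1p0_approximable Dv0.
have [tf mv mDv EDv cDv aev] := Af.
have [s [hs aes]] : exists s : nat -> nat, (forall k, (k <= s k)%N) /\
    {ae mu, forall z, Omega z -> (fun k => f_ (s k) z) @ \oo --> v z}.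
  apply: cvg_measure_ae => e r e0 /quasicontinuous_small[d d0 hd].
  have cp : 0 < `|4 / e| `^ p.
    by rewrite powR_gt0 // normr_gt0 gt_eqF // divr_gt0.
  have := (ecvg0P (fun k => energy_ge0 _)).1 cDv _ (divr_gt0 d0 cp).
  apply: filterS => k hk; have sfk : smooth (f_ k) by case: (tf k).
  have Elt : (Lp_energy p Omega (fun z => hgrad (f_ k) z - Dv z)%R < +oo)%E.
    by apply: le_lt_trans hk _; rewrite ltry.
  have Aw := approximable_affine (4 / e) (tf k) Elt Af.
  have qw := quasicontinuousB (smooth_continuous sfk) qv.
  (* An open condition that follows from [e <= |x|]; where it holds, the scaling factor [4 / e]
     brings the square to at least 4. *)
  have oA : open [set x : R | e / 2 < `|x|].
    apply: (@open_comp _ _ (@Num.norm R R) [set x | e / 2 < x]).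
      by move=> x _; exact: norm_continuous.
    exact: open_gt.
  have [] := hd _ _ _ _ _ qw oA Aw.
  - rewrite energyZ; last by apply: mfieldB mDv; exact: mfield_hgrad.
    rewrite muleC -lee_pdivlMr; last exact: cp.
    by rewrite -EFinM; exact: hk.
  - apply: aeW => z _ /= h; rewrite exprMn -(real_normK (num_real (f_ k z - v z))).
    rewrite expr_div_n mulrAC ler_pdivlMr ?exprn_gt0 //.
    have := e0; nra.
  - move=> U [mU leU hU]; exists U; split; [exact: mU|exact: leU|].
    move=> z Oz h; apply: hU => //=; apply: lt_le_trans h.
    by rewrite ltr_pdivrMr // ltr_pMr // ltr1n.
exists (fun k => f_ (s k)); [exact: (approximable_subseq hs Af)|exact: aes].
Qed.

(** The approximations are Cauchy in [L^1(mu)], because [integral_test_small] applies to their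
    differences; Fatou's lemma in the second index brings in the limit. *)
Lemma cvg_approximable_mu (f_ : nat -> H -> R) (v : H -> R) Dv : approximable f_ v Dv ->
  {ae mu, forall z, Omega z -> f_ ^~ z @ \oo --> v z} ->
  (fun k => \int[mu]_(z in Omega) `|f_ k z - v z|%:E)%E @ \oo --> 0%E.
Proof.
move=> Af aef; have [tf mv mDv EDv cDv _] := Af.
apply/ecvg0P; first by move=> k; apply: integral_ge0 => z _; rewrite lee_fin.
move=> r /integral_test_small[e e0 he].
have pp : 0 < 2 `^ p :> R by rewrite powR_gt0.
have d0 : 0 < e / 2 / 2 `^ p by rewrite !divr_gt0.
have mf k : measurable_fun Omega (f_ k) by apply: measurable_test; case: (tf k).
have [N _ hN] := (ecvg0P (fun k => energy_ge0 _)).1 cDv _ d0.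
exists N => // k Nk; apply: (@fatou_le _ _ _ mu Omega (fun l z => `|f_ k z - f_ l z|)).
- exact: mOmega.
- move=> l; apply: measurableT_comp; first exact: normr_measurable.
  exact: measurable_funB.
- apply: measurableT_comp; first exact: normr_measurable.
  exact: measurable_funB.
- by [].
- by [].
- apply: filterS aef => z h Oz; apply: cvg_norm; apply: cvgB; first exact: cvg_cst.
  exact: h.
move=> e' e'0; exists N => // l Nl; apply: (@le_trans _ _ r%:E); last first.
  by rewrite leeDl // lee_fin ltW.
have sk : smooth (f_ k) by case: (tf k).
have sl : smooth (f_ l) by case: (tf l).
apply: (he (fun z => f_ k z - f_ l z)); first exact: test_functionB.
rewrite (_ : hgrad _ = fun z => (hgrad (f_ k) z - Dv z) + (Dv z - hgrad (f_ l) z)); last first.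
  by apply/funext => z; rewrite hgradB // addrA subrK.
have mk := mfieldB (mfield_hgrad sk) mDv; have ml := mfieldB mDv (mfield_hgrad sl).
apply: le_trans (energyD_le mk ml) _.
rewrite muleC -lee_pdivlMr; last exact: pp.
rewrite -EFinM [X in (_ + X)%E]energyB; apply: le_trans (leeD (hN _ Nk) (hN _ Nl)) _.
by rewrite -EFinD lee_fin -mulrDl -splitr.
Qed.

(** Both sides of the equation tested with [f_ k] converge in [L^1], so it may be tested with [v]
    itself. *)
Lemma integral_approximable (f_ : nat -> H -> R) (v : H -> R) Dv : approximable f_ v Dv ->
  {ae mu, forall z, Omega z -> f_ ^~ z @ \oo --> v z} ->
  mu.-integrable Omega (EFin \o v) /\
  (\int[mu]_(z in Omega) (v z)%:E = \int[L]_(z in Omega) (flux Dv z)%:E)%E.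
Proof.
move=> Af aef; have cmu := cvg_approximable_mu Af aef.
have [tf mv mDv EDv cDv _] := Af.
have mf k : measurable_fun Omega (f_ k) by apply: measurable_test; case: (tf k).
have ifk k := integrable_test (tf k).
have iv : mu.-integrable Omega (EFin \o v).
  have a0 k : (0 <= \int[mu]_(z in Omega) `|f_ k z - v z|%:E)%E.
    by apply: integral_ge0 => z _; rewrite lee_fin.
  have [N _ /(_ N (leqnn N)) hN] := (ecvg0P a0).1 cmu 1 ltr01.
  have ifv : mu.-integrable Omega (EFin \o (fun z => f_ N z - v z)).
    apply/integrableP; split; first by apply/measurable_EFinP; exact: measurable_funB.
    by apply: le_lt_trans hN _; rewrite ltry.
  have := integrableB mOmega (ifk N) ifv.
  apply: eq_integrable => //.
  by move=> z _ /=; rewrite -EFinB; congr EFin; ring.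
split; first exact: iv.
have h1 := cvg_integral_L1 mOmega ifk iv cmu.
have iF k := integrable_flux_test (tf k).
have h2 := cvg_integral_L1 mOmega iF (integrable_flux mDv EDv) (approximable_flux Af).
have E : (fun k => \int[mu]_(z in Omega) (f_ k z)%:E)%E =
   (fun k => \int[L]_(z in Omega) (flux (hgrad (f_ k)) z)%:E)%E.
  by apply/funext => k; rewrite integral_flux_test.
rewrite E in h1.
by apply: (cvg_unique _ h1 h2).
Qed.

(** * Picone's inequality in integrated form *)

Lemma picone_eps (phi : H -> R) (f_ : nat -> H -> R) (u : H -> R) (a s M : R) :
  test_function Omega phi -> (Lp_energy p Omega (hgrad phi) < +oo)%E ->
  approximable f_ u Du -> {ae L, forall z, Omega z -> 0 <= u z} ->
  {ae mu, forall z, Omega z -> f_ ^~ z @ \oo --> u z} ->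
  {ae mu, forall z, Omega z -> 0 <= u z} -> 0 < a -> 0 < s ->
  (forall z, 0 <= regpow s (p / 2) (phi z) - regpow s (p / 2) 0 <= M) ->
  (\int[mu]_(z in Omega) ((regpow s (p / 2) (phi z) - regpow s (p / 2) 0) *
      regpow s ((1 - p) / 2) (`|u z| + a))%:E <=
    Lp_energy p Omega (hgrad phi) +
    ((p - 1) * (s `^ p + M * (s / a)) / a `^ p)%:E * Lp_energy p Omega Du)%E.
Proof.
move=> tphi Ephi Af uL muf umu a0 s0 AM.
have [tf mu_ mDu' EDu' cDu aef] := Af; have [sphi _ _] := tphi.
have sf k : smooth (f_ k) by case: (tf k).
have mf k := measurable_test (sf k); have mphi := measurable_test sphi.
(* The test function is [A * G (f_ k)]. Subtracting the value at 0 makes [A] vanish where [phi]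
   does. The power of [f_ k + a] is regularized too, because [f_ k] may be negative even where its
   limit is not. *)
set q := (1 - p) / 2; pose A (z : H) := regpow s (p / 2) (phi z) - regpow s (p / 2) 0.
pose A' (z : H) := 2 * (p / 2) * phi z * regpow s (p / 2 - 1) (phi z).
pose G (x : R) := regpow s q (x + a).
pose G' (x : R) := 2 * q * (x + a) * regpow s (q - 1) (x + a).
have q0 : q <= 0 by have hp := p1; rewrite /q; lra.
have sA0 : smooth (regpow s (p / 2) \o phi) by exact: smooth_regpow.
have sA : smooth A by exact: (smoothDl (- regpow s (p / 2) 0) sA0).
have sfa k : smooth (fun z => f_ k z + a) by exact: smoothDl.
have sG k : smooth (fun z => G (f_ k z)) by exact: (smooth_regpow q s0 (sfa k)).
pose h k z := A z * G (f_ k z).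
have tA : test_function Omega A.
  by apply: test_function_sub (tphi) _ => // z pz; rewrite /A pz subrr.
have th k : test_function Omega (h k).
  apply: test_function_sub (tA) _; first exact: smoothM.
  by move=> z Az; rewrite /h Az mul0r.
have tA' : test_function Omega A'.
  have sA' : smooth ((fun z => 2 * (p / 2) * phi z) * (regpow s (p / 2 - 1) \o phi)).
    by apply: smoothM; [exact: smoothZ|exact: smooth_regpow].
  apply: test_function_sub (tphi) _; first exact: sA'.
  by move=> z pz; rewrite /A' pz mulr0 mul0r.
have fh k z : flux (hgrad (h k)) z = A' z * G (f_ k z) * flux (hgrad phi) z +
    A z * G' (f_ k z) * flux (hgrad (f_ k)) z.
  rewrite /flux (hgradM z sA (sG k)).
  rewrite (hgradDl (- regpow s (p / 2) 0) z sA0) (hgrad_regpow (p / 2) z s0 sphi).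
  rewrite (hgrad_regpow q z s0 (sfa k)) (hgradDl a z (sf k)).
  move: (hgrad phi z) (hgrad (f_ k) z) => F1 F2.
  by rewrite dotvDr !dotvZr /G /G' /A' /=; ring.
have [M' hM'] := test_function_bounded tA'.
have Gle x : 0 <= G x <= regpow s q 0.
  by rewrite (ltW (regpow_gt0 _ _ s0)) regpow_le0.
have G'le x : `|G' x| <= `|2 * q| * regpow s (q - 1 + 2^-1) 0.
  rewrite /G' -mulrA normrM ler_wpM2l // normr_mul_regpow_le //; have hp := p1; rewrite /q; lra.
have bd0 z x : `|A' z * G x| <= M' * regpow s q 0.
  have /andP[g0 g1] := Gle x; rewrite normrM (ger0_norm g0).
  by apply: ler_pM.
have bd1 z x : `|A z * G' x| <= M * (`|2 * q| * regpow s (q - 1 + 2^-1) 0).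
  have /andP[A0 A1] := AM z; rewrite normrM (ger0_norm A0).
  by apply: ler_pM.
have mG (w : H -> R) : measurable_fun Omega w -> measurable_fun Omega (fun z => G (w z)).
  by move=> mw; apply: measurable_regpow; apply: measurable_funD.
have mG' (w : H -> R) : measurable_fun Omega w -> measurable_fun Omega (fun z => G' (w z)).
  move=> mw; have mwa : measurable_fun Omega (fun z => w z + a) by exact: measurable_funD.
  apply: measurable_funM; last exact: measurable_regpow.
  by apply: measurable_funM => //; exact: measurable_cst.
have mA := measurable_test sA.
have mA' : measurable_fun Omega A' by apply: measurable_test; case: tA'.
have mau : measurable_fun Omega (fun z => `|u z|).
  by apply: measurableT_comp; [exact: normr_measurable|exact: mu_].
have iphi := integrable_flux_test tphi.
have iF k := integrable_flux_test (tf k).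
have iD := integrable_flux mDu EDu.
have mb0 k : measurable_fun Omega (fun z => A' z * G (f_ k z)).
  by apply: measurable_funM => //; exact: mG.
have mb1 k : measurable_fun Omega (fun z => A z * G' (f_ k z)).
  by apply: measurable_funM => //; exact: mG'.
have mc0 : measurable_fun Omega (fun z => A' z * G `|u z|).
  by apply: measurable_funM => //; exact: (mG (fun z => `|u z|)).
have mc1 : measurable_fun Omega (fun z => A z * G' `|u z|).
  by apply: measurable_funM => //; exact: (mG' (fun z => `|u z|)).
have cG (x_ : nat -> R) (x : R) : x_ @ \oo --> x -> (fun k => G (x_ k)) @ \oo --> G x.
  move=> xc; apply: (continuous_cvg _ (@regpow_continuous R s q s0 (x + a))).
  by apply: cvgD => //; exact: cvg_cst.
have cG' (x_ : nat -> R) (x : R) : x_ @ \oo --> x -> (fun k => G' (x_ k)) @ \oo --> G' x.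
  move=> xc; have xca : (fun k => x_ k + a) @ \oo --> x + a.
    by apply: cvgD => //; exact: cvg_cst.
  apply: cvgM; first by apply: cvgM => //; exact: cvg_cst.
  exact: (continuous_cvg _ (@regpow_continuous R s (q - 1) s0 (x + a)) xca).
have l0 : (fun k => \int[L]_(z in Omega) (A' z * G (f_ k z) * flux (hgrad phi) z)%:E)%E @ \oo -->
    (\int[L]_(z in Omega) (A' z * G `|u z| * flux (hgrad phi) z)%:E)%E.
  have phi0 : (fun k : nat => \int[L]_(z in Omega) `|flux (hgrad phi) z - flux (hgrad phi) z|%:E)%E @ \oo --> 0%E.
    rewrite (_ : (fun _ => _) = cst 0%E); first exact: cvg_cst.
    apply/funext => k; under eq_integral do rewrite subrr normr0.
    exact: integral0.
  apply: (cvg_integral_bounded_mul mOmega (fun _ => iphi) iphi phi0 mb0 mc0 (M := M' * regpow s q 0)).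
  - by move=> k z _; exact: bd0.
  - by move=> z _; exact: bd0.
  - apply: filterS2 aef uL => z h1 h2 Oz; rewrite ger0_norm ?h2 //.
    by apply: cvgM; [exact: cvg_cst|apply: cG; exact: h1].
have l1 : (fun k => \int[L]_(z in Omega) (A z * G' (f_ k z) * flux (hgrad (f_ k)) z)%:E)%E @ \oo -->
    (\int[L]_(z in Omega) (A z * G' `|u z| * flux Du z)%:E)%E.
  apply: (cvg_integral_bounded_mul mOmega iF iD (approximable_flux Af) mb1 mc1
    (M := M * (`|2 * q| * regpow s (q - 1 + 2^-1) 0))).
  - by move=> k z _; exact: bd1.
  - by move=> z _; exact: bd1.
  - apply: filterS2 aef uL => z h1 h2 Oz; rewrite ger0_norm ?h2 //.
    by apply: cvgM; [exact: cvg_cst|apply: cG'; exact: h1].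
have k0 : L.-integrable Omega (fun z => (A' z * G `|u z| * flux (hgrad phi) z)%:E).
  by apply: (bounded_mul_integrable mOmega mc0 _ iphi (M := M' * regpow s q 0)) => z _; exact: bd0.
have k1 : L.-integrable Omega (fun z => (A z * G' `|u z| * flux Du z)%:E).
  by apply: (bounded_mul_integrable mOmega mc1 _ iD
    (M := M * (`|2 * q| * regpow s (q - 1 + 2^-1) 0))) => z _; exact: bd1.
set C := (p - 1) * (s `^ p + M * (s / a)) / a `^ p.
have C0 : 0 <= C.
  have /andP[A0 A1] := AM (0 : H); have M0 := le_trans A0 A1.
  have pm : 0 <= p - 1 by rewrite subr_ge0 ltW.
  rewrite /C; apply: mulr_ge0; last by rewrite invr_ge0 powR_ge0.
  apply: mulr_ge0 => //; apply: addr_ge0; first exact: powR_ge0.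
  by apply: mulr_ge0 => //; apply: divr_ge0; exact: ltW.
set I0 := (\int[L]_(z in Omega) (A' z * G `|u z| * flux (hgrad phi) z)%:E)%E in l0.
set I1 := (\int[L]_(z in Omega) (A z * G' `|u z| * flux Du z)%:E)%E in l1.
have q0f : I0 \is a fin_num by exact: (integrable_fin_num mOmega k0).
have q1f : I1 \is a fin_num by exact: (integrable_fin_num mOmega k1).
have ienergy F : mfield F -> (Lp_energy p Omega F < +oo)%E ->
    L.-integrable Omega (fun z => (enorm (F z) `^ p)%:E).
  move=> mF EF; apply/integrableP; split; first exact: measurable_energy.
  apply: le_lt_trans EF; rewrite /Lp_energy le_eqVlt; apply/orP; left; apply/eqP.
  by apply: eq_integral => z _; rewrite abse_EFin ger0_norm // powR_ge0.
have mgphi := mfield_hgrad sphi.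
have iephi := ienergy _ mgphi Ephi.
have ieD := ienergy _ mDu EDu.
(* The pointwise inequality is applied after the limit in [k]: before it, the second summand
   contains the flux of [hgrad (f_ k)], whose sign is unknown, in place of the flux of [Du], which
   is [enorm (Du z) ^ p]. *)
have I_le : (I0 + I1 <= Lp_energy p Omega (hgrad phi) + C%:E * Lp_energy p Omega Du)%E.
  have e1 := integralD mOmega k0 k1.
  have e2 := integralD mOmega iephi (integrableZl mOmega C ieD).
  have e3 := integralZl mOmega ieD C.
  rewrite -/I0 -/I1 in e1; rewrite -e1 /Lp_energy -e3 -e2.
  apply: le_integral => //.
  - exact: integrableD.
  - by apply: integrableD => //; exact: integrableZl.
  - move=> z _; rewrite -EFinM -!EFinD lee_fin flux_self.
    have /andP[A0 A1] := AM z.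
    have hX := normr_flux (hgrad phi) z.
    have hp := picone_regularized (phi z) p1 s0 a0 (normr_ge0 (u z)) (enorm_ge0 (Du z))
       (enorm_ge0 (hgrad phi z)) hX.
    apply: le_trans hp _; rewrite lerD2l ler_wpM2r ?powR_ge0 // /C.
    rewrite ler_wpM2r ?invr_ge0 ?powR_ge0 // ler_wpM2l; [by []|by rewrite subr_ge0 ltW|].
    rewrite lerD2l ler_wpM2r //; apply: divr_ge0; exact: ltW.
have limI : (fun k => \int[mu]_(z in Omega) (h k z)%:E)%E @ \oo --> (I0 + I1)%E.
  rewrite (_ : (fun _ => _) = fun k =>
     (\int[L]_(z in Omega) (A' z * G (f_ k z) * flux (hgrad phi) z)%:E +
      \int[L]_(z in Omega) (A z * G' (f_ k z) * flux (hgrad (f_ k)) z)%:E)%E).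
    by apply: cvgeD l0 l1; exact: fin_num_adde_defr.
  apply/funext => k; rewrite -(integral_flux_test (th k)).
  have u0 : L.-integrable Omega (fun z => (A' z * G (f_ k z) * flux (hgrad phi) z)%:E).
    by apply: (bounded_mul_integrable mOmega (mb0 k) _ iphi (M := M' * regpow s q 0)) => z _; exact: bd0.
  have u1 : L.-integrable Omega (fun z => (A z * G' (f_ k z) * flux (hgrad (f_ k)) z)%:E).
    by apply: (bounded_mul_integrable mOmega (mb1 k) _ (iF k)
      (M := M * (`|2 * q| * regpow s (q - 1 + 2^-1) 0))) => z _; exact: bd1.
  apply: (etrans _ (integralD mOmega u0 u1)).
  by apply: eq_integral => z _; rewrite fh EFinD.
apply: (@fatou_le _ _ _ mu Omega h).
- exact: mOmega.
- by move=> k; apply: measurable_test; case: (th k).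
- by apply: measurable_funM => //; exact: (mG (fun z => `|u z|)).
- move=> k z _; have /andP[A0 _] := AM z; have /andP[g0 _] := Gle (f_ k z).
  exact: mulr_ge0.
- move=> z _; have /andP[A0 _] := AM z; have /andP[g0 _] := Gle (`|u z|).
  exact: mulr_ge0.
- apply: filterS2 muf umu => z h1 h2 Oz; rewrite ger0_norm ?h2 //.
  by apply: cvgM; [exact: cvg_cst|apply: cG; exact: h1].
move=> e e0.
pose B := (Lp_energy p Omega (hgrad phi) + C%:E * Lp_energy p Omega Du)%E.
have Bf : B \is a fin_num.
  rewrite ge0_fin_numE; last first.
    by apply: adde_ge0; [exact: energy_ge0|apply: mule_ge0; [by rewrite lee_fin|exact: energy_ge0]].
  by apply: lte_add_pinfty; [exact: Ephi|exact: lte_EFin_mul].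
have lt : (I0 + I1 < B + e%:E)%E.
  by apply: le_lt_trans I_le _; rewrite lteDl // lte_fin.
have near1 : \forall k \near \oo, (\int[mu]_(z in Omega) (h k z)%:E < B + e%:E)%E.
  exact: (limI _ (open_ereal_lt' lt)).
by apply: filterS near1 => k hk; exact: (ltW hk).
Qed.

Lemma energy_fineK F : (Lp_energy p Omega F < +oo)%E ->
  Lp_energy p Omega F = (fine (Lp_energy p Omega F))%:E.
Proof.
move=> h; symmetry; apply: fineK; rewrite ge0_fin_numE; first exact: h.
exact: energy_ge0.
Qed.

Section picone.
Variables (f_ : nat -> H -> R) (u : H -> R).
Hypotheses (Af : approximable f_ u Du) (uL : {ae L, forall z, Omega z -> 0 <= u z}).
Hypothesis muf : {ae mu, forall z, Omega z -> f_ ^~ z @ \oo --> u z}.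
Hypothesis umu : {ae mu, forall z, Omega z -> 0 <= u z}.

Let mu_abs : measurable_fun Omega (fun z => `|u z|).
Proof.
by apply: measurableT_comp; [exact: normr_measurable|exact: (approx_measurable Af)].
Qed.

(** Here [s] tends to 0 with [a] fixed. The error in [picone_eps] has the factor [1 / a^p] and
    contains [s / a], which is why [a] goes to 0 only later. *)
Lemma picone_test phi a : test_function Omega phi ->
  (Lp_energy p Omega (hgrad phi) < +oo)%E -> 0 < a ->
  (\int[mu]_(z in Omega) (`|phi z| `^ p * (`|u z| + a) `^ (1 - p))%:E <=
    Lp_energy p Omega (hgrad phi))%E.
Proof.
move=> tphi Ephi a0; have [sphi _ _] := tphi; have mphi := measurable_test sphi.
have [K hK] := test_function_bounded tphi.
pose s : R^nat := harmonic; have s0 k : 0 < s k by exact: harmonic_gt0.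
have s1 k : 0 < s k <= 1 by rewrite s0 /s /harmonic /= invf_le1 // ler1n.
have AM k z := regpow_sub_le p1 (s1 k) (hK z).
have ua z : 0 < `|u z| + a by rewrite ltr_wpDl.
have mua : measurable_fun Omega (fun z => `|u z| + a) by exact: measurable_funD.
apply: (@fatou_le _ _ _ mu Omega (fun k z => (regpow (s k) (p / 2) (phi z) - regpow (s k) (p / 2) 0) *
      regpow (s k) ((1 - p) / 2) (`|u z| + a))).
- exact: mOmega.
- move=> k; apply: measurable_funM; last exact: measurable_regpow.
  by apply: measurable_funB; [exact: measurable_regpow|exact: measurable_cst].
- apply: measurable_funM; apply: (measurableT_comp (measurable_powR _)) => //.
  by apply: measurableT_comp; [exact: normr_measurable|exact: mphi].
- move=> k z _; have /andP[h _] := AM k z.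
  by apply: mulr_ge0 => //; exact/ltW/regpow_gt0.
- by move=> z _; rewrite mulr_ge0 ?powR_ge0.
- apply: aeW => z _; apply: cvgM; first exact: regpow_sub_cvg.
  have -> : (`|u z| + a) `^ (1 - p) = `| `|u z| + a | `^ (2 * ((1 - p) / 2)).
    by rewrite (gtr0_norm (ua z)); congr (_ `^ _); field.
  apply: regpow_cvg_powR => //; first exact: cvg_harmonic.
  by rewrite gt_eqF.
move=> e e0; pose E0 := fine (Lp_energy p Omega Du).
have EE : Lp_energy p Omega Du = E0%:E by exact: energy_fineK.
have errc : (fun k => (p - 1) * (s k `^ p + (K + 1) `^ p * (s k / a)) / a `^ p * E0) @ \oo --> (0 : R).
  have -> : 0 = (p - 1) * (0 + (K + 1) `^ p * (0 / a)) / a `^ p * E0 :> R.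
    by rewrite mul0r mulr0 addr0 mulr0 !mul0r.
  apply: cvgM; last exact: cvg_cst.
  apply: cvgM; last exact: cvg_cst.
  apply: cvgM; first exact: cvg_cst.
  apply: cvgD; first by apply: powR_cvg_0; exact: ltW.
  apply: cvgM; first exact: cvg_cst.
  by apply: cvgM; [exact: cvg_harmonic|exact: cvg_cst].
have near1 : \forall k \near \oo,
    (p - 1) * (s k `^ p + (K + 1) `^ p * (s k / a)) / a `^ p * E0 < e.
  by move/cvgr_lt : errc; apply; exact: e0.
apply: filterS near1 => k hk.
apply: le_trans (picone_eps tphi Ephi Af uL muf umu a0 (s0 k) (AM k)) _.
by rewrite leeD2l // EE -EFinM lee_fin ltW.
Qed.

Lemma picone_approximable (g_ : nat -> H -> R) w Dw a : approximable g_ w Dw ->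
  {ae mu, forall z, Omega z -> g_ ^~ z @ \oo --> w z} -> 0 < a ->
  (\int[mu]_(z in Omega) (`|w z| `^ p * (`|u z| + a) `^ (1 - p))%:E <=
    Lp_energy p Omega Dw)%E.
Proof.
move=> [tg mw mDw EDw cDw _] mug a0.
have mua : measurable_fun Omega (fun z => (`|u z| + a) `^ (1 - p)).
  by apply: (measurableT_comp (measurable_powR _)); exact: measurable_funD.
have mpow (v : H -> R) : measurable_fun Omega v -> measurable_fun Omega (fun z => `|v z| `^ p).
  move=> mv; apply: (measurableT_comp (measurable_powR _)).
  by apply: measurableT_comp; [exact: normr_measurable|exact: mv].
apply: (@fatou_le _ _ _ mu Omega (fun k z => `|g_ k z| `^ p * (`|u z| + a) `^ (1 - p))).
- exact: mOmega.
- move=> k; apply: measurable_funM => //; apply: mpow.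
  by apply: measurable_test; case: (tg k).
- by apply: measurable_funM => //; exact: mpow.
- by move=> k z _; rewrite mulr_ge0 ?powR_ge0.
- by move=> z _; rewrite mulr_ge0 ?powR_ge0.
- apply: filterS mug => z h Oz; apply: cvgM; last exact: cvg_cst.
  by apply: cvg_norm_powR; [exact: ltW|exact: h].
move=> e e0; pose E0 := fine (Lp_energy p Omega Dw).
have EE : Lp_energy p Omega Dw = E0%:E by exact: energy_fineK.
have e2 : 0 < e / 2 by rewrite divr_gt0.
(* A small [t] keeps the leading factor of [powRD_eps] near 1; a constant such as [2^p] in front of
   the energy would spoil the final comparison. *)
have [t t0 ht] : exists2 t : R, 0 < t & (1 + t) `^ p * E0 < E0 + e / 2.
  have hc : (fun k => (1 + (harmonic k : R)) `^ p * E0) @ \oo --> (1 + 0 : R) `^ p * E0.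
    apply: cvgM; last exact: cvg_cst.
    apply: cvg_powR_gt0; first by rewrite addr0.
    by apply: cvgD; [exact: cvg_cst|exact: cvg_harmonic].
  rewrite addr0 powR1 mul1r in hc.
  have lt : E0 < E0 + e / 2 by rewrite ltrDl.
  have near0 : \forall k \near \oo, (1 + (harmonic k : R)) `^ p * E0 < E0 + e / 2.
    by move/cvgr_lt : hc; apply; exact: lt.
  have [k _ /(_ k (leqnn k)) hk] := near0.
  by exists (harmonic k); [exact: harmonic_gt0|exact: hk].
pose c := (1 + t^-1) `^ p.
have c0 : 0 < c by rewrite powR_gt0 // addr_gt0 // invr_gt0.
have near1 := (ecvg0P (fun k => energy_ge0 _)).1 cDw _ (divr_gt0 e2 c0).
apply: filterS near1 => k hk.
have sk : smooth (g_ k) by case: (tg k).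
have mk := mfieldB (mfield_hgrad sk) mDw.
have Ek : (Lp_energy p Omega (hgrad (g_ k)) <= (E0 + e)%:E)%E.
  apply: (@le_trans _ _ (((1 + t) `^ p)%:E * Lp_energy p Omega Dw +
      c%:E * Lp_energy p Omega (fun z => hgrad (g_ k) z - Dw z)%R)%E).
    rewrite /Lp_energy -!ge0_integralZl_EFin ?powR_ge0 //; first last.
    - exact: measurable_energy.
    - by move=> z _; rewrite lee_fin powR_ge0.
    - exact: (measurable_energy mk).
    - by move=> z _; rewrite lee_fin powR_ge0.
    rewrite -ge0_integralD //; first last.
    - by apply: measurable_funeM; exact: (measurable_energy mk).
    - by move=> z _; rewrite -EFinM lee_fin mulr_ge0 ?powR_ge0.
    - by apply: measurable_funeM; exact: measurable_energy.
    - by move=> z _; rewrite -EFinM lee_fin mulr_ge0 ?powR_ge0.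
    apply: ge0_le_integral; first exact: mOmega.
    - by move=> z _; rewrite lee_fin powR_ge0.
    - exact: (measurable_energy (mfield_hgrad sk)).
    - apply: emeasurable_funD; apply: measurable_funeM; first exact: measurable_energy.
      exact: (measurable_energy mk).
    move=> z _; rewrite -!EFinM -EFinD lee_fin.
    apply: le_trans (powRD_eps (ltW p0) t0 (enorm_ge0 _) (enorm_ge0 _)).
    apply: (ge0_ler_powR (ltW p0)); rewrite ?nnegrE ?addr_ge0 ?enorm_ge0 //.
    by rewrite -[X in enorm X <= _](subrK (Dw z)) addrC enormD.
  rewrite EE -EFinM; apply: (@le_trans _ _ ((E0 + e / 2)%:E + (e / 2)%:E)%E).
    apply: leeD; first by rewrite lee_fin ltW.
    rewrite muleC -lee_pdivlMr; last exact: c0.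
    by rewrite -EFinM; exact: hk.
  by rewrite -EFinD -addrA -splitr.
have Efin : (Lp_energy p Omega (hgrad (g_ k)) < +oo)%E.
  by apply: le_lt_trans Ek _; rewrite ltry.
apply: le_trans (picone_test (tg k) Efin a0) _.
by rewrite EE -EFinD.
Qed.

(** As [a] tends to 0, the extra factor [|u| / (|u| + a)], at most 1, keeps the integrand equal to 0
    at the zeros of [u]. The limit then agrees with the convention for quotients by 0, and Fatou's
    lemma applies. *)
Lemma picone_inequality (g_ : nat -> H -> R) w Dw : approximable g_ w Dw ->
  {ae mu, forall z, Omega z -> g_ ^~ z @ \oo --> w z} ->
  (\int[mu]_(z in Omega) (`|w z| `^ p / `|u z| `^ (p - 1))%:E <= Lp_energy p Omega Dw)%E.
Proof.
move=> Ag mug; have [_ mw _ _ _ _] := Ag.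
have mwp : measurable_fun Omega (fun z => `|w z| `^ p).
  apply: (measurableT_comp (measurable_powR _)).
  by apply: measurableT_comp; [exact: normr_measurable|exact: mw].
have mup : measurable_fun Omega (fun z => (`|u z| `^ (p - 1))^-1).
  rewrite (_ : (fun _ => _) = fun z => (`|u z| `^ (p - 1)) `^ (-1)); last first.
    by apply/funext => z; rewrite powR_inv1 // powR_ge0.
  apply: (measurableT_comp (measurable_powR _)).
  exact: (measurableT_comp (measurable_powR _)).
have muk (a : R) : measurable_fun Omega (fun z => (`|u z| + a) `^ (1 - p)).
  by apply: (measurableT_comp (measurable_powR _)); exact: measurable_funD.
have a0 k : 0 < harmonic k :> R by exact: harmonic_gt0.
have ua0 k z : 0 < `|u z| + harmonic k by rewrite ltr_wpDl.
have mr k : measurable_fun Omega (fun z => `|u z| / (`|u z| + harmonic k)).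
  apply: measurable_funM => //.
  rewrite (_ : (fun _ => _) = fun z => (`|u z| + harmonic k) `^ (-1)); last first.
    by apply/funext => z; rewrite powR_inv1 // ltW.
  by apply: (measurableT_comp (measurable_powR _)); exact: measurable_funD.
apply: (@fatou_le _ _ _ mu Omega (fun k z =>
   `|w z| `^ p * (`|u z| + harmonic k) `^ (1 - p) * (`|u z| / (`|u z| + harmonic k)))).
- exact: mOmega.
- by move=> k; apply: measurable_funM => //; exact: measurable_funM.
- exact: measurable_funM.
- move=> k z _; rewrite !mulr_ge0 ?powR_ge0 // invr_ge0; exact: ltW.
- by move=> z _; rewrite divr_ge0 ?powR_ge0.
- apply: aeW => z _.
  have [u0|u0] := eqVneq (u z) 0.
    rewrite u0 normr0 powR0; last by rewrite gt_eqF // subr_gt0.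
    rewrite invr0 mulr0; under eq_fun do rewrite mul0r mulr0.
    exact: cvg_cst.
  have up : 0 < `|u z| by rewrite normr_gt0.
  have hc : (fun k => `|u z| + harmonic k) @ \oo --> `|u z|.
    rewrite -[X in _ --> X]addr0; apply: cvgD; [exact: cvg_cst|exact: cvg_harmonic].
  rewrite -[X in _ --> X]mulr1; apply: cvgM.
    rewrite -powRN opprB; apply: cvgM; first exact: cvg_cst.
    exact: cvg_powR_gt0.
  rewrite -(divff (lt0r_neq0 up)); apply: cvgM; first exact: cvg_cst.
  by apply: cvgV => //; exact: lt0r_neq0.
move=> e e0; apply: nearW => k.
apply: (@le_trans _ _ (Lp_energy p Omega Dw)); last by rewrite leeDl // lee_fin ltW.
apply: le_trans (picone_approximable Ag mug (a0 k)).
apply: ge0_le_integral.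
- exact: mOmega.
- move=> z _; rewrite lee_fin !mulr_ge0 ?powR_ge0 // invr_ge0; exact: ltW.
- by apply/measurable_EFinP; apply: measurable_funM => //; exact: measurable_funM.
- by apply/measurable_EFinP; exact: measurable_funM.
move=> z _; rewrite lee_fin ler_piMr ?mulr_ge0 ?powR_ge0 //.
by rewrite ler_pdivrMr // mul1r lerDl ltW.
Qed.

End picone.

(** [mu]-a.e. the quotient is [u - w^p / u^(p-1)]: the first term integrates to the energy of [Du],
    the second to [J], which Picone's inequality bounds. Integrability is recorded because one of
    the two applications changes the sign of the integrand. *)
Lemma integral_quotient (u w : H -> R) (Dw : H -> V) :
  D1p0 p Omega u Du -> D1p0 p Omega w Dw ->
  quasicontinuous p Omega u -> quasicontinuous p Omega w ->
  {ae L, forall z, Omega z -> 0 <= u z} -> {ae L, forall z, Omega z -> 0 <= w z} ->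
  let f z := (u z `^ p - w z `^ p) / u z `^ (p - 1) in
  mu.-integrable Omega (EFin \o f) /\
  exists2 J : R, (J%:E <= Lp_energy p Omega Dw)%E &
    (\int[mu]_(z in Omega) (f z)%:E = Lp_energy p Omega Du - J%:E)%E.
Proof.
move=> Du0 Dw0 qu qw uL wL f.
have umu := quasicontinuous_ae_ge0 Du0 qu uL.
have wmu := quasicontinuous_ae_ge0 Dw0 qw wL.
have [f_ Af muf] := quasicontinuous_cvg Du0 qu.
have [g_ Ag mug] := quasicontinuous_cvg Dw0 qw.
have mu_ := approx_measurable Af; have mw := approx_measurable Ag.
have EDw := approx_energy Ag.
have [iu eu] := integral_approximable Af muf.
pose h z := `|w z| `^ p / `|u z| `^ (p - 1).
have hle := picone_inequality Af uL muf umu Ag mug.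
have mpow (v : H -> R) q : measurable_fun Omega v -> measurable_fun Omega (fun z => v z `^ q).
  by move=> mv; apply: (measurableT_comp (measurable_powR _)).
have mnorm (v : H -> R) : measurable_fun Omega v -> measurable_fun Omega (fun z => `|v z|).
  by move=> mv; apply: measurableT_comp; [exact: normr_measurable|exact: mv].
have minv (v : H -> R) : (forall z, 0 <= v z) -> measurable_fun Omega v ->
    measurable_fun Omega (fun z => (v z)^-1).
  move=> v0 mv; rewrite (_ : (fun _ => _) = fun z => v z `^ (-1)); first exact: mpow.
  by apply/funext => z; rewrite powR_inv1.
have mh : measurable_fun Omega h.
  apply: measurable_funM; first by apply: mpow; exact: mnorm.
  by apply: minv => [z|]; [exact: powR_ge0|apply: mpow; exact: mnorm].
have mf : measurable_fun Omega f.
  apply: measurable_funM; first by apply: measurable_funB; exact: mpow.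
  by apply: minv => [z|]; [exact: powR_ge0|exact: mpow].
have h0 z : 0 <= h z by rewrite divr_ge0 // powR_ge0.
have ih : mu.-integrable Omega (EFin \o h).
  apply/integrableP; split; first exact/measurable_EFinP.
  apply: le_lt_trans EDw; apply: le_trans hle; rewrite le_eqVlt; apply/orP; left; apply/eqP.
  by apply: eq_integral => z _; rewrite /= ger0_norm.
pose g z := u z - h z.
have mg : measurable_fun Omega g by exact: measurable_funB.
have fg : {ae mu, forall z, Omega z -> f z = g z}.
  apply: filterS2 umu wmu => z hu hw Oz; rewrite /f /g /h !ger0_norm ?hu ?hw //.
  (* At a zero of [u] both sides are 0, as [p - 1 > 0] and the inverse of 0 is 0. *)
  have [->|u0] := eqVneq (u z) 0.
    by rewrite (powR0 (x := p - 1)) ?invr0 ?mulr0 ?subr0 // gt_eqF // subr_gt0.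
  by rewrite mulrBl -(mulr_powRB1 (hu Oz) p0) mulfK // powR_eq0 negb_and u0.
have ig : mu.-integrable Omega (EFin \o g).
  have := integrableB mOmega iu ih; apply: eq_integrable => //.
have mEf : measurable_fun Omega (EFin \o f) by exact/measurable_EFinP.
have mEg : measurable_fun Omega (EFin \o g) by exact/measurable_EFinP.
have efg : (\int[mu]_(z in Omega) (f z)%:E = \int[mu]_(z in Omega) (g z)%:E)%E.
  apply: ae_eq_integral; [exact: mOmega|exact: mEf|exact: mEg|].
  by apply: filterS fg => z e Oz /=; rewrite e.
split.
  apply/integrableP; split; first exact: mEf.
  have /integrableP[_] := ig; apply: le_lt_trans.
  rewrite le_eqVlt; apply/orP; left; apply/eqP; apply: ae_eq_integral.
  - exact: mOmega.
  - by apply: measurableT_comp mEf; exact: abse_measurable.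
  - by apply: measurableT_comp mEg; exact: abse_measurable.
  - by apply: filterS fg => z e Oz /=; rewrite e.
pose J := fine (\int[mu]_(z in Omega) (h z)%:E)%E.
have EJ : (\int[mu]_(z in Omega) (h z)%:E = J%:E)%E.
  by symmetry; apply: fineK; exact: (integrable_fin_num mOmega ih).
exists J; first by rewrite -EJ.
have eB := integralB_EFin mOmega iu ih.
rewrite efg; apply: (etrans eB); rewrite eu EJ; congr (_ - _)%E.
by apply: eq_integral => z _; rewrite flux_self.
Qed.

End potential.

Theorem theorem2p8 (R : realType) (n : nat) (p : R) (Omega : set (heis R n))
    (u1 u2 : heis R n -> R) (Du1 Du2 : heis R n -> 'rV[R]_(n + n))
    (mu1 mu2 : {finite_measure set (heis R n) -> \bar R}) :
  (0 < n)%N -> 1 < p -> bounded_domain Omega ->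
  D1p0 p Omega u1 Du1 -> D1p0 p Omega u2 Du2 ->
  quasicontinuous p Omega u1 -> quasicontinuous p Omega u2 ->
  (0 < mu1 Omega)%E -> (0 < mu2 Omega)%E ->
  pLaplace_eq p Omega Du1 mu1 -> pLaplace_eq p Omega Du2 mu2 ->
  {ae heis_lebesgue, forall z, Omega z -> 0 <= u1 z} ->
  {ae heis_lebesgue, forall z, Omega z -> 0 <= u2 z} ->
  ~ {ae heis_lebesgue, forall z, Omega z -> u1 z = 0} ->
  ~ {ae heis_lebesgue, forall z, Omega z -> u2 z = 0} ->
  (0 <= \int[mu1]_(z in Omega)
          ((u1 z `^ p - u2 z `^ p) / u1 z `^ (p - 1))%:E
      - \int[mu2]_(z in Omega)
          ((u1 z `^ p - u2 z `^ p) / u2 z `^ (p - 1))%:E)%E.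
Proof.
move=> _ p1 [oO _ _ _] D1 D2 q1 q2 _ _ eq1 eq2 u1ge0 u2ge0 _ _.
have [[_ mD1 _ E1 _] _] := D1; have [[_ mD2 _ E2 _] _] := D2.
(* Writing [E1], [E2] for the energies, one gets [J1 <= E2] here and [J2 <= E1] with the roles
   exchanged, and the quantity to estimate is [(E1 - J2) + (E2 - J1)]. *)
have [_ [J1 J1le ->]] := integral_quotient p1 oO mD1 E1 eq1 D1 D2 q1 q2 u1ge0 u2ge0.
have [i2 [J2 J2le e2]] := integral_quotient p1 oO mD2 E2 eq2 D2 D1 q2 q1 u2ge0 u1ge0.
have mO := open_measurable_heis oO.
have -> : (\int[mu2]_(z in Omega) ((u1 z `^ p - u2 z `^ p) / u2 z `^ (p - 1))%:E =
    - (Lp_energy p Omega Du2 - J2%:E))%E.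
  rewrite -e2 -integralN; last first.
    by rewrite fin_num_adde_defl // fin_numN integrable_neg_fin_num.
  by apply: eq_integral => z _ /=; congr EFin; rewrite -mulNr opprB.
rewrite (energy_fineK E1) in J2le *; rewrite (energy_fineK E2) in J1le *.
exact: sube_exchange_ge0 J1le J2le.
Qed.
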